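(* Let $G$ be an abelian group, let $n\geq 1$, let $X\subseteq G$ be a finite, nonempty set, let $L\leq \mathsf H(X)$ be a subgroup, let $S\in \mathcal F(G)$ be a sequence of terms from $G$, and suppose $S'\mid S$ is a subsequence with $\mathsf h(\phi_L(S'))\leq n\leq |S'|$. Then there is a setpartition $\mathscr A=A_1\cdot\ldots\cdot A_n$ with $\mathsf S(\mathscr A)\mid S$, $|\mathsf S(\mathscr A)|=|S'|$ and $|\phi_L(A_i)|=|A_i|$ for all $i\in [1,n]$ such that one of the following holds: 1. $|X+\Sigma_n(S)|\geq |X+\sum_{i=1}^{n}A_i|\geq (|S'|-n)|L|+|X|$ and $\mathscr A$ is equitable; or 2. $X+\Sigma_n(S)=X+\sum_{i=1}^{n}A_i$, $\mathscr A$ is equitable, $\mathrm{supp}(\mathsf S(\mathscr A)^{[-1]}\cdot S)\subseteq Z$ and $|A_i\setminus Z|\leq 1$ for all $i$, where $Z=\bigcap_{i=1}^{n}(A_i+H)$ and $H=\mathsf H(X+\Sigma_n(S))$; or 3. $n=2$, and there exist $\beta\in X$ and a subgroup $K\leq G$ with $L\leq K$ and $K/L\cong (\mathbb Z/2\mathbb Z)^2$ such that $X\setminus (\beta+L)$ and $(A_1+L)\cap (A_2+L)$ are $K$-periodic, $\mathrm{supp}(\mathsf S(\mathscr A)^{[-1]}\cdot S)\subseteq (A_1+L)\cap (A_2+L)$, $\big((A_1+L)\cup (A_2+L)\big)\setminus \big((A_1+L)\cap (A_2+L)\big)$ is a $K$-coset, $\mathsf H(X+\Sigma_n(S))=\mathsf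 H(X+\sum_{i=1}^{n}A_i)=\mathsf H(X)=L$, and $|X+\Sigma_n(S)|=(|S'|-n)|L|+|X|$.
   Context: A sequence $S$ over an abelian group $G$ is a finite unordered list of elements of $G$ (an element of the free abelian monoid $\mathcal F(G)$ on $G$, with operation written $\cdot$); $|S|$ is its length, $\mathsf v_g(S)$ the multiplicity of $g$ in $S$, $\mathsf h(S)=\max_g \mathsf v_g(S)$, $\mathrm{supp}(S)=\{g:\mathsf v_g(S)>0\}$. $T\mid S$ means $T$ is a subsequence, and $S\cdot T^{[-1]}$ (or $T^{[-1]}\cdot S$) is the sequence obtained by removing the terms of $T$ from $S$. $\sigma(T)$ is the sum of the terms of $T$ and $\Sigma_n(S)=\{\sigma(T): T\mid S, |T|=n\}$. For a subgroup $H$, $\phi_H:G\to G/H$ is the natural homomorphism, applied termwise to sequences and elementwise to sets. The stabilizer of $A\subseteq G$ is $\mathsf H(A)=\{g\in G: g+A=A\}$; $A$ is $H$-periodic if it is a union of $H$-cosets. Sumsets: $A_1+\dots+A_n=\{a_1+\dots+a_n: a_i\in A_i\}$. A setpartition over $G$ is a sequence $\mathscr A=A_1\cdot\ldots\cdot A_n$ of finite nonempty subsets $A_i\subseteq G$; its underlying sequence $\mathsf S(\mathscr A)$ is the sequence consisting of all elements of all $A_i$ (each element counted once for each $A_i$ containing it). $\mathscr A$ is equitable if $||A_i|-|A_j||\leq 1$ for all $i,j$. Intervals are discrete: $[a,b]=\{x\in\mathbb Z:a\le x\le b\}$. *)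

(* Defs.v *)
(* G is an arbitrary (possibly infinite) abelian group,
   modelled as a zmodType; finite subsets are finmap's {fset G};
   sequences (elements of F(G)) are seq G, considered up to order. *)
From HB Require Import structures.
From mathcomp Require Import all_boot all_order all_algebra.
From mathcomp Require Import finmap.
Set Implicit Arguments. Unset Strict Implicit. Unset Printing Implicit Defensive.
Import Order.TTheory GRing.Theory.
Local Open Scope ring_scope.
Local Open Scope fset_scope.

Section Defs.
Variable G : zmodType.

Definition subseqm (T S : seq G) : Prop :=
  forall g : G, (count_mem g T <= count_mem g S)%N.

Definition seqdiff (S T : seq G) : seq G := foldr (fun x s => rem x s) S T.

Definition hmult (T : choiceType) (S : seq T) : nat :=
  \max_(x <- S) count_mem x S.

Definition sigma (T : seq G) : G := \sum_(x <- T) x.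

Definition Sigma_n (n : nat) (S : seq G) : {fset G} :=
  [fset sigma (mask (val m) S) | m : (size S).-tuple bool in
     filter (fun m : (size S).-tuple bool => count id m == n)
            (enum {: (size S).-tuple bool})].

Definition sumset (A B : {fset G}) : {fset G} := [fset (a + b)%R | a in A, b in B].
Definition bigsumset (As : seq {fset G}) : {fset G} := foldr sumset [fset 0%R] As.

Definition shift (g : G) (A : {fset G}) : {fset G} := [fset (g + a)%R | a in A].

Definition stab (A : {fset G}) : pred G := fun g => shift g A == A.

Definition is_subgroup (H : {fset G}) : Prop :=
  0%R \in H /\ forall x y, x \in H -> y \in H -> (x - y)%R \in H.

Definition periodic (K : {fset G}) (A : {fset G}) : Prop :=
  forall k, k \in K -> shift k A = A.

(* phi_L : G -> G/L, the image of x being the coset x + L *)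
Definition phi (L : {fset G}) (x : G) : {fset G} := shift x L.
Definition phi_set (L : {fset G}) (A : {fset G}) : {fset {fset G}} :=
  [fset phi L a | a in A].

Definition Sseq (As : seq {fset G}) : seq G := flatten [seq enum_fset A | A <- As].

Definition is_setpartition (As : seq {fset G}) : Prop :=
  forall A, A \in As -> A != fset0.

Definition equitable (As : seq {fset G}) : Prop :=
  forall A B, A \in As -> B \in As -> (#|` A| <= (#|` B|).+1)%N.

Definition in_sum_pred (A : {fset G}) (H : pred G) (x : G) : bool :=
  has (fun a => H (x - a)%R) (enum_fset A).

Definition quot_is_Z2xZ2 (K L : {fset G}) : Prop :=
  exists f : G -> ('Z_2 * 'Z_2)%type,
    (forall x y, x \in K -> y \in K -> f (x + y)%R = (f x + f y)%R) /\
    (forall v, exists2 x, x \in K & f x = v) /\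
    (forall x, x \in K -> (f x == 0%R) = (x \in L)).
End Defs.

(* Main.v *)
(* Dividing out L, one may assume that L is trivial. Put m = |S'|. Among the
   setpartitions of m terms of S into n sets take one maximizing first
   W = X + A_1 + ... + A_n and then the total size of the sets A_i + H, where
   H is the stabilizer of W. If |W| < |X| + m - n, then by Kneser's theorem the
   sets, added in any order, reach a step at which every term of the set being
   added is redundant and congruent modulo H to another of its terms. Moving
   such terms around shows that all unused terms lie in Z and |A_i \ Z| <= 1,
   which forces W = X + Sigma_n(S).

   It remains to make the setpartition equitable. Rearrange its terms so that
   the sum of the |A_i|^2 is minimal while W stays large (or keeps the structure
   just found), and suppose |B| >= |C| + 2 for two of its sets. If n >= 3, fix
   a third set A and let M be the stabilizer of X + A. By minimality every term
   of B not in C is alone in its M-coset. Either the remaining sets are small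
   modulo M, and an exchange argument yields a better arrangement, or the
   theorem for n - 1, applied modulo M, makes them equitable; its third
   alternative (n = 3) is excluded by a count of cosets. If n = 2 and W is
   large, a study of the stabilizers of X + (B \ b) + C, b in B \ C, leaves only
   B = I + (c + K \ 0) and C = I + {c} (disjoint unions), where K is a Klein four
   group, I is K-periodic and X is K-periodic up to one point: the third
   alternative, unless an unused term outside I permits an equitable choice. *)

Require Import Defs.
From HB Require Import structures.
From mathcomp Require Import all_boot all_order all_algebra.
From mathcomp Require Import finmap zify.
From Stdlib Require Import Classical.
Set Implicit Arguments. Unset Strict Implicit. Unset Printing Implicit Defensive.
Import Order.TTheory GRing.Theory.
Local Open Scope fset_scope.
Local Open Scope ring_scope.

(** A term may pass from a large set to a smaller one only if the sumset keeps what is wanted of it,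
    and each failure of such a move is informative: the term is needed, or it is alone in a coset of
    a stabilizer. Kneser's theorem turns this into counting. The large and the structured case share
    one argument, in which the property to be kept is abstracted into a predicate on sumsets and a
    condition on the single sets. For n >= 3 the obstacle is that a partial sum X + A may have a
    nontrivial stabilizer although L is trivial. Hence the induction on n needs arbitrary L, and the
    passage to G/L makes it run over all groups at once. The Klein group arises as follows. For b in
    B \ C the stabilizer of X + (B \ b) + C turns out to be {0, c - b}, of order 2, with one c for
    all b. These differences and 0 form an elementary 2-group K, and |B \ C| = |K| - 1 is at least
    3. If |K| > 4, two terms can be moved at once without loss and the squares decrease; if |K| = 4,
    that move only interchanges the two sizes. *)

(** * Equations in abelian groups by reflection *)

(* An equation holds in every abelian group when both sides have the same integer coefficients at each atom. *)
Inductive zexp := ZV of nat | ZO | ZA of zexp & zexp | ZN of zexp.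

Section Zmod.
Variable G : zmodType.
Fixpoint zeval (e : seq G) t : G :=
  match t with
  | ZV n => nth 0 e n | ZO => 0 | ZA a b => zeval e a + zeval e b | ZN a => - zeval e a
  end.
Fixpoint zcoef t (i : nat) : int :=
  match t with
  | ZV n => (i == n)%:Z | ZO => 0 | ZA a b => zcoef a i + zcoef b i | ZN a => - zcoef a i
  end.
Lemma zevalE e t : zeval e t = \sum_(i < size e) e`_i *~ zcoef t i.
Proof.
elim: t => [n||a IHa b IHb|a IHa] /=; rewrite ?IHa ?IHb.
- case: (ltnP n (size e)) => hn.
    rewrite (bigD1 (Ordinal hn)) //= eqxx mulr1z big1 ?addr0 // => i.
    by rewrite -val_eqE /= => /negPf ->; rewrite mulr0z.
  rewrite nth_default // big1 // => i _; case: eqP => [ni|_]; last by rewrite mulr0z.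
  by move: (ltn_ord i); rewrite ni ltnNge hn.
- by rewrite big1 // => i _; rewrite mulr0z.
- by rewrite -big_split; apply: eq_bigr => i _ /=; rewrite mulrzDr.
- by rewrite -sumrN; apply: eq_bigr => i _; rewrite mulrNz.
Qed.
Lemma zeval_eq e t u :
  all (fun i => zcoef t i == zcoef u i) (iota 0 (size e)) -> zeval e t = zeval e u.
Proof.
move/allP => h; rewrite !zevalE; apply: eq_bigr => i _.
by rewrite (eqP (h i _)) // mem_iota /= ltn_ord.
Qed.
End Zmod.

Ltac zindex x e :=
  match e with
  | cons x _ => constr:(O)
  | cons _ ?e' => let n := zindex x e' in constr:(S n)
  end.
Ltac zadd x e :=
  match e with
  | _ => let _ := zindex x e in e
  | _ => constr:(cons x e)
  end.
Ltac zatoms t e :=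
  match t with
  | GRing.add ?a ?b => let e1 := zatoms a e in zatoms b e1
  | GRing.opp ?a => zatoms a e
  | GRing.zero => e
  | _ => zadd t e
  end.
Ltac zreify t e :=
  match t with
  | GRing.add ?a ?b => let x := zreify a e in let y := zreify b e in constr:(ZA x y)
  | GRing.opp ?a => let x := zreify a e in constr:(ZN x)
  | GRing.zero => constr:(ZO)
  | _ => let n := zindex t e in constr:(ZV n)
  end.
(** Atoms are the maximal subterms not built from addition, opposite and zero. Both sides are
    reified over one list of atoms, so that comparing coefficients is a computation. *)
Ltac zmod :=
  match goal with
  | |- @eq ?T ?a ?b =>
    let e0 := zatoms a (@nil T) in let e := zatoms b e0 in
    let x := zreify a e in let y := zreify b e in
    exact: (@zeval_eq _ e x y isT)
  end.

(** For membership goals that differ from [h] only by the abelian group laws applied to the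
    element. *)
Ltac inz h :=
  match type of h with
  | is_true (in_mem ?y _) =>
    match goal with |- is_true (in_mem ?x _) =>
      (replace x with y by zmod); exact: h end
  end.

Ltac arith_clear :=
  repeat match goal with
  | H : ?T |- _ =>
    lazymatch T with
    | is_true (leq _ _) => revert H
    | @eq nat _ _ => revert H
    | @eq bool (leq _ _) _ => revert H
    | or _ _ => revert H
    | _ => clear H
    end
  end.
Ltac card_gen :=
  repeat match goal with
  | |- context [@bigop.body nat ?I ?x ?r ?F] =>
    let n := fresh "n" in set n := (@bigop.body nat I x r F); clearbody n
  end;
  repeat match goal with
  | |- context [@size ?T ?s] => let n := fresh "n" in set n := (@size T s); clearbody n
  end.
(** Only facts on natural numbers are kept, and sizes and big sums are generalized, so that [lia]
    treats each cardinality as an atom. *)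
Ltac nlia := try (repeat match goal with H := _ |- _ => clearbody H end; arith_clear; intros; repeat match goal with H : or _ _ |- _ => destruct H end;
   repeat match goal with H : is_true (leq _ _) |- _ => revert H | H : @eq nat _ _ |- _ => revert H | H : @eq bool _ _ |- _ => revert H end; card_gen; lia).

(** * Sumsets, stabilizers and periodic sets *)

Section Sumset.
Variable G : zmodType.
Implicit Types (A B C D X Y W K H L : {fset G}) (x y z a b c g h k : G).

Lemma sumsetP A B z : reflect (exists a b, [/\ a \in A, b \in B & z = a + b]) (z \in sumset A B).
Proof.
apply: (iffP idP) => [/imfset2P[a aA [b bB ->]]|[a [b [aA bB ->]]]].
  by exists a, b.
by apply/imfset2P; exists a => //; exists b.
Qed.

Lemma mem_sumset A B a b : a \in A -> b \in B -> a + b \in sumset A B.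
Proof. by move=> aA bB; apply/sumsetP; exists a, b. Qed.

Lemma sumsetC A B : sumset A B = sumset B A.
Proof.
by apply/fsetP=> z; apply/sumsetP/sumsetP=> -[a [b [aA bB ->]]]; exists b, a; rewrite addrC.
Qed.

Lemma sumsetA A B C : sumset A (sumset B C) = sumset (sumset A B) C.
Proof.
apply/fsetP=> z; apply/sumsetP/sumsetP.
  by move=> [a [_ [aA /sumsetP[b [c [bB cC ->]]] ->]]]; exists (a + b), c; rewrite mem_sumset // addrA.
by move=> [_ [c [/sumsetP[a [b [aA bB ->]]] cC ->]]]; exists a, (b + c); rewrite mem_sumset // addrA.
Qed.

Lemma sumsetCA A B C : sumset A (sumset B C) = sumset B (sumset A C).
Proof. by rewrite !sumsetA (sumsetC A). Qed.

Lemma sumset0 A : sumset A [fset 0] = A.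
Proof.
apply/fsetP=> z; apply/sumsetP/idP => [[a [b [aA /fset1P-> ->]]]|zA]; first by rewrite addr0.
by exists z, 0; rewrite fset11 addr0.
Qed.

Lemma sumsetSS A B C D : A `<=` C -> B `<=` D -> sumset A B `<=` sumset C D.
Proof.
move=> /fsubsetP AC /fsubsetP BD; apply/fsubsetP=> z /sumsetP[a [b [aA bB ->]]].
by rewrite mem_sumset ?AC ?BD.
Qed.

Lemma sumset_neq0 A B : A != fset0 -> B != fset0 -> sumset A B != fset0.
Proof.
move=> /fset0Pn[a aA] /fset0Pn[b bB]; apply/fset0Pn; exists (a + b); exact: mem_sumset.
Qed.

Lemma shiftP g A z : (z \in shift g A) = (z - g \in A).
Proof.
apply/imfsetP/idP => [[a aA ->]|zA]; first by have -> : g + a - g = a by zmod.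
by exists (z - g) => //; zmod.
Qed.

Lemma mem_shift g A a : a \in A -> g + a \in shift g A.
Proof. by move=> aA; rewrite shiftP; have -> : g + a - g = a by zmod. Qed.

Lemma card_shift g A : #|` shift g A| = #|` A|.
Proof. by rewrite card_imfset //; apply: addrI. Qed.

Lemma shiftD g h A : shift (g + h) A = shift g (shift h A).
Proof. by apply/fsetP=> z; rewrite !shiftP; have -> : z - (g + h) = z - g - h by zmod. Qed.

Lemma shift0 A : shift 0 A = A.
Proof. by apply/fsetP=> z; rewrite shiftP subr0. Qed.

Lemma shift_sumset g A B : shift g (sumset A B) = sumset (shift g A) B.
Proof.
apply/fsetP=> z; rewrite shiftP; apply/sumsetP/sumsetP => -[a [b [aA bB e]]].
  exists (g + a), b; rewrite mem_shift //; split=> //; rewrite -addrA -e; zmod.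
move: aA; rewrite shiftP => aA; exists (a - g), b; split=> //; rewrite e; zmod.
Qed.

Lemma shift_sub_eq g A : shift g A `<=` A -> shift g A = A.
Proof. by move=> sA; apply/eqP; rewrite eqEfcard sA card_shift leqnn. Qed.

(* The stabilizer as a finite set; it is the true stabilizer only for [A != fset0], as every group element stabilizes the empty set. *)
Definition Stab A : {fset G} :=
  locked [fset g in [fset x - y | x in A, y in A] | shift g A == A].

Lemma stabP g A : reflect (forall a, a \in A -> g + a \in A) (stab A g).
Proof.
apply: (iffP eqP) => [e a aA|h]; first by rewrite -e mem_shift.
apply: shift_sub_eq; apply/fsubsetP=> z; rewrite shiftP => /h.
by have -> : g + (z - g) = z by zmod.
Qed.

Lemma in_Stab A g : A != fset0 -> (g \in Stab A) = stab A g.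
Proof.
move=> /fset0Pn[a aA]; rewrite /Stab -lock !inE /= /stab; apply: andb_idl => /eqP e.
apply/imfset2P; exists (g + a); first by rewrite /= -e mem_shift.
by exists a => //; zmod.
Qed.

Lemma stab0 A : stab A 0. Proof. by apply/stabP=> a; rewrite add0r. Qed.
Lemma stabN A g : stab A g -> stab A (- g).
Proof. by move/eqP=> e; rewrite /stab -{1}e -shiftD addNr shift0. Qed.
Lemma stabD A g h : stab A g -> stab A h -> stab A (g + h).
Proof. by move=> /eqP eg /eqP eh; rewrite /stab shiftD eh eg. Qed.

Lemma sub_stab_sumset A B g : stab A g -> stab (sumset A B) g.
Proof. by move=> /eqP e; rewrite /stab shift_sumset e. Qed.

Lemma sub_stab_sumsetr A B g : stab B g -> stab (sumset A B) g.
Proof. by rewrite sumsetC; apply: sub_stab_sumset. Qed.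

Lemma Stab_subgroup A : A != fset0 -> is_subgroup (Stab A).
Proof.
move=> A0; split=> [|x y]; rewrite !in_Stab // ?stab0 // => hx hy.
by rewrite stabD ?stabN.
Qed.

Section Subgroup.
Variable K : {fset G}.
Hypothesis Kg : is_subgroup K.
Lemma sg0 : 0 \in K. Proof. by case: Kg. Qed.
Lemma sgB x y : x \in K -> y \in K -> x - y \in K. Proof. by case: Kg => _; apply. Qed.
Lemma sgN x : x \in K -> - x \in K.
Proof. by move=> xK; rewrite -sub0r sgB // sg0. Qed.
Lemma sgD x y : x \in K -> y \in K -> x + y \in K.
Proof. by move=> xK yK; rewrite -[y]opprK sgB // sgN. Qed.
Lemma sgNE x : (- x \in K) = (x \in K).
Proof. by apply/idP/idP => /sgN; rewrite ?opprK. Qed.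
Lemma sgBC x y : (x - y \in K) = (y - x \in K).
Proof. by rewrite -sgNE opprB. Qed.
Lemma sg_trans y x z : x - y \in K -> y - z \in K -> x - z \in K.
Proof. by move=> h1 h2; have h := sgD h1 h2; inz h. Qed.
Lemma sg_gt0 : (0 < #|` K|)%N.
Proof. by rewrite cardfs_gt0; apply/fset0Pn; exists 0; apply: sg0. Qed.
Lemma sg_neq0 : K != fset0. Proof. by rewrite -cardfs_gt0 sg_gt0. Qed.

(** Lemmas with [cl] in their name concern [sumset A K], the union of the cosets of [K] that meet
    [A]. *)
Lemma in_cl A z : reflect (exists2 a, a \in A & z - a \in K) (z \in sumset A K).
Proof.
apply: (iffP (sumsetP _ _ _)) => [[a [k [aA kK ->]]]|[a aA zK]].
  by exists a => //; have -> : a + k - a = k by zmod.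
by exists a, (z - a); split=> //; zmod.
Qed.

Lemma sub_cl A : A `<=` sumset A K.
Proof. by apply/fsubsetP=> a aA; apply/in_cl; exists a; rewrite ?subrr ?sg0. Qed.

Lemma card_cl_ge A : (#|` A| <= #|` sumset A K|)%N.
Proof. exact/fsubset_leq_card/sub_cl. Qed.

Lemma clS A B : A `<=` sumset B K -> sumset A K `<=` sumset B K.
Proof.
move=> /fsubsetP s; apply/fsubsetP=> z /in_cl[a /s /in_cl[b bB h1] h2].
by apply/in_cl; exists b => //; apply: sg_trans h2 h1.
Qed.

Lemma cl_idem A : sumset (sumset A K) K = sumset A K.
Proof. by apply/eqP; rewrite eqEfsubset clS ?sub_cl. Qed.

Definition per A := forall k a, k \in K -> a \in A -> k + a \in A.

Lemma per_cl A : per (sumset A K).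
Proof.
move=> k z kK /in_cl[a aA h]; apply/in_cl; exists a => //.
have -> : k + z - a = k + (z - a) by zmod.
exact: sgD.
Qed.

Lemma per_sumset A B : per A -> per (sumset A B).
Proof.
by move=> pA k _ kK /sumsetP[a [b [aA bB ->]]]; rewrite addrA mem_sumset // pA.
Qed.
Lemma per_sumsetr A B : per B -> per (sumset A B).
Proof. by rewrite sumsetC; apply: per_sumset. Qed.

Lemma per_cl_id A : per A -> sumset A K = A.
Proof.
move=> pA; apply/eqP; rewrite eqEfsubset sub_cl andbT; apply/fsubsetP=> z /in_cl[a aA zK].
by have h := pA _ _ zK aA; inz h.
Qed.

Lemma per_stab A : A != fset0 -> per A <-> K `<=` Stab A.
Proof.
move=> A0; split => [pA|/fsubsetP s k a kK]; last by have := s k kK; rewrite in_Stab // => /stabP; apply.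
by apply/fsubsetP=> k kK; rewrite in_Stab //; apply/stabP=> a; apply: pA.
Qed.

Lemma per_mem A x y : per A -> x - y \in K -> (x \in A) = (y \in A).
Proof.
move=> pA h; apply/idP/idP => hA.
  by move: h; rewrite sgBC => /pA/(_ hA) h; inz h.
by have h' := pA _ _ h hA; inz h'.
Qed.

(** Injectivity on [A] of the map to the quotient by [K]. *)
Definition sep A := forall x y, x \in A -> y \in A -> x - y \in K -> x = y.

Lemma card_sep A : sep A -> #|` sumset A K| = (#|` A| * #|` K|)%N.
Proof.
elim/fset1U_rect: A => [_|a A aA IH sA].
  by rewrite cardfs0 mul0n; apply/eqP; rewrite cardfs_eq0; apply/eqP/fsetP=> z; rewrite !inE;
     apply/sumsetP=> -[? [? []]]; rewrite inE.
have -> : sumset (a |` A) K = shift a K `|` sumset A K.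
  apply/fsetP=> z; rewrite inE shiftP; apply/in_cl/orP.
    move=> [b]; rewrite !inE => /orP[/eqP->|bA] h; [by left | right].
    by apply/in_cl; exists b.
  by move=> [h|/in_cl[b bA h]]; [exists a|exists b]; rewrite ?inE ?eqxx ?bA ?orbT.
rewrite cardfsU disjoint_fsetI0 ?cardfs0 ?subn0.
  rewrite IH ?card_shift ?cardfsU1 ?aA //= ?mulSn ?mulnDl //.
  by move=> x y xA yA; apply: sA; rewrite !inE ?xA ?yA orbT.
apply/fdisjointP=> z; rewrite shiftP => h; apply/negP=> /in_cl[b bA h'].
have ab : a - b \in K by move: h; rewrite sgBC => h; apply: sg_trans h h'.
by move: aA; rewrite (sA a b _ _ ab) ?bA // !inE ?eqxx ?bA ?orbT.
Qed.

End Subgroup.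
End Sumset.

(** * Kneser's theorem *)

Section Kneser.
Variable G : zmodType.
Implicit Types (A B C D X Y W K H L : {fset G}) (x y z a b c g h k : G).

Lemma cardfsDI A B : (#|` A `&` B| + #|` A `\` B| = #|` A|)%N.
Proof. exact: cardfsID. Qed.

Lemma card_sub_disj A B C d : A `<=` C -> B `<=` C -> (#|` A `&` B| <= d)%N ->
  (#|` A| + #|` B| <= #|` C| + d)%N.
Proof.
move=> sA sB hd; by rewrite -cardfsUI; apply: leq_add => //; apply: fsubset_leq_card; rewrite fsubUset sA.
Qed.

Lemma card_fim (T : choiceType) (f : G -> T) A : {in A &, injective f} ->
  #|` [fset f a | a in A]| = #|` A|.
Proof. by move=> h; rewrite card_in_imfset. Qed.

Lemma Stab_per A : A != fset0 -> per (Stab A) A.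
Proof. by move=> A0 k a; rewrite in_Stab // => /stabP; apply. Qed.

Section Two.
Variables C1 C2 : {fset G}.
Hypotheses (n1 : C1 != fset0) (n2 : C2 != fset0).
Let H1 := Stab C1.
Let H2 := Stab C2.

(** Both pieces lie in [C2] minus [C1], because [H1] stabilizes [C1] and [H2] stabilizes [C2]; they
    overlap only inside p + (H1 ∩ H2). *)
Lemma row_bound p : p \in C2 -> p \notin C1 ->
  (#|` shift p H1 `&` C2| + #|` shift p H2 `\` C1| <= #|` C2 `\` C1| + #|` H1 `&` H2|)%N.
Proof.
move=> p2 p1; apply: card_sub_disj.
- apply/fsubsetP=> z; rewrite !inE shiftP => /andP[h zC2]; rewrite zC2 andbT.
  by rewrite (per_mem (Stab_subgroup n1) (y := p)) //; apply: Stab_per.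
- apply/fsubsetP=> z; rewrite !inE shiftP => /andP[-> h] /=.
  by rewrite (per_mem (Stab_subgroup n2) (y := p)) //; apply: Stab_per.
rewrite -[X in (_ <= X)%N](card_shift p) fsubset_leq_card //; apply/fsubsetP=> z.
by rewrite !(inE, shiftP) => /andP[/andP[-> _] /andP[_ ->]].
Qed.

(** Translation by [h2] preserves [C2] and carries the row q + H1 to the row p + H1, so both rows
    meet [C2] in equally many points. *)
Lemma row_shift p q h1 h2 : h1 \in H1 -> h2 \in H2 -> p = q + h1 + h2 ->
  (#|` shift p H1 `&` C2| + #|` shift q H1 `\` C2| = #|` H1|)%N.
Proof.
move=> k1 k2 e; rewrite -[RHS](card_shift q) -[RHS](cardfsDI _ C2); congr (_ + _)%N.
rewrite -(card_shift h2 (shift q H1 `&` C2)); congr #|` _|; apply/fsetP=> z.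
rewrite !(inE, shiftP); congr (_ && _).
  rewrite (per_mem (Stab_subgroup n1) (A := H1) (x := z - p) (y := z - h2 - q)) //.
    by move=> *; apply: sgD => //; apply: Stab_subgroup.
  rewrite e (_ : z - _ - _ = - h1); last by zmod.
  by rewrite sgNE //; apply: Stab_subgroup.
rewrite (per_mem (Stab_subgroup n2) (y := z - h2)) //; first exact: Stab_per.
by rewrite (_ : z - _ = h2) //; zmod.
Qed.
End Two.

Section Two'.
Variables C1 C2 : {fset G}.
Hypotheses (n1 : C1 != fset0) (n2 : C2 != fset0).
Let H1 := Stab C1.
Let H2 := Stab C2.
(** If [C1] meets p + H1 + H2, the hypothesis forces the whole coset p + H1 into [C2] and outside
    [C1]. Otherwise the coset p + H2 avoids [C1] and lies in [C2]. *)
Lemma coset_bound p : p \in C2 -> p \notin C1 ->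
  (forall q h1 h2, q \in C1 -> q \notin C2 -> h1 \in H1 -> h2 \in H2 -> p <> q + h1 + h2) ->
  (#|` H1| <= #|` C2 `\` C1|)%N \/ (#|` H2| <= #|` C2 `\` C1|)%N.
Proof.
move=> p2 p1 hno.
have [[r [h1 [h2 [rC k1 k2 e]]]]|no] := classic (exists r h1 h2,
  [/\ r \in C1, h1 \in H1, h2 \in H2 & p = r + h1 + h2]).
  left; rewrite -[X in (X <= _)%N](card_shift p) fsubset_leq_card //; apply/fsubsetP=> z.
  rewrite !inE shiftP => h.
  rewrite (per_mem (Stab_subgroup n1) (y := p)) ?p1 //=; last exact: Stab_per.
  have s1 : is_subgroup H1 by apply: Stab_subgroup.
  have s2 : is_subgroup H2 by apply: Stab_subgroup.
  have z1 : z - h2 \in C1.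
    rewrite (per_mem s1 (y := r)) //; first exact: Stab_per.
    rewrite (_ : z - h2 - r = (z - p) + h1); first exact: sgD.
    by rewrite e; zmod.
  have [z2|z2] := boolP (z - h2 \in C2).
    rewrite (per_mem s2 (y := z - h2)) //; first exact: Stab_per.
    by rewrite (_ : z - _ = h2) //; zmod.
  have pz : p - z \in H1 by rewrite (sgBC s1).
  by case: (hno _ (p - z) h2 z1 z2 pz k2); zmod.
right; rewrite -[X in (X <= _)%N](card_shift p) fsubset_leq_card //; apply/fsubsetP=> z.
have s2 : is_subgroup H2 by apply: Stab_subgroup.
rewrite !inE shiftP => h; apply/andP; split.
  apply/negP=> z1; case: no; exists z, 0, (p - z).
  rewrite (sgBC s2) z1 h sg0; last exact: Stab_subgroup.
  by split=> //; zmod.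
rewrite (per_mem s2 (y := p)) //; exact: Stab_per.
Qed.
End Two'.

(* If some [p \in C2 `\` C1] and [q \in C1 `\` C2] lie in one coset of [H1 + H2], counting in the rows [p + H1] and [q + H2] gives the bound;
   otherwise a whole coset of [H1] or [H2] in [C2] avoids [C1], and vice versa. *)
Lemma stab_union C1 C2 : C1 != fset0 -> C2 != fset0 ->
  (#|` C1| + #|` Stab C1| <= #|` C1 `|` C2| + #|` Stab (C1 `|` C2)|)%N \/
  (#|` C2| + #|` Stab C2| <= #|` C1 `|` C2| + #|` Stab (C1 `|` C2)|)%N.
Proof.
move=> n1 n2.
have [/fsetUidPr -> | /fsubsetPn[q q1 q2]] := boolP (C1 `<=` C2); first by right.
have [/fsetUidPl -> | /fsubsetPn[p p2 p1]] := boolP (C2 `<=` C1); first by left.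
set H1 := Stab C1; set H2 := Stab C2.
have s1 : is_subgroup H1 by apply: Stab_subgroup.
have s2 : is_subgroup H2 by apply: Stab_subgroup.
have n12 : C1 `|` C2 != fset0 by apply/fset0Pn; exists p; rewrite inE p2 orbT.
have hd : (#|` H1 `&` H2| <= #|` Stab (C1 `|` C2)|)%N.
  apply/fsubset_leq_card/fsubsetP=> g /fsetIP[].
  rewrite !in_Stab // => /stabP g1 /stabP g2; apply/stabP=> a.
  by rewrite !inE => /orP[/g1->|/g2->]; rewrite ?orbT.
have d1 : (#|` C1 `|` C2| = #|` C1| + #|` C2 `\` C1|)%N.
  by rewrite -(cardfsDI (C1 `|` C2) C1) fsetUKC fsetDUl fsetDv fset0U.
have d2 : (#|` C1 `|` C2| = #|` C2| + #|` C1 `\` C2|)%N.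
  by rewrite -(cardfsDI (C1 `|` C2) C2) fsetUK fsetDUl fsetDv fsetU0.
have d0 : (0 < #|` H1 `&` H2|)%N.
  by rewrite cardfs_gt0; apply/fset0Pn; exists 0; rewrite inE !sg0.
suff : (#|` H1| <= #|` C2 `\` C1| + #|` H1 `&` H2|)%N \/ (#|` H2| <= #|` C1 `\` C2| + #|` H1 `&` H2|)%N.
  by case=> h; [left; rewrite d1|right; rewrite d2]; nlia.
have [[p' [q' [h1 [h2 [[a1 a2 a3 a4] [a5 a6 e]]]]]]|no] := classic (exists p' q' h1 h2,
  [/\ p' \in C2, p' \notin C1, q' \in C1 & q' \notin C2] /\ [/\ h1 \in H1, h2 \in H2 & p' = q' + h1 + h2]).
  have := row_bound n1 n2 a1 a2; have := row_bound n2 n1 a3 a4.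
  have := row_shift n1 n2 a5 a6 e.
  have e' : q' = p' + (- h2) + (- h1) by rewrite e; zmod.
  have := row_shift n2 n1 (sgN s2 a6) (sgN s1 a5) e'.
  rewrite -/H1 -/H2 (fsetIC H2 H1); nlia.
have c1 := coset_bound n1 n2 p2 p1; have c2 := coset_bound n2 n1 q1 q2.
have {c1} : (#|` H1| <= #|` C2 `\` C1|)%N \/ (#|` H2| <= #|` C2 `\` C1|)%N.
  by apply: c1 => q' h1 h2 k1 k2 k3 k4 e; apply: no; exists p, q', h1, h2.
have {c2} : (#|` H2| <= #|` C1 `\` C2|)%N \/ (#|` H1| <= #|` C1 `\` C2|)%N.
  apply: c2 => q' h1 h2 k1 k2 k3 k4 e; apply: no; exists q', q, (- h2), (- h1).
  split=> //; split; [exact: (sgN s1)|exact: (sgN s2)|].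
  by rewrite e; zmod.
by nlia.
Qed.

(* Dyson's e-transform, by induction on [#|` B|]. *)
Lemma kneser_local n A B a b : (#|` B| <= n)%N -> a \in A -> b \in B ->
  exists C, [/\ C `<=` sumset A B, a + b \in C &
    (#|` A| + #|` B| <= #|` C| + #|` Stab C|)%N].
Proof.
elim: n A B => [|n IH] A B.
  by rewrite leqn0 cardfs_eq0 => /eqP-> _; rewrite inE.
move=> hn aA bB.
have [h|/not_all_ex_not[a' /not_all_ex_not[b' no]]] :=
  classic (forall a' b', a' \in A -> b' \in B -> a' + b' - b \in A).
  (* Here B - b stabilizes A, so the translate b + A has a stabilizer with at least |B| elements. *)
  exists (shift b A); split.
  - by apply/fsubsetP=> z; rewrite shiftP => zA; apply/sumsetP; exists (z - b), b; split=> //; zmod.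
  - by rewrite addrC mem_shift.
  have n0 : shift b A != fset0 by apply/fset0Pn; exists (b + a); rewrite mem_shift.
  rewrite card_shift leq_add2l -[X in (X <= _)%N](card_shift (- b)) fsubset_leq_card //.
  apply/fsubsetP=> z; rewrite shiftP in_Stab // => zB; apply/stabP=> w; rewrite !shiftP => wA.
  have h' := h _ _ wA zB; inz h'.
have [a'A [b'B nA]] : a' \in A /\ b' \in B /\ a' + b' - b \notin A.
  apply: NNPP => hh; apply: no => h1 h2; apply: contraT => h3; case: hh; do 2!split=> //.
(* This shift keeps b, as b + e = a' lies in A, and discards b', as b' + e lies outside A; hence the
   second set shrinks but stays nonempty. *)
pose e := a' - b.
pose A' := A `|` shift e B; pose B' := B `&` shift (- e) A.
have bB' : b \in B' by rewrite inE bB shiftP; have -> : b - - e = a' by rewrite /e; zmod.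
have aA' : a \in A' by rewrite inE aA.
have cB' : (#|` B'| <= n)%N.
  rewrite -ltnS (leq_trans _ hn) // fproper_ltn_card //.
  rewrite fproperEneq fsubsetIl andbT; apply/eqP=> eB.
  move: b'B; rewrite -eB inE shiftP => /andP[_]; apply/negP.
  by have -> : b' - - e = a' + b' - b by rewrite /e; zmod.
have [C [CS abC hC]] := IH _ _ cB' aA' bB'.
exists C; split=> //.
  apply: fsubset_trans CS _; apply/fsubsetP=> z /sumsetP[x [y [xA yB ->]]].
  move: xA yB; rewrite !inE !shiftP => /orP[xA|xB] /andP[yB yA]; first exact: mem_sumset.
  by apply/sumsetP; exists (y - - e), (x - e); split=> //; zmod.
suff : (#|` A'| + #|` B'| = #|` A| + #|` B|)%N by nlia.
rewrite -[X in (_ = _ + X)%N](card_shift e) -[RHS]cardfsUI; congr (_ + _)%N.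
rewrite -[LHS](card_shift e); congr #|` _|; apply/fsetP=> z; rewrite !(inE, shiftP) andbC.
by have -> : z - e - - e = z by zmod.
Qed.

(** Every point of the sumset lies in a subset that meets the bound, by [kneser_local]. By
    [stab_union] the bound survives unions, and the whole sumset is such a union. *)
Lemma kneser_weak A B : A != fset0 -> B != fset0 ->
  (#|` A| + #|` B| <= #|` sumset A B| + #|` Stab (sumset A B)|)%N.
Proof.
move=> A0 B0; set S := sumset A B.
have S0 : S != fset0 by apply: sumset_neq0.
suff : forall T : {fset G}, T != fset0 -> T `<=` S -> exists C, [/\ T `<=` C, C `<=` S &
   (#|` A| + #|` B| <= #|` C| + #|` Stab C|)%N].
  by move=> /(_ S S0 (fsubset_refl _))[C [SC CS]]; rewrite (_ : C = S) //; apply/eqP; rewrite eqEfsubset CS SC.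
elim/fset1U_rect=> [|x T xT IH _ sT]; first by rewrite eqxx.
have [C [CS xC hC]] : exists C, [/\ C `<=` S, x \in C & (#|` A| + #|` B| <= #|` C| + #|` Stab C|)%N].
  have : x \in S by apply: (fsubsetP sT); rewrite !inE eqxx.
  by move=> /sumsetP[a [b [aA bB ->]]]; apply: (kneser_local (leqnn _)).
have [T0|T0] := eqVneq (T : {fset G}) fset0.
  by exists C; split=> //; rewrite T0 fsetU0 fsub1set.
have [|C' [TC' CS' hC']] := IH T0.
  by apply: fsubset_trans sT; apply: fsubsetU1.
exists (C `|` C'); split.
- by rewrite fsubUset fsub1set !inE xC /= (fsubset_trans TC') // fsubsetUr.
- by rewrite fsubUset CS.
have nC : C != fset0 by apply/fset0Pn; exists x.
have nC' : C' != fset0 by apply: fsubset_neq0 TC' T0.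
by case: (stab_union nC nC'); nlia.
Qed.

(** A + H and B + H have the same sum as A and B, so the weak form applied to them is already the
    strong one. *)
Theorem kneser A B : A != fset0 -> B != fset0 -> (#|` sumset A (Stab (sumset A B))| + #|` sumset B (Stab (sumset A B))|
   <= #|` sumset A B| + #|` Stab (sumset A B)|)%N.
Proof.
move=> A0 B0; set H := Stab _.
have sg : is_subgroup H by apply/Stab_subgroup/sumset_neq0.
have e : sumset (sumset A H) (sumset B H) = sumset A B.
  rewrite sumsetA -(sumsetA A) (sumsetC H B) sumsetA cl_idem //.
  by rewrite per_cl_id //; apply/Stab_per/sumset_neq0.
have := @kneser_weak (sumset A H) (sumset B H); rewrite e; apply; apply: sumset_neq0 => //; exact: sg_neq0.
Qed.

End Kneser.

(** * Lone and redundant terms *)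

Section Lone.
Variable G : zmodType.
Implicit Types (A B C D X Y W K H L T : {fset G}) (x y z a b c g h k w : G) (As Bs : seq {fset G}).

(** The obstruction to dropping [x]: an element that is not [lone] can be removed without changing A
    + K. *)
Definition lone K A x := forall y, y \in A -> y - x \in K -> y = x.

Lemma cl_sumset K A B : is_subgroup K ->
  sumset (sumset A K) (sumset B K) = sumset (sumset A B) K.
Proof. by move=> Kg; rewrite (sumsetC A K) -(sumsetA K) (sumsetA A B K) sumsetC cl_idem. Qed.

(** The coset of an element of [T] contributes |K| points to A + K but only one point to A. *)
Lemma card_lone K A T : is_subgroup K -> T `<=` A -> (forall x, x \in T -> lone K A x) ->
  (#|` A| + #|` T| * #|` K| <= #|` sumset A K| + #|` T|)%N.
Proof.
move=> Kg TA lT.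
rewrite -(card_sep Kg); last by move=> x y xT yT h; apply: lT h => //; apply: (fsubsetP TA).
have d0 : (A `\` T) `&` sumset T K = fset0.
  apply/fsetP=> z; rewrite !inE; apply/negP=> /andP[/andP[zT zA] /in_cl[t tT h]].
  by move: zT; rewrite (lT _ tT _ zA h) tT.
have := @card_sub_disj _ (A `\` T) (sumset T K) (sumset A K) 0.
rewrite d0 cardfs0 => h; have {h} := h _ _ isT.
have -> : A `\` T `<=` sumset A K by apply: fsubset_trans (sub_cl Kg A); apply: fsubsetDl.
have -> : sumset T K `<=` sumset A K by apply: sumsetSS.
by move=> /(_ isT isT); rewrite cardfsDS //; have := fsubset_leq_card TA; nlia.
Qed.

Lemma card_lone1 K A x : is_subgroup K -> x \in A -> lone K A x ->
  (#|` A| + #|` K| <= #|` sumset A K| + 1)%N.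
Proof.
move=> Kg xA lx; have := @card_lone K A [fset x] Kg.
rewrite cardfs1 mul1n; apply; first by rewrite fsub1set.
by move=> y /fset1P->.
Qed.

Lemma card_lone2 K A x y : is_subgroup K -> x \in A -> y \in A -> x != y ->
  lone K A x -> lone K A y -> (#|` A| + 2 * #|` K| <= #|` sumset A K| + 2)%N.
Proof.
move=> Kg xA yA xy lx ly; have := @card_lone K A [fset x; y] Kg.
rewrite cardfs2 xy; apply; first by rewrite fsubUset !fsub1set xA.
by move=> z /fset2P[]->.
Qed.

Lemma nlone K A x : ~ lone K A x -> exists y, [/\ y \in A, y != x & y - x \in K].
Proof.
move=> h; apply: NNPP => no; apply: h => y yA yK; apply/eqP; apply: contraT => yx.
by case: no; exists y.
Qed.

(** Kneser's bound leaves room for the holes of A and B modulo H, the stabilizer of A + B. In the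
    coset Q = x + H every point a of A + K outside x + K yields a hole w - a of B. If Q contains
    many such points, B + H exceeds B by as many; if few, A + H exceeds A + K by the rest of Q.
    Together this pays for |H| - |K|. *)
Lemma essential_card_cl K A B x w : is_subgroup K -> per K B -> x \in A -> w \in sumset A B ->
  (forall a, a \in A -> w - a \in B -> a - x \in K) ->
  (#|` sumset A K| + #|` B| <= #|` sumset A B| + #|` K|)%N.
Proof.
move=> Kg pB xA wS hw.
have [a0 [b0 [aA bB we]]] := sumsetP _ _ _ wS.
have A0 : A != fset0 by apply/fset0Pn; exists x.
have B0 : B != fset0 by apply/fset0Pn; exists b0.
have S0 := sumset_neq0 A0 B0.
have := kneser A0 B0; set H := Stab _ => kn.
have Hg : is_subgroup H by apply: Stab_subgroup.
have KH : K `<=` H by rewrite -per_stab //; apply: per_sumsetr.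
pose Q := shift x H; pose A1 := (sumset A K `&` Q) `\` shift x K.
have hA1 : (#|` A1| + #|` B| <= #|` sumset B H|)%N.
  have -> : #|` A1| = #|` [fset w - a | a in A1]|.
    by rewrite card_fim // => u v _ _ /addrI/oppr_inj.
  have := @card_sub_disj _ [fset w - a | a in A1] B (sumset B H) 0; rewrite addn0; apply.
  - apply/fsubsetP=> z /imfsetP[a /=]; rewrite !inE => /andP[aK /andP[_ aQ]] ->.
    apply/in_cl; exists b0 => //; move: aQ; rewrite shiftP => aQ.
    have a0x : a0 - x \in H.
      by apply: (fsubsetP KH); apply: hw => //; rewrite we (_ : _ - a0 = b0) //; zmod.
    have h := sgB Hg a0x aQ; rewrite we.
    by rewrite (_ : a0 + b0 - a - b0 = a0 - x - (a - x)) //; zmod.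
  - exact: sub_cl.
  rewrite leqn0 cardfs_eq0; apply/eqP/fsetP=> z; rewrite [in RHS]inE; apply/negP=> /fsetIP[/imfsetP[a /=]].
  rewrite !(inE, shiftP) => /andP[aK /andP[/in_cl[a' a'A h] aQ]] -> wB.
  have h' : a' - x \in K.
    apply: hw => //; rewrite (per_mem Kg (y := w - a)) //.
    by rewrite (_ : w - a' - (w - a) = a - a') //; zmod.
  by case/negP: aK; apply: sg_trans h h'.
have c1 : (#|` sumset A K `&` Q| <= #|` A1| + #|` K|)%N.
  rewrite -(cardfsDI _ (shift x K)) addnC leq_add2l -[X in (_ <= X)%N](card_shift x).
  by apply: fsubset_leq_card; apply: fsubsetIr.
have : (#|` sumset A K `|` Q| <= #|` sumset A H|)%N.
  apply: fsubset_leq_card; rewrite fsubUset sumsetSS //=.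
  by apply/fsubsetP=> z; rewrite shiftP => h; apply/in_cl; exists x.
have := cardfsUI (sumset A K) Q; rewrite card_shift; nlia.
Qed.

Lemma subgroup0 : is_subgroup [fset (0 : G)].
Proof. by split=> [|x y]; rewrite !inE // => /eqP-> /eqP->; rewrite subr0. Qed.

Lemma per0 A : per [fset 0] A.
Proof. by move=> k a /fset1P->; rewrite add0r. Qed.

(** A point that is lost when x is removed has x as its only summand from A, which is what
    [essential_card_cl] asks for. *)
Lemma irredundant_card_cl K A B x : is_subgroup K -> per K B -> x \in A -> lone K A x ->
  sumset (A `\ x) B <> sumset A B -> (#|` sumset A K| + #|` B| <= #|` sumset A B| + #|` K|)%N.
Proof.
move=> Kg pB xA lx ne.
have sS : sumset (A `\ x) B `<=` sumset A B by apply: sumsetSS => //; apply: fsubD1set.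
have /fsubsetPn[w wS wn] : ~~ (sumset A B `<=` sumset (A `\ x) B).
  by apply/negP=> h; apply: ne; apply/eqP; rewrite eqEfsubset sS h.
apply: (essential_card_cl Kg pB xA wS) => a aA wB; suff -> : a = x by rewrite subrr sg0.
apply/eqP; apply: contraR wn => ax; apply/sumsetP; exists a, (w - a); rewrite !inE ax aA; split=> //; zmod.
Qed.

(** The previous bound with trivial K: an element whose removal matters forces |A| + |B| <= |A + B|
    + 1. *)
Lemma redundant_of_deficit A B x : x \in A -> (#|` sumset A B| + 1 < #|` A| + #|` B|)%N ->
  sumset (A `\ x) B = sumset A B.
Proof.
move=> xA h; apply: NNPP => ne.
have := irredundant_card_cl subgroup0 (per0 (A := B)) xA _ ne; rewrite sumset0 cardfs1 => /(_ _)/wrap[]; last by nlia.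
by move=> y yA /fset1P/eqP; rewrite subr_eq0 => /eqP.
Qed.

(** A lone element adds |H| - 1 to |A + H|, which uses up the |H| that Kneser's theorem can lose. *)
Lemma nlone_of_deficit A B x : A != fset0 -> B != fset0 -> x \in A ->
  (#|` sumset A B| + 1 < #|` A| + #|` B|)%N -> ~ lone (Stab (sumset A B)) A x.
Proof.
move=> A0 B0 xA h lx.
have Hg : is_subgroup (Stab (sumset A B)) by apply/Stab_subgroup/sumset_neq0.
have := kneser A0 B0; have := card_lone1 Hg xA lx; have := card_cl_ge Hg B; nlia.
Qed.

End Lone.

(** * Sumsets of lists of sets *)

Section Lists.
Variable G : zmodType.
Implicit Types (A B C D X Y W K H L T : {fset G}) (x y z a b c g h k w : G) (As Bs : seq {fset G}).

Lemma sumset0l A : sumset [fset 0] A = A.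
Proof. by rewrite sumsetC sumset0. Qed.

(** Makes the iterated sumset a commutative big operator, so that lists of sets can be permuted. *)
HB.instance Definition _ := Monoid.isComLaw.Build {fset G} [fset 0] (@sumset G)
  (@sumsetA G) (@sumsetC G) sumset0l.

Definition ssum X As := sumset X (bigsumset As).

Lemma bigsumsetE As : bigsumset As = \big[@sumset G/[fset 0]]_(A <- As) A.
Proof. by rewrite unlock. Qed.

Lemma ssum_perm X As Bs : perm_eq As Bs -> ssum X As = ssum X Bs.
Proof. by move=> p; rewrite /ssum !bigsumsetE (perm_big _ p). Qed.

Lemma ssum_nil X : ssum X [::] = X. Proof. exact: sumset0. Qed.
Lemma ssum_cons X A As : ssum X (A :: As) = ssum (sumset X A) As.
Proof. by rewrite /ssum /= sumsetA. Qed.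
Lemma ssum_cat X As Bs : ssum X (As ++ Bs) = ssum (ssum X As) Bs.
Proof. by elim: As X => [|A As IH] X; rewrite ?ssum_nil // cat_cons !ssum_cons. Qed.

Definition nonempty As := forall A, A \in As -> A != fset0.

Lemma nonempty_cons A As : nonempty (A :: As) <-> A != fset0 /\ nonempty As.
Proof.
split=> [h|[h1 h2] B]; last by rewrite inE => /orP[/eqP->|/h2].
by split=> [|B hB]; apply: h; rewrite inE ?eqxx ?hB ?orbT.
Qed.

Lemma ssum_neq0 X As : X != fset0 -> nonempty As -> ssum X As != fset0.
Proof.
elim: As X => [|A As IH] X X0; first by rewrite ssum_nil.
by move/nonempty_cons=> [A0 h]; rewrite ssum_cons; apply: IH => //; apply: sumset_neq0.
Qed.

Lemma nonempty_perm As Bs : perm_eq As Bs -> nonempty As -> nonempty Bs.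
Proof. by move=> /perm_mem p h A; rewrite -p; apply: h. Qed.

Lemma nonempty_cat As Bs : nonempty (As ++ Bs) <-> nonempty As /\ nonempty Bs.
Proof.
split=> [h|[h1 h2] A]; last by rewrite mem_cat => /orP[/h1|/h2].
by split=> A hA; apply: h; rewrite mem_cat hA ?orbT.
Qed.

Lemma stab_ssum X As g : stab X g -> stab (ssum X As) g.
Proof. exact: sub_stab_sumset. Qed.

Lemma Stab_ssum X As : X != fset0 -> nonempty As -> Stab X `<=` Stab (ssum X As).
Proof.
move=> X0 h; apply/fsubsetP=> g; rewrite !in_Stab ?ssum_neq0 //; exact: stab_ssum.
Qed.

Lemma kneser_list X As : X != fset0 -> nonempty As -> (#|` sumset X (Stab (ssum X As))| + \sum_(A <- As) #|` sumset A (Stab (ssum X As))|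
   <= #|` ssum X As| + size As * #|` Stab (ssum X As)|)%N.
Proof.
move=> X0 hAs; set H := Stab _.
have Hg : is_subgroup H by apply/Stab_subgroup/ssum_neq0.
suff : forall Bs Y, Y != fset0 -> nonempty Bs -> ssum Y Bs = ssum X As ->
  (#|` sumset Y H| + \sum_(A <- Bs) #|` sumset A H| <= #|` ssum X As| + size Bs * #|` H|)%N.
  by apply.
elim=> [|B Bs IH] Y Y0.
  rewrite ssum_nil big_nil addn0 => _ ->.
  by rewrite per_cl_id ?leq_addr //; apply: Stab_per; apply: ssum_neq0.
move/nonempty_cons=> [B0 hB] e; have := IH (sumset Y B); rewrite -ssum_cons => /(_ (sumset_neq0 Y0 B0) hB e).
rewrite big_cons /=.
set S := sumset (sumset Y B) H.
have SE : S = sumset (sumset Y H) (sumset B H).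
  by rewrite cl_sumset.
have H0 := sg_neq0 Hg.
have S0 : S != fset0 by rewrite SE; rewrite !sumset_neq0.
(* Whatever stabilizes the enlarged partial sum also stabilizes the total. *)
have SH : Stab S = H.
  apply/eqP; rewrite eqEfsubset; apply/andP; split; last by rewrite -per_stab //; apply: per_cl.
  rewrite -[X in _ `<=` X]/(Stab (ssum X As)).
  rewrite (_ : ssum X As = ssum S Bs); first by apply: Stab_ssum.
  rewrite /S {2}/ssum -sumsetA (sumsetC H) sumsetA -/(ssum _ _) -ssum_cons e.
  by rewrite per_cl_id //; apply: Stab_per; apply: ssum_neq0.
have := kneser (sumset_neq0 Y0 H0) (sumset_neq0 B0 H0); rewrite -SE SH !cl_idem // mulSn => h1 h2; nlia.
Qed.

(** If every step satisfied |V + A| + 1 >= |V| + |A|, these inequalities would telescope to the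
    opposite of the hypothesis. *)
Lemma deficit_step X As : (#|` ssum X As| + size As < #|` X| + \sum_(A <- As) #|` A|)%N ->
  exists (L1 : seq {fset G}) A (L2 : seq {fset G}), As = L1 ++ A :: L2 /\
   (#|` sumset (ssum X L1) A| + 1 < #|` ssum X L1| + #|` A|)%N.
Proof.
elim: As X => [|A As IH] X; first by rewrite ssum_nil big_nil; nlia.
rewrite ssum_cons big_cons /=.
have [h _|h h'] := ltnP (#|` sumset X A| + 1) (#|` X| + #|` A|).
  by exists [::], A, As; rewrite ssum_nil.
have [|L1 [B [L2 [-> hB]]]] := IH (sumset X A); first by nlia.
by exists (A :: L1), B, L2; rewrite ssum_cons.
Qed.

End Lists.

(** * Sequences, setpartitions and their sumsets *)

Section Extrema.
Variable T : Type.
Lemma exists_max (P : T -> Prop) (f : T -> nat) b : (exists x, P x) -> (forall x, P x -> f x <= b)%N ->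
  exists2 x, P x & forall y, P y -> (f y <= f x)%N.
Proof.
move=> [x0 Px0] hb; apply: NNPP => no.
have h k : exists2 x, P x & (k <= f x)%N.
  elim: k => [|k [x Px hx]]; first by exists x0.
  apply: NNPP => no'; apply: no; exists x => // y Py; rewrite leqNgt; apply/negP=> lt.
  by apply: no'; exists y => //; apply: leq_ltn_trans hx lt.
by have [x /hb h1 h2] := h b.+1; move: (leq_trans h2 h1); rewrite ltnn.
Qed.

Lemma exists_min (P : T -> Prop) (f : T -> nat) : (exists x, P x) ->
  exists2 x, P x & forall y, P y -> (f x <= f y)%N.
Proof.
move=> [x0 Px0].
have [||x [Px hx] h] := @exists_max (fun x => P x /\ f x <= f x0)%N (fun x => f x0 - f x)%N (f x0).
- by exists x0; rewrite leqnn.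
- by move=> x _; apply: leq_subr.
exists x => // y Py; case: (leqP (f y) (f x0)) => hy; last by apply: leq_trans hx (ltnW hy).
by have := h y (conj Py hy); lia.
Qed.
End Extrema.

Section Perm.
Variable T : eqType.
Implicit Types (x y z : T) (r s : seq T).
Lemma perm_swap x y r : perm_eq (x :: y :: r) (y :: x :: r).
Proof. by rewrite -[x :: _]cat1s -[y :: r]cat1s -[y :: _]cat1s -[x :: r]cat1s perm_catCA. Qed.
Lemma perm_ins y x r s : perm_eq r (x :: s) -> perm_eq (y :: r) (x :: y :: s).
Proof. by move=> p; apply: perm_trans (perm_swap _ _ _); rewrite perm_cons. Qed.
Lemma perm_rot3 x y z r : perm_eq (x :: y :: z :: r) (y :: z :: x :: r).
Proof. by apply: perm_trans (perm_swap _ _ _) _; rewrite perm_cons perm_swap. Qed.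
End Perm.

Section Count.
Variable G : zmodType.
Implicit Types (A B C D X Y W K H L : {fset G}) (x y z a b c g h k w : G) (As Bs R : seq {fset G}) (S T : seq G).

Definition cnt x As := count (fun A => x \in A) As.
Definition tot As := (\sum_(A <- As) #|` A|)%N.

Lemma cnt_cons x A As : cnt x (A :: As) = ((x \in A) + cnt x As)%N. Proof. by []. Qed.
Lemma tot_cons A As : tot (A :: As) = (#|` A| + tot As)%N. Proof. exact: big_cons. Qed.

Lemma count_Sseq x As : count_mem x (Sseq As) = cnt x As.
Proof.
rewrite /Sseq; elim: As => [|A As IH] //=; rewrite count_cat IH count_uniq_mem ?fset_uniq //.
Qed.

Lemma size_Sseq As : size (Sseq As) = tot As.
Proof.
rewrite /Sseq /tot; elim: As => [|A As IH] /=; first by rewrite big_nil.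
by rewrite size_cat IH big_cons.
Qed.

Lemma cnt_perm As Bs x : perm_eq As Bs -> cnt x As = cnt x Bs.
Proof. by move/permP; apply. Qed.

Lemma tot_perm As Bs : perm_eq As Bs -> tot As = tot Bs.
Proof. by move=> p; rewrite /tot (perm_big _ p). Qed.

Lemma perm_pick A As : A \in As -> exists R, perm_eq As (A :: R).
Proof. by move=> h; exists (rem A As); apply: perm_to_rem. Qed.

Lemma ssumS X Y As : X `<=` Y -> ssum X As `<=` ssum Y As.
Proof. by move=> s; apply: sumsetSS. Qed.

Lemma ssum_cons2S X A B A' B' As : sumset A B `<=` sumset A' B' ->
  ssum X (A :: B :: As) `<=` ssum X (A' :: B' :: As).
Proof. by move=> s; rewrite !ssum_cons -!sumsetA; apply/ssumS/sumsetSS. Qed.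

Lemma ssum_consS X A B As : A `<=` B -> ssum X (A :: As) `<=` ssum X (B :: As).
Proof. by move=> s; rewrite !ssum_cons; apply/ssumS/sumsetSS. Qed.

(** The sum x + b survives with the roles exchanged: b is now taken from A, where it differs from x
    since x is not in B. *)
Lemma swap_sub A B x : B `<=` A -> x \notin B -> sumset A B `<=` sumset (A `\ x) (x |` B).
Proof.
move=> /fsubsetP s xB; apply/fsubsetP=> z /sumsetP[a [b [aA bB ->]]].
case: (eqVneq a x) => [->|ax]; last by rewrite mem_sumset // !inE ?ax ?aA ?bB ?orbT.
rewrite addrC mem_sumset // !inE ?eqxx // s // andbT; apply: contraNneq xB => <-; exact: bB.
Qed.

Lemma SigmaP n S z : reflect (exists T, [/\ subseqm T S, size T = n & z = sigma T]) (z \in Sigma_n n S).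
Proof.
apply: (iffP (imfsetP _ _ _ _)) => [[m /=]|[T [/count_subseqP[U /subseqP[m sm ->] p] sT ->]]].
  rewrite mem_filter => /andP[/eqP cm _] ->; exists (mask m S); split=> //.
    by move=> g; apply/leq_count_subseq/mask_subseq.
  by rewrite size_mask ?size_tuple.
exists (tcast sm (in_tuple m)) => /=.
  by rewrite mem_filter mem_enum val_tcast /= -(size_mask sm) -(perm_size p) sT eqxx.
by rewrite val_tcast /= /sigma (perm_big _ p).
Qed.

Lemma bigsumset_pick As z : z \in bigsumset As ->
  exists T, [/\ forall x, (count_mem x T <= cnt x As)%N, size T = size As & z = sigma T].
Proof.
elim: As z => [|A As IH] z /=; first by move/fset1P->; exists [::]; rewrite /sigma big_nil.
move=> /sumsetP[a [u [aA /IH[T [h1 h2 ->]] ->]]]; exists (a :: T); split=> /=.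
- move=> x; rewrite leq_add //; case: eqP => [<-|//]; by rewrite aA.
- by rewrite h2.
- by rewrite /sigma big_cons.
Qed.

Lemma ssum_Sigma X As S : (forall x, cnt x As <= count_mem x S)%N ->
  ssum X As `<=` sumset X (Sigma_n (size As) S).
Proof.
move=> h; apply: sumsetSS => //; apply/fsubsetP=> z /bigsumset_pick[T [h1 h2 ->]].
by apply/SigmaP; exists T; split=> // g; apply: leq_trans (h g).
Qed.

Lemma Sigma_ssum X As S (H : {fset G}) (Z : pred G) : is_subgroup H -> H `<=` Stab (ssum X As) ->
  ssum X As != fset0 ->
  (forall x, count_mem x S <= cnt x As \/ Z x)%N ->
  (forall A, A \in As -> (forall z, Z z -> exists2 a, a \in A & z - a \in H) /\
     (forall x y, x \in A -> y \in A -> ~~ Z x -> ~~ Z y -> x = y)) ->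
  sumset X (Sigma_n (size As) S) `<=` ssum X As.
Proof.
move=> Hg HS W0 hS hA; apply/fsubsetP=> z /sumsetP[x [u [xX /SigmaP[T [sT szT ->]] ->]]].
suff [h [v [hH vA ->]]] : exists h v, [/\ h \in H, v \in bigsumset As & sigma T = h + v].
  have := fsubsetP HS _ hH; rewrite in_Stab // => /stabP/(_ _ (mem_sumset xX vA)) e; inz e.
have {sT hS} : (forall x, ~~ Z x -> count_mem x T <= cnt x As)%N.
  by move=> y Zy; apply: leq_trans (sT y) _; case: (hS y) => //; rewrite (negPf Zy).
have {HS W0} := erefl (size T); move: {2}(size T) => n.
elim: n T As szT hA {xX z} => [|n IH] T As szT hA sT hc.
  move: szT; rewrite (size0nil sT) => /esym/size0nil->; exists 0, 0.
  by rewrite sg0 // inE /sigma big_nil addr0.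
(* The last premise postpones the terms of Z until no term outside Z is left; otherwise a block
   needed for such a term could be spent on a term of Z. *)
have pick y A : y \in T -> A \in As -> (Z y \/ y \in A) -> (Z y -> all Z T) ->
   exists h v, [/\ h \in H, v \in bigsumset As & sigma T = h + v].
  move=> yT AAs yA ya.
  have [R pR] := perm_pick AAs; have pT := perm_to_rem yT.
  have hAR B : B \in R -> B \in As by rewrite (perm_mem pR) inE => ->; rewrite orbT.
  have [a aA yaH] : exists2 a, a \in A & y - a \in H.
    case: yA => [|yA]; first by case: (hA _ AAs) => h _; apply: h.
    by exists y; rewrite ?subrr ?sg0.
  have [||||h [v [hH vR e]]] := IH (rem y T) R.
  - by have := perm_size pR; have := perm_size pT; rewrite /= szT => -> [].
  - by move=> B /hAR; apply: hA.
  - by have := perm_size pT; rewrite sT => -[].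
  - move=> w Zw; have := hc w Zw.
    rewrite (cnt_perm _ pR) cnt_cons (permP pT) /=.
    case: (eqVneq y w) Zw => [<-|yw] Zw.
      by case: (y \in A); rewrite /= ?add1n ?ltnS // add0n => /ltnW.
    case: (boolP (w \in A)) => // wA; case: (boolP (Z y)) => [/ya al _|Zy].
      rewrite (count_memPn _) //; apply: contra Zw => /mem_rem; exact: (allP al).
    case: yA => [|yA]; first by rewrite (negPf Zy).
    by case: (hA _ AAs) => _ /(_ _ _ yA wA Zy Zw) e; rewrite e eqxx in yw.
  exists (y - a + h), (a + v); split; first exact: sgD.
    have := ssum_perm [fset 0] pR; rewrite /ssum !(sumsetC [fset 0]) !sumset0 => ->.
    exact: mem_sumset.
  rewrite /sigma (perm_big _ pT) big_cons /= -/(sigma _) e; zmod.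
case: (boolP (all Z T)) => [al|/allPn[y yT Zy]].
  case: T szT sT pick al {hc} => // y T szT sT pick al; case: As szT pick {hA} => // A As _ /(_ y A).
  by rewrite !inE !eqxx; apply=> //; left; case/andP: al.
have : (0 < cnt y As)%N by apply: leq_trans (hc y Zy); rewrite -has_count; apply/hasP; exists y => /=.
rewrite -has_count => /hasP[A AAs yA]; apply: (pick y A) => //; first by right.
by rewrite (negPf Zy).
Qed.

(** Redundancy is meant for one term at a time: removing two terms of [A] may well shrink the
    sum. *)
Definition soft X A R := forall x, x \in A ->
  ssum X ((A `\ x) :: R) = ssum X (A :: R) /\ ~ lone (Stab (ssum X (A :: R))) A x.

Lemma soft_perm X A R R' : perm_eq R R' -> soft X A R -> soft X A R'.
Proof.
move=> p h x xA; have [h1 h2] := h x xA.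
have e B : ssum X (B :: R) = ssum X (B :: R') by apply: ssum_perm; rewrite perm_cons.
by rewrite -!e.
Qed.

(** At a step with a deficit the block is soft within the partial sum. Both properties persist in
    the total, whose stabilizer contains that of the partial sum. *)
Lemma deficit_soft X As : X != fset0 -> nonempty As ->
  (#|` ssum X As| + size As < #|` X| + tot As)%N ->
  exists A R, perm_eq As (A :: R) /\ soft X A R.
Proof.
move=> X0 hA /deficit_step[L1 [A [L2 [e h]]]]; exists A, (L1 ++ L2); split.
  by rewrite e -cat1s perm_catCA.
move: hA; rewrite e => /nonempty_cat[hL1 /nonempty_cons[A0 hL2]].
have pm B : perm_eq (B :: L1 ++ L2) (L1 ++ B :: L2) by rewrite perm_sym -cat1s perm_catCA.
move=> x xA; rewrite !(ssum_perm _ (pm _)) !ssum_cat !ssum_cons.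
have V0 := ssum_neq0 X0 hL1.
split; first by rewrite sumsetC (redundant_of_deficit xA) 1?sumsetC // addnC; nlia.
move=> lx; have := @nlone_of_deficit _ A (ssum X L1) x A0 V0 xA; rewrite (sumsetC A) addnC.
rewrite [(#|` A| + _)%N]addnC addnC => /(_ _)/wrap[]; first by nlia.
apply=> y yA yx; apply: lx => //; apply: fsubsetP yx.
by apply: Stab_ssum => //; apply: sumset_neq0.
Qed.

(* Moving terms of the soft blocks into [B] must stop, since [#|` B|] is bounded: then [B] itself, or some [A `<=` B], is soft. *)
Lemma absorb X (I : {fset G} -> seq {fset G} -> Prop) (m : nat) B R : X != fset0 ->
  (forall B R, I B R -> #|` B| <= m)%N ->
  (forall B R R', perm_eq R R' -> I B R -> I B R') ->
  (forall B R, I B R -> nonempty (B :: R) /\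
      #|` ssum X (B :: R)| + size (B :: R) < #|` X| + tot (B :: R))%N ->
  (forall B A R c, I B (A :: R) -> c \in A -> c \notin B -> soft X A (B :: R) ->
     I (c |` B) ((A `\ c) :: R)) ->
  I B R -> exists B R, I B R /\ (soft X B R \/
     exists A R', [/\ perm_eq R (A :: R'), soft X A (B :: R'), A `<=` B & I B (A :: R')]).
Proof.
move=> X0 hb hp hd hs; move: {-1}(m - #|` B|)%N (erefl (m - #|` B|)%N) => k.
elim: k B R => [|k IH] B R ek IB.
all: have [ne df] := hd _ _ IB; have [A [R1 [p sA]]] := deficit_soft X0 ne df.
all: have : A \in B :: R by rewrite (perm_mem p) inE eqxx.
all: rewrite inE => /orP[/eqP eA|AR].
all: try by exists B, R; split=> //; left; subst A; move: p; rewrite perm_cons perm_sym => /soft_perm; apply.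
all: have [R' pR] := perm_pick AR.
all: have sA' : soft X A (B :: R') by
  (apply: soft_perm sA; rewrite -(perm_cons A) perm_sym; apply: perm_trans p;
   rewrite perm_sym; apply: perm_ins).
all: have IB' := hp _ _ _ pR IB.
all: case: (boolP (A `<=` B)) => [sub|/fsubsetPn[c cA cB]];
  first by (exists B, R; split=> //; right; exists A, R').
all: have IB2 := hs _ _ _ _ IB' cA cB sA'; have := hb _ _ IB2; rewrite cardfsU1 cB add1n => hlt.
- by move: ek hlt; nlia.
- by apply: IH IB2; rewrite cardfsU1 cB add1n; move: ek hlt; nlia.
Qed.

End Count.

(** * The dichotomy for setpartitions that need not be equitable *)

Section PartA.
Variable G : zmodType.
Implicit Types (A B C D X Y W K H L : {fset G}) (x y z a b c g h k w : G) (As Bs R : seq {fset G}) (S T : seq G).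

Definition partition_in n S m As :=
  [/\ size As = n, nonempty As, forall x, (cnt x As <= count_mem x S)%N & tot As = m].

Lemma partition_in_perm n S m As Bs : perm_eq As Bs -> partition_in n S m As -> partition_in n S m Bs.
Proof.
move=> p [h1 h2 h3 h4]; split; rewrite -?(perm_size p) -?(tot_perm p) //.
  exact: nonempty_perm p h2.
by move=> x; rewrite -(cnt_perm x p).
Qed.

(** Start from n singletons; a further term is always missing from some set, since it occurs at most
    n times in all. *)
Lemma deal n S : (forall x, count_mem x S <= n)%N -> (n <= size S)%N ->
  exists As, [/\ size As = n, nonempty As & forall x, cnt x As = count_mem x S].
Proof.
move=> hc hs; have sT : size (take n S) = n by rewrite size_takel.
suff H : forall T As, nonempty As -> (forall x, cnt x As + count_mem x T <= size As)%N ->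
   exists Bs, [/\ size Bs = size As, nonempty Bs & forall x, cnt x Bs = cnt x As + count_mem x T]%N.
  have c0 x : cnt x [seq [fset y] | y <- take n S] = count_mem x (take n S).
    by elim: (take n S) => //= y s ->; rewrite inE eq_sym.
  have [||Bs [h1 h2 h3]] := H (drop n S) [seq [fset x] | x <- take n S].
  - by move=> A /mapP[x _ ->]; apply/fset0Pn; exists x; rewrite fset11.
  - by move=> x; rewrite c0 -count_cat cat_take_drop size_map sT.
  by exists Bs; rewrite h1 size_map sT; split=> // x; rewrite h3 c0 -count_cat cat_take_drop.
elim=> [|y T IH] As hA h; first by exists As; split=> // x; rewrite addn0.
have : ~~ all (fun A => y \in A) As.
  by rewrite all_count neq_ltn; have := h y; rewrite /= eqxx addnCA add1n => h'; rewrite (leq_trans _ h') // ltnS leq_addr.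
move=> /allPn[A AAs yA]; have [R p] := perm_pick AAs.
have [||Bs [h1 h2 h3]] := IH ((y |` A) :: R).
- have /nonempty_cons[_ hR] := nonempty_perm p hA; apply/nonempty_cons; split=> //.
  by apply/fset0Pn; exists y; rewrite !inE eqxx.
- move=> x; have := h x; rewrite (cnt_perm x p) (perm_size p) /= !inE [y == x]eq_sym.
  by case: eqVneq => [->|_] /=; rewrite ?(negPf yA) //; lia.
exists Bs; rewrite h1 (perm_size p); split=> // x; rewrite h3 (cnt_perm x p) /= !inE [y == x]eq_sym.
by case: eqVneq => [->|_] /=; rewrite ?(negPf yA) //; lia.
Qed.

Lemma tot_count As S : (forall x, cnt x As = count_mem x S) -> tot As = size S.
Proof.
move=> h; rewrite -size_Sseq; apply: perm_size; apply/allP => x _ /=.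
by rewrite count_Sseq h.
Qed.

Lemma cl_cons H A x : sumset (x |` A) H = shift x H `|` sumset A H.
Proof.
apply/fsetP=> z; rewrite inE shiftP; apply/in_cl/orP.
  move=> [b]; rewrite !inE => /orP[/eqP->|bA] h; [by left | right].
  by apply/in_cl; exists b.
by move=> [h|/in_cl[b bA h]]; [exists x|exists b]; rewrite ?inE ?eqxx ?bA ?orbT.
Qed.

Lemma cl_add H A x : is_subgroup H -> x \notin sumset A H ->
  #|` sumset (x |` A) H| = (#|` sumset A H| + #|` H|)%N.
Proof.
move=> Hg xA; rewrite cl_cons.
rewrite cardfsU disjoint_fsetI0 ?cardfs0 ?subn0 ?card_shift 1?addnC //.
apply/fdisjointP=> z; rewrite shiftP => h; apply: contra xA => /in_cl[b bA h'].
by apply/in_cl; exists b => //; apply: sg_trans h'; rewrite // sgBC.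
Qed.

Lemma cl_sub H A B z : A `<=` B -> z \in sumset A H -> z \in sumset B H.
Proof. by move=> s; apply/fsubsetP/sumsetSS. Qed.

Lemma cl_rem H A x : is_subgroup H -> ~ lone H A x -> sumset (A `\ x) H = sumset A H.
Proof.
move=> Hg /nlone[y [yA yx h]]; apply/eqP; rewrite eqEfsubset sumsetSS ?fsubD1set //=.
apply/fsubsetP=> z /in_cl[a aA ha]; apply/in_cl.
case: (eqVneq a x) ha => [->|ax] ha; last by exists a => //; rewrite !inE ax.
by exists y; rewrite ?inE ?yx //; apply: sg_trans ha _; rewrite // sgBC.
Qed.

Lemma cl_addin H A x : is_subgroup H -> x \in sumset A H -> sumset (x |` A) H = sumset A H.
Proof.
move=> Hg xA; apply/eqP; rewrite eqEfsubset clS //=; last by rewrite fsubUset fsub1set xA sub_cl.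
by rewrite sumsetSS // fsubsetUr.
Qed.

Lemma sum_leq (As : seq {fset G}) (f : {fset G} -> nat) (c : nat) :
  (forall A, A \in As -> f A <= c)%N -> (\sum_(A <- As) f A <= size As * c)%N.
Proof.
elim: As => [|A As IH] h; first by rewrite big_nil.
rewrite big_cons mulSn leq_add ?h ?inE ?eqxx // IH // => B hB; apply: h; by rewrite inE hB orbT.
Qed.

Lemma partition_in_move n S m A B R x : x \in A -> x \notin B -> A `\ x != fset0 ->
  partition_in n S m (A :: B :: R) -> partition_in n S m ((A `\ x) :: (x |` B) :: R).
Proof.
move=> xA xB A0 [h1 /nonempty_cons[_ /nonempty_cons[B0 h2]] h3 h4]; split=> //.
- apply/nonempty_cons; split=> //; apply/nonempty_cons; split=> //.
  by apply/fset0Pn; exists x; rewrite !inE eqxx.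
- move=> y; have := h3 y; rewrite !cnt_cons !inE.
  by case: eqVneq => [->|] //=; rewrite xA (negPf xB).
- by move: h4; rewrite !tot_cons cardfsU1 xB (cardfsD1 x A) xA; nlia.
Qed.

Lemma nlone_rem_neq0 H A x : ~ lone H A x -> A `\ x != fset0.
Proof. by move=> /nlone[y [yA yx _]]; apply/fset0Pn; exists y; rewrite !inE yx. Qed.

Lemma soft_move X A B R x : soft X A (B :: R) -> x \in A ->
  ssum X (A :: B :: R) `<=` ssum X ((A `\ x) :: (x |` B) :: R).
Proof.
move=> s xA; have [<- _] := s x xA.
by apply: ssum_cons2S; apply: sumsetSS => //; apply: fsubsetUr.
Qed.

(** Each claim on the structure is obtained by moving a redundant term and comparing with the
    maximal W and the maximal total of |A + H|. Only the uniqueness outside Z needs one more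
    extremal choice. *)
Lemma large_or_structured X S n m : X != fset0 -> (exists As, partition_in n S m As) ->
  exists As, partition_in n S m As /\ (#|` X| + m <= #|` ssum X As| + n \/
    let H := Stab (ssum X As) in
    let Z := fun x => all (fun A => x \in sumset A H) As in
    (forall x, cnt x As < count_mem x S -> Z x) /\
    (forall A, A \in As -> forall x y, x \in A -> y \in A -> ~~ Z x -> ~~ Z y -> x = y))%N.
Proof.
move=> X0 ex.
have [|As0 c0 max0] := @exists_max _ (partition_in n S m) (fun As => #|` ssum X As|) (#|` sumset X (Sigma_n n S)|) ex.
  by move=> As [<- _ h _]; apply/fsubset_leq_card/ssum_Sigma.
case: (leqP (#|` X| + m) (#|` ssum X As0| + n)) => lt; first by exists As0; split=> //; left.
move eW0 : (ssum X As0) lt max0 => W0 lt max0; pose H := Stab W0.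
have W00 : W0 != fset0 by rewrite -eW0 ssum_neq0 //; case: c0.
have Hg : is_subgroup H by apply: Stab_subgroup.
have W0max As : partition_in n S m As -> W0 `<=` ssum X As -> ssum X As = W0.
  by move=> /max0 h1 h2; apply/esym/eqP; rewrite eqEfcard h2.
pose phis As := (\sum_(A <- As) #|` sumset A H|)%N.
have phis_perm As Bs : perm_eq As Bs -> phis As = phis Bs.
  by move=> p; apply: perm_big.
have phisC A R : phis (A :: R) = (#|` sumset A H| + phis R)%N by apply: big_cons.
have [||As1 [c1 eW1] max1] := @exists_max _ (fun As => partition_in n S m As /\ ssum X As = W0) phis
     (n * #|` sumset [fset x in S] H|)%N.
- by exists As0.
- move=> As [[<- _ hc _] _]; apply: sum_leq => A AAs; apply/fsubset_leq_card/sumsetSS => //.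
  apply/fsubsetP=> x xA; rewrite inE -has_pred1 has_count; apply: leq_trans (hc x).
  by rewrite -has_count; apply/hasP; exists A.
move ep : (phis As1) max1 => p max1.
pose mx As := [/\ partition_in n S m As, ssum X As = W0 & phis As = p].
have mx_perm As Bs : perm_eq As Bs -> mx As -> mx Bs.
  move=> pe [h1 h2 h3]; split; first exact: partition_in_perm pe h1.
    by rewrite -(ssum_perm X pe).
  by rewrite -(phis_perm _ _ pe).
have mx_def As : mx As -> nonempty As /\ (#|` ssum X As| + size As < #|` X| + tot As)%N.
  by move=> [[-> h _ ->] -> _].
have mx_soft As : mx As -> exists A R, [/\ perm_eq As (A :: R), soft X A R & mx (A :: R)].
  move=> mA; have [h1 h2] := mx_def _ mA; have [A [R [pe sA]]] := deficit_soft X0 h1 h2.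
  by exists A, R; split=> //; apply: mx_perm mA.
have softH A R x : mx (A :: R) -> soft X A R -> x \in A -> ~ lone H A x.
  by move=> [_ e _] s xA; have [_] := s x xA; rewrite e.
(* As x has a companion in A modulo H, A + H does not change; were x new to B modulo H, the total
   would grow by |H|. *)
have mx_move A B R x : mx (A :: B :: R) -> x \in A -> x \notin B -> ~ lone H A x ->
    W0 `<=` ssum X ((A `\ x) :: (x |` B) :: R) ->
    mx ((A `\ x) :: (x |` B) :: R) /\ x \in sumset B H.
  move=> [c e f] xA xB nl sub.
  have c' := partition_in_move xA xB (nlone_rem_neq0 nl) c.
  have e' := W0max _ c' sub.
  have := max1 _ (conj c' e').
  move: f; rewrite !phisC (cl_rem Hg nl) => f.
  case: (boolP (x \in sumset B H)) => [xB' _|xB']; last by rewrite (cl_add Hg xB'); have := sg_gt0 Hg; move: f; nlia.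
  by split=> //; split=> //; rewrite !phisC (cl_rem Hg nl) (cl_addin Hg xB').
have mx_smove A B R x : mx (A :: B :: R) -> soft X A (B :: R) -> x \in A -> x \notin B ->
    mx ((A `\ x) :: (x |` B) :: R) /\ x \in sumset B H.
  move=> mA sA xA xB; apply: mx_move => //; first exact: softH mA sA xA.
  by case: mA => _ <- _; apply: soft_move.
have F1 As A y : mx As -> A \in As -> (cnt y As < count_mem y S)%N -> y \in sumset A H.
  move=> mA AAs hy; apply: contraT => yA.
  have [D [R [pe sD mD]]] := mx_soft _ mA.
  have D0 : D != fset0 by case: mD => -[_ /nonempty_cons[]].
  have [x xD] := fset0Pn _ D0; have nl := softH _ _ _ mD sD xD.
  have clD := cl_rem Hg nl; have [eD _] := sD x xD.
  have yA' : y \notin A by apply: contra yA => /(fsubsetP (sub_cl Hg A)).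
  rewrite (cnt_perm y pe) in hy; move: AAs; rewrite (perm_mem pe) inE; case/orP=> [/eqP eA|AR].
    subst A; have /(_ _)/wrap[] := max1 ((y |` (D `\ x)) :: R).
      have c' : partition_in n S m (y |` D `\ x :: R).
        case: mD => -[h1 /nonempty_cons[_ h2] h3 h4] _ _; split=> //.
        - by apply/nonempty_cons; split=> //; apply/fset0Pn; exists y; rewrite !inE eqxx.
        - move=> z; have := h3 z; move: hy; rewrite !cnt_cons !inE (negPf yA') /=.
          case: eqVneq => [->|_] /=; first by nlia.
          by case: (z \in D) => /=; rewrite ?andbT ?andbF //; case: (z != x) => /=; nlia.
        - move: h4; rewrite !tot_cons cardfsU1 !inE (negPf yA') andbF /= (cardfsD1 x D) xD; nlia.
      split=> //; apply: W0max => //; case: mD => _ <- _; rewrite -eD.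
      by apply: ssum_consS; apply: fsubsetUr.
    by case: mD => _ _ <-; rewrite !phisC cl_add // clD //; have := sg_gt0 Hg; nlia.
  have [R' pR] := perm_pick AR.
  have pD : perm_eq (D :: R) (D :: A :: R') by rewrite perm_cons.
  have {}mD := mx_perm _ _ pD mD; rewrite (cnt_perm y pD) in hy.
  have {}sD := soft_perm pR sD; have {}eD := proj1 (sD x xD).
  have /(_ _)/wrap[] := max1 ((D `\ x) :: (y |` A) :: R').
    have c' : partition_in n S m (D `\ x :: y |` A :: R').
      case: mD => -[h1 /nonempty_cons[_ /nonempty_cons[_ h2]] h3 h4] _ _; split=> //.
      - apply/nonempty_cons; split; first exact: nlone_rem_neq0 nl.
        by apply/nonempty_cons; split=> //; apply/fset0Pn; exists y; rewrite !inE eqxx.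
      - move=> z; have := h3 z; move: hy; rewrite !cnt_cons !inE (negPf yA') /=.
        case: (eqVneq z y) => [->|_] /=; first by rewrite (negPf yA'); case: (y \in D); rewrite ?andbT ?andbF //; case: (y != x) => /=; nlia.
        by case: (z \in D) => /=; rewrite ?andbT ?andbF //; case: (z != x) => /=; nlia.
      - by move: h4; rewrite !tot_cons cardfsU1 (negPf yA') /= (cardfsD1 x D) xD; nlia.
    split=> //; apply: W0max => //; case: mD => _ <- _; rewrite -eD.
    by apply: ssum_cons2S; apply: sumsetSS => //; apply: fsubsetUr.
  by case: mD => _ _ <-; rewrite !phisC cl_add // clD //; have := sg_gt0 Hg; nlia.
have cB As B : mx As -> B \in As -> (#|` B| <= m)%N.
  move=> [[_ _ _ <-] _ _] /perm_pick[R /tot_perm->]; rewrite tot_cons; exact: leq_addr.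
(* Suppose A + H misses x. Redundant terms are absorbed into B until B is soft or contains a soft
   block A2. A soft B passes x on to the block that misses it. Otherwise either x goes to A2 by
   [swap_sub], or a term of A2 congruent to x goes to the block that misses x. *)
have F2 As A B x : mx As -> A \in As -> B \in As -> x \in B -> ~ lone H B x -> x \in sumset A H.
  move=> mA AAs BAs xB nl; apply: contraT => xA.
  have [R pR] := perm_pick BAs.
  have AR : A \in R.
    move: AAs; rewrite (perm_mem pR) inE => /orP[/eqP eA|//].
    by case/negP: xA; rewrite eA; apply: (fsubsetP (sub_cl Hg B)).
  have [|||||B' [R' [[mB xB' nl' [A1 A1R xA1]] h]]] := @absorb _ X (fun B R => [/\ mx (B :: R), x \in B, ~ lone H B x & exists2 A, A \in R & x \notin sumset A H]) m B R X0.
  - by move=> B1 R1 [h _ _ _]; apply: cB h _; rewrite inE eqxx.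
  - move=> B1 R1 R2 pe [h1 h2 h3 [A1 h4 h5]]; split=> //; last by exists A1; rewrite -?(perm_mem pe).
    by apply: mx_perm h1; rewrite perm_cons.
  - by move=> B1 R1 [/mx_def].
  - move=> B1 A1 R1 c [h1 h2 h3 [A2 h4 h5]] cA1 cB1 s1.
    have p1 := perm_swap B1 A1 R1.
    have [h6 h7] := mx_smove _ _ _ _ (mx_perm _ _ p1 h1) s1 cA1 cB1.
    split.
    - by apply: mx_perm h6; apply: perm_swap.
    - by rewrite !inE h2 orbT.
    - by move=> l; apply: h3 => y yB; apply: l; rewrite !inE yB orbT.
    - move: h4; rewrite inE => /orP[/eqP eA|h4]; last by exists A2; rewrite // inE h4 orbT.
      exists (A1 `\ c); rewrite ?inE ?eqxx //; apply: contra h5; rewrite eA; apply: cl_sub; exact: fsubD1set.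
  - split=> //; [exact: mx_perm mA | by exists A].
  have xn C : x \notin sumset C H -> x \notin C by apply: contra => /(fsubsetP (sub_cl Hg C)).
  case: h => [sB|[A2 [R2 [p2 s2 sub [mB2 _ _ _]]]]].
    have [R1 pR1] := perm_pick A1R.
    have mB' : mx (B' :: A1 :: R1) by apply: mx_perm mB; rewrite perm_cons.
    have [_] := mx_smove _ _ _ _ mB' (soft_perm pR1 sB) xB' (xn _ xA1); by rewrite (negPf xA1).
  have p3 := perm_swap B' A2 R2.
  case: (boolP (x \in sumset A2 H)) => [/in_cl[x' x'A2 hx]|xA2]; last first.
    have [] := mx_move _ _ _ _ mB2 xB' (xn _ xA2) nl'; last by rewrite (negPf xA2).
    by case: mB2 => _ <- _; apply/ssum_cons2S/swap_sub => //; apply: xn.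
  have A1R2 : A1 \in R2.
    move: A1R; rewrite (perm_mem p2) inE => /orP[/eqP eA|//].
    by case/negP: xA1; rewrite eA; apply/in_cl; exists x'.
  have [R3 p4] := perm_pick A1R2.
  have p5 : perm_eq (B' :: R2) (A1 :: B' :: R3) by apply: perm_ins.
  have m5 : mx (A2 :: A1 :: B' :: R3).
    by apply: mx_perm mB2; apply: perm_trans p3 _; rewrite perm_cons.
  have x'A1 : x' \notin sumset A1 H by rewrite -(per_mem Hg _ hx) //; apply: per_cl.
  have [_] := mx_smove _ _ _ _ m5 (soft_perm p5 s2) x'A2 (contra (fsubsetP (sub_cl Hg A1) _) x'A1).
  by rewrite (negPf x'A1).
(* Z is frozen here, and competing setpartitions must have the same Z; minimality of [E] then
   spreads the terms outside Z over the blocks. *)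
pose Z x := all (fun A => x \in sumset A H) As1.
pose outs A := [fset a in A | ~~ Z a].
pose E As := (\sum_(A <- As) #|` outs A| ^ 2)%N.
pose P3 As := mx As /\ forall z, all (fun A => z \in sumset A H) As = Z z.
have [|As2 [m2 Z2] min2] := @exists_min _ P3 E.
  by exists As1; split.
exists As2; split; first by case: m2.
right; rewrite (_ : ssum X As2 = W0); last by case: m2.
rewrite /= -/H; split=> [x hx|A AAs x y xA yA].
  by apply/allP=> A AAs; apply: (F1 As2).
rewrite !Z2 => Zx Zy; apply: NNPP => xy.
have P3_perm As Bs : perm_eq As Bs -> P3 As -> P3 Bs.
  by move=> pe [h1 h2]; split; [exact: mx_perm h1|move=> z; rewrite -(perm_all _ pe) h2].
have EC B R : E (B :: R) = (#|` outs B| ^ 2 + E R)%N by apply: big_cons.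
have E_perm As Bs : perm_eq As Bs -> E As = E Bs by move=> pe; apply: perm_big.
have outsP B z : (z \in outs B) = (z \in B) && ~~ Z z by rewrite !inE.
have nlZ As B z : P3 As -> B \in As -> z \in B -> ~ lone H B z -> Z z.
  by move=> [mA <-] BAs zB nl; apply/allP=> C CAs; apply: F2 mA CAs BAs zB nl.
have xn C z : z \notin sumset C H -> z \notin C by apply: contra => /(fsubsetP (sub_cl Hg C)).
have [R pR] := perm_pick AAs.
have [|||||B' [R' [[P3B xB' yB' eE] h]]] := @absorb _ X (fun B R => [/\ P3 (B :: R), x \in B, y \in B & E (B :: R) = E As2]) m A R X0.
- by move=> B1 R1 [[h _] _ _ _]; apply: cB h _; rewrite inE eqxx.
- move=> B1 R1 R2 pe [h1 h2 h3 h4].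
  have pe' : perm_eq (B1 :: R1) (B1 :: R2) by rewrite perm_cons.
  by split=> //; [apply: P3_perm h1|rewrite -(E_perm _ _ pe')].
- by move=> B1 R1 [[/mx_def]].
- move=> B1 A1 R1 c [P1 h2 h3 h4] cA1 cB1 s1.
  have p1 := perm_swap B1 A1 R1; have p2 := perm_swap (A1 `\ c) (c |` B1) R1.
  have P1' := P3_perm _ _ p1 P1; have [m1 Z1] := P1'.
  have [h6 h7] := mx_smove _ _ _ _ m1 s1 cA1 cB1.
  have nl := softH _ _ _ m1 s1 cA1.
  have Zc : Z c by apply: (nlZ _ A1 c P1') => //; rewrite inE eqxx.
  split; rewrite ?inE ?h2 ?h3 ?orbT //.
  + apply: P3_perm p2 _; split=> // z; rewrite -Z1 /= (cl_rem Hg nl) (cl_addin Hg) //.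
  + rewrite -h4 !EC (_ : outs (c |` B1) = outs B1) 1?(_ : outs (A1 `\ c) = outs A1) //.
      by apply/fsetP=> z; rewrite !outsP !inE; case: eqVneq => [->|]; rewrite ?Zc ?andbF.
    by apply/fsetP=> z; rewrite !outsP !inE; case: eqVneq => [->|]; rewrite ?Zc ?andbF.
- by split=> //; [exact: P3_perm (conj m2 Z2)|rewrite (E_perm _ _ pR)].
(* A soft block has all its terms in Z. So B', which contains x, is not soft and contains a soft
   block A1; moving x from B' to A1 lowers [E], because y stays behind. *)
case: h => [sB|[A1 [R1 [p1 s1 sub [P4 _ _ _]]]]].
  case/negP: Zx; apply: (nlZ _ B' x P3B) => //; first by rewrite inE eqxx.
  by case: (P3B) => h _; apply: softH h sB xB'.
have m4 := P4.1; have p4 := perm_swap B' A1 R1.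
have s1Z z : z \in A1 -> Z z.
  move=> zA1; apply: (nlZ _ A1 z P4) => //; first by rewrite !inE eqxx orbT.
  by apply: softH s1 zA1; apply: mx_perm m4.
have lx : lone H B' x.
  by apply: NNPP => /(nlZ _ B' x P4); rewrite inE eqxx (negPf Zx) => /(_ isT xB').
have xA1 : x \notin sumset A1 H.
  apply/negP => /in_cl[a aA1]; rewrite sgBC // => ha.
  by have := s1Z a aA1; rewrite (lx _ (fsubsetP sub a aA1) ha) (negPf Zx).
have xA1' := xn _ _ xA1.
have B'x0 : B' `\ x != fset0 by apply/fset0Pn; exists y; rewrite !inE yB' andbT; apply/eqP=> e; apply: xy.
have xB'x : x \notin sumset (B' `\ x) H.
  apply/negP => /in_cl[a]; rewrite !inE => /andP[ax aB]; rewrite sgBC // => /(lx _ aB) e.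
  by rewrite e eqxx in ax.
have eB' : B' = x |` (B' `\ x) by rewrite fsetD1K.
have c4 := partition_in_move xB' xA1' B'x0 (let: And3 h _ _ := m4 in h).
have e4 : ssum X (B' `\ x :: x |` A1 :: R1) = W0.
  apply: W0max => //; case: m4 => _ <- _; exact/ssum_cons2S/swap_sub.
have f4 : phis (B' `\ x :: x |` A1 :: R1) = p.
  case: m4 => _ _ <-; rewrite !phisC (cl_add Hg xA1) [in RHS]eB' (cl_add Hg xB'x); nlia.
(* Only the coset of x is affected. A1 + H misses it before the move and the rest of B' misses it
   afterwards, so it is outside Z both times. *)
have Z4 z : all (fun A => z \in sumset A H) (B' `\ x :: x |` A1 :: R1) = Z z.
  rewrite -P4.2 /=; case: (boolP (z - x \in H)) => hz.
    have -> : z \in sumset (B' `\ x) H = false.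
      by apply/negbTE; rewrite (per_mem Hg _ hz) //; apply: per_cl.
    have -> : z \in sumset A1 H = false.
      by apply/negbTE; rewrite (per_mem Hg _ hz) //; apply: per_cl.
    by rewrite andbF.
  have e1 : (z \in sumset (B' `\ x) H) = (z \in sumset B' H).
    apply/in_cl/in_cl => -[a aB ha]; exists a => //; first by move: aB; rewrite !inE => /andP[].
    by rewrite !inE aB andbT; apply: contraNneq hz => <-.
  have e2 : (z \in sumset (x |` A1) H) = (z \in sumset A1 H).
    apply/in_cl/in_cl => -[a aB ha]; exists a => //; last by rewrite !inE aB orbT.
    by move: aB; rewrite !inE => /orP[/eqP e|//]; rewrite -e ha in hz.
  by rewrite e1 e2.
have := min2 _ (conj (And3 c4 e4 f4) Z4); rewrite -eE (E_perm (B' :: R') (B' :: A1 :: R1)) ?perm_cons // !EC.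
have -> : outs (x |` A1) = [fset x].
  apply/fsetP=> z; rewrite outsP !inE; case: eqVneq => [->|_] //=; case: (boolP (z \in A1)) => // /s1Z->//.
have -> : outs A1 = fset0.
  by apply/fsetP=> z; rewrite outsP !inE; case: (boolP (z \in A1)) => // /s1Z->.
have yx : y != x by apply/eqP=> e; apply: xy.
rewrite (cardfsD1 x (outs B')) outsP xB' Zx /=.
have -> : outs B' `\ x = outs (B' `\ x) by apply/fsetP=> z; rewrite !inE; case: eqP.
have : (0 < #|` outs (B' `\ x)|)%N.
  by rewrite cardfs_gt0; apply/fset0Pn; exists y; rewrite outsP !inE yx yB'.
rewrite ?cardfs0 cardfs1; move: (#|` outs (B' `\ x)|) (E R1) => u v u0; nlia.
Qed.

End PartA.

(** * Extending a setpartition inside the cosets of a subgroup *)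

Section Squares.
Variable T : Type.
Implicit Types (f : T -> nat) (r s : seq T).
(** The difference of the two sides is (x - s)(x - s - 1), a product of consecutive integers. *)
Lemma sq_lower (s x : nat) :
  ((2 * s + 1) * x <= x ^ 2 + s * (s + 1) ?= iff ((x == s) || (x == s.+1)))%N.
Proof.
rewrite -mulnn; case: (leqP x s) => h.
  have [d ->] : exists d, s = (x + d)%N by exists (s - x)%N; rewrite subnKC.
  apply/leqifP; case: d => [|d]; first by rewrite addn0 eqxx /=; nia.
  by rewrite (ltn_eqF (_ : x < _)%N) ?(ltn_eqF (_ : x < _)%N) //=; nia.
have [d ->] : exists d, x = (s.+1 + d)%N by exists (x - s.+1)%N; rewrite subnKC.
apply/leqifP; case: d => [|d]; first by rewrite addn0 eqxx orbT /=; nia.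
by rewrite (gtn_eqF (_ : s < _)%N) ?(gtn_eqF (_ : s.+1 < _)%N) //=; nia.
Qed.

Lemma sum_sq_lower f k r : (\sum_(x <- r) (2 * k + 1) * f x <= \sum_(x <- r) f x ^ 2 + size r * (k * (k + 1))
   ?= iff all (fun x => (f x == k) || (f x == k.+1)) r)%N.
Proof.
elim: r => [|x r IH]; first by rewrite !big_nil; apply/leqifP.
rewrite !big_cons /= mulSn addnACA; apply: leqif_add => //; exact: sq_lower.
Qed.

(** The secant of the square through k and k + 1 gives a lower bound that depends only on the total.
    It is attained on [r], and strict on [s], where two values differ by 2 or more. *)
Lemma equitable_sq f r s k x y : size r = size s -> (\sum_(x <- r) f x = \sum_(x <- s) f x)%N ->
  all (fun x => (f x == k) || (f x == k.+1)) r ->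
  (exists R, perm_eq (map f s) [:: x, y & R]) -> (y + 2 <= x)%N ->
  (\sum_(x <- r) f x ^ 2 < \sum_(x <- s) f x ^ 2)%N.
Proof.
move=> es et hr [R p] xy.
have e1 : (\sum_(x <- r) f x ^ 2 + size r * (k * (k + 1)) = \sum_(x <- r) (2 * k + 1) * f x)%N.
  by have [_ ] := sum_sq_lower f k r; rewrite hr => /eqP.
have [h1 h2] := sum_sq_lower f k s.
have : ~~ all (fun x => (f x == k) || (f x == k.+1)) s.
  have -> : all (fun x => (f x == k) || (f x == k.+1)) s = all (fun z => (z == k) || (z == k.+1)) (map f s).
    by rewrite all_map.
  rewrite (perm_all _ p) /=; apply/negP=> /and3P[hx hy _]; move: hx hy xy.
  by case/orP=> /eqP->; case/orP=> /eqP->; lia.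
rewrite -h2 => ne; have : (\sum_(x <- s) (2 * k + 1) * f x < \sum_(x <- s) f x ^ 2 + size s * (k * (k + 1)))%N.
  by rewrite ltn_neqAle ne.
rewrite -!big_distrr /= -et big_distrr /= -e1 es ltn_add2r //.
Qed.
End Squares.

Section Fill.
Variable G : zmodType.
Implicit Types (A B C D X Y W K H L : {fset G}) (x y z a b c g h k w : G) (As Bs R : seq {fset G}) (S T : seq G).

Lemma ex_transversal K A : is_subgroup K -> exists T : {fset G}, [/\ T `<=` A, sep K T & sumset T K = sumset A K].
Proof.
move=> Kg; elim/fset1U_rect: A => [|a A aA [T [s1 s2 s3]]]; first by exists fset0; split.
case: (boolP (a \in sumset A K)) => h.
  by exists T; split; rewrite ?cl_addin ?s3 // fsubsetU // s1 orbT.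
exists (a |` T); split; first by rewrite fsetUS.
  move=> x y; rewrite !inE => /orP[/eqP->|xT] /orP[/eqP->|yT] // hxy; last exact: s2.
    by case/negP: h; rewrite -s3; apply/in_cl; exists y.
  by case/negP: h; rewrite -s3; apply/in_cl; exists x; rewrite // sgBC.
by rewrite !cl_cons s3.
Qed.

Lemma card_cl_le K A : is_subgroup K -> (#|` sumset A K| <= #|` A| * #|` K|)%N.
Proof.
move=> Kg; have [T [s1 s2 <-]] := ex_transversal A Kg.
by rewrite card_sep // leq_mul2r fsubset_leq_card ?orbT.
Qed.

Lemma cl_U A B K : sumset (A `|` B) K = sumset A K `|` sumset B K.
Proof.
apply/fsetP=> z; rewrite inE; apply/in_cl/orP.
  by move=> [u]; rewrite inE => /orP[uA|uB] h; [left|right]; apply/in_cl; exists u.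
by move=> [] /in_cl[u uA h]; exists u; rewrite // inE uA ?orbT.
Qed.

Lemma cl_lone K A (T : {fset G}) : is_subgroup K -> T `<=` A -> (forall x, x \in T -> lone K A x) ->
  #|` sumset A K| = (#|` sumset (A `\` T) K| + #|` T| * #|` K|)%N.
Proof.
move=> Kg TA lT; rewrite -(card_sep Kg); last first.
  by move=> x y xT yT h; apply: lT h => //; apply: (fsubsetP TA).
have {1}-> : A = (A `\` T) `|` T .
  by apply/fsetP=> z; rewrite !inE; case: (boolP (z \in T)) => [/(fsubsetP TA)->|_]; rewrite ?orbF.
rewrite cl_U cardfsU disjoint_fsetI0 ?cardfs0 ?subn0 //.
apply/fdisjointP=> z /in_cl[a]; rewrite !inE => /andP[aT aA] ha.
apply: contra aT => /in_cl[t tT ht].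
by rewrite (lT t tT a aA) //; apply: sg_trans ht; rewrite // sgBC.
Qed.

Lemma count_seqdiff x S T : count_mem x (seqdiff S T) = (count_mem x S - count_mem x T)%N.
Proof.
elim: T => [|y T IH] /=; first by rewrite subn0.
rewrite count_mem_rem IH /=; case: (y == x) => /=; rewrite ?subn0 ?add0n //.
by rewrite -subnDA addn1.
Qed.
End Fill.

Section Fill2.
Variables (G : zmodType) (M : {fset G}) (J : seq {fset G}) (S : seq G).
Implicit Types (A B C D X Y W K H L : {fset G}) (x y z a b c g h k w : G) (As Bs R : seq {fset G}) (T : seq G)
  (p q : {fset G} * {fset G}) (P Q : seq ({fset G} * {fset G})).
Hypothesis Mg : is_subgroup M.
Hypotheses (hsep : forall A, A \in J -> sep M A) (heq : equitable J).
Hypothesis hc : forall x, (cnt x J <= count_mem x S <= size J)%N.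
(** By [hsat] the coset of such a term meets every block, so the term may be placed anywhere without
    enlarging a closure. *)
Definition saturated x := exists2 l, (cnt l J < count_mem l S)%N & x - l \in M.
Hypothesis hsat : forall x A, saturated x -> A \in J -> x \in sumset A M.

(** [p.1] is a block of [J] and [p.2] its replacement, which need not contain [p.1]: it meets the
    same cosets, and only saturated ones more than once. *)
Definition coset_extension_block p := sumset p.1 M = sumset p.2 M /\
  forall x y, x \in p.2 -> y \in p.2 -> x - y \in M -> x = y \/ saturated x.
Definition coset_extension P := perm_eq (unzip1 P) J /\ forall p, p \in P -> coset_extension_block p.

Lemma coset_extension_perm P Q : perm_eq P Q -> coset_extension P -> coset_extension Q.
Proof.
move=> pe [h1 h2]; split; last by move=> p; rewrite -(perm_mem pe); apply: h2.
by apply: perm_trans h1; rewrite perm_sym perm_map.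
Qed.

Lemma coset_extension_block_add A B x : coset_extension_block (A, B) -> A \in J -> saturated x -> coset_extension_block (A, x |` B).
Proof.
move=> [/= e h] AJ sx; split=> /=; first by rewrite cl_addin // -e; apply: hsat.
move=> u v; rewrite !inE => /orP[/eqP->|uB] /orP[/eqP->|vB] huv; [by left|by right| |exact: h].
by right; case: sx => l hl xl; exists l => //; apply: sg_trans huv xl.
Qed.

(** A left-over term occurs at most [size J] times in [S], so some block lacks it; its coset meets
    every block, so it can be put there. *)
Lemma fill_exists : exists2 P, coset_extension P & forall x, cnt x (unzip2 P) = count_mem x S.
Proof.
suff H : forall T P, coset_extension P -> (forall x, x \in T -> saturated x) ->
    (forall x, cnt x (unzip2 P) + count_mem x T = count_mem x S)%N ->
    exists2 P, coset_extension P & forall x, cnt x (unzip2 P) = count_mem x S.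
  apply: (H (seqdiff S (Sseq J)) [seq (A, A) | A <- J]).
  - split; first by rewrite /unzip1 -map_comp map_id.
    move=> p /mapP[A AJ ->]; split=> //= x y xA yA h; left; exact: (hsep AJ xA yA h).
  - move=> x; rewrite -has_pred1 has_count count_seqdiff count_Sseq subn_gt0 => h.
    by exists x; rewrite // subrr sg0.
  - move=> x; rewrite count_seqdiff count_Sseq /unzip2 -map_comp map_id subnKC //.
    by case/andP: (hc x).
elim=> [|l T IH] P [pP oP] sT h.
  by exists P => // x; rewrite -h addn0.
have : ~~ all (fun A => l \in A) (unzip2 P).
  rewrite all_count neq_ltn size_map -(size_map fst) (perm_size pP).
  by have /andP[_ h1] := hc l; rewrite -h /= eqxx add1n addnS in h1; rewrite (leq_trans _ h1) // ltnS leq_addr.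
move=> /allPn[_ /mapP[p0 pinP ->] lB]; case: p0 pinP lB => A B' pinP /= lB.
have pe := perm_to_rem pinP; have [pP' oP'] := coset_extension_perm pe (conj pP oP).
have AJ : A \in J by rewrite -(perm_mem pP') /= inE eqxx.
apply: (IH ((A, l |` B') :: rem (A, B') P)).
- split=> // p; rewrite inE => /orP[/eqP->|pR]; last by apply: oP'; rewrite inE pR orbT.
  by apply: coset_extension_block_add => //; [apply: oP; exact: pinP|apply: sT; rewrite inE eqxx].
- by move=> x xT; apply: sT; rewrite inE xT orbT.
- move=> x; rewrite -h (cnt_perm x (perm_map snd pe)) /= !inE [l == x]eq_sym.
  by case: eqVneq => [->|_] /=; rewrite ?(negPf lB) //= addnCA addnA.
Qed.

(** Choose the extension with the fewest squares and suppose |A| >= |B| + 2. A term of A outside B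
    that shares its coset would be saturated and could move to B, so all of these are alone in their
    cosets. Since the closures come from an equitable [J], counting cosets gives |A \ B| <= |B \ A|
    + 1. *)
Lemma fill : exists P, [/\ coset_extension P, forall x, cnt x (unzip2 P) = count_mem x S & equitable (unzip2 P)].
Proof.
have [|P [oP cP] minP] := @exists_min _ (fun P => coset_extension P /\ forall x, cnt x (unzip2 P) = count_mem x S)
   (fun P => \sum_(p <- P) #|` p.2| ^ 2)%N.
  by have [P h1 h2] := fill_exists; exists P.
exists P; split=> // _ _ /mapP[pA pa ->] /mapP[pB pb ->].
case: pA pB pa pb => [a A] [b B] /= pa pb.
rewrite leqNgt; apply/negP=> lt.
have pe1 := perm_to_rem pa.
have pb' : (b, B) \in rem (a, A) P.
  move: pb; rewrite (perm_mem pe1) inE => /orP[/eqP[_ e]|//].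
  by move: lt; rewrite e ltnNge leqW ?leqnSn.
have pe : perm_eq P [:: (a, A), (b, B) & rem (b, B) (rem (a, A) P)].
  by apply: perm_trans pe1 _; rewrite perm_cons perm_to_rem.
move: (rem _ _) pe => Q pe {pe1 pb'}.
have [pQ oQ] := coset_extension_perm pe oP.
have aJ : a \in J by rewrite -(perm_mem pQ) inE eqxx.
have bJ : b \in J by rewrite -(perm_mem pQ) !inE eqxx orbT.
have [/= ea ha] : coset_extension_block (a, A) by apply: oQ; rewrite inE eqxx.
have oB : coset_extension_block (b, B) by apply: oQ; rewrite !inE eqxx orbT.
have eb : sumset b M = sumset B M by case: oB.
have nomove : forall x, x \in A `\` B -> lone M A x.
  move=> x; rewrite inE => /andP[xB xA]; apply: NNPP => nl.
  have sx : saturated x.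
    by have [y [yA yx]] := nlone nl; rewrite sgBC // => h; case: (ha x y xA yA h) => // e; rewrite e eqxx in yx.
  have /(_ _)/wrap[] := minP [:: (a, A `\ x), (b, x |` B) & Q].
    split.
      split=> // p; rewrite !inE => /or3P[/eqP->|/eqP->|pQ']; last by apply: oQ; rewrite !inE pQ' !orbT.
        split=> /= [|u v]; first by rewrite (cl_rem Mg nl).
        by rewrite !inE => /andP[_ uA] /andP[_ vA]; apply: ha.
      exact: coset_extension_block_add.
    move=> y; rewrite -cP (cnt_perm y (perm_map snd pe)) /= !inE.
    by case: eqVneq => [->|] //=; rewrite xA (negPf xB).
  apply/negP; rewrite -ltnNge (perm_big _ pe) /= !big_cons /= cardfsU1 xB (cardfsD1 x A) xA.
  by move: (bigop.body _ _ _) lt => s; rewrite (cardfsD1 x A) xA; nlia.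
have c1 := cl_lone Mg (fsubsetDl A B) nomove.
have c2 : (#|` sumset B M| <= #|` sumset (A `\` (A `\` B)) M| + #|` B `\` A| * #|` M|)%N.
  apply: leq_trans (leq_add (leqnn _) (card_cl_le _ Mg)).
  apply: leq_trans (fsubset_leq_card (_ : _ `<=` sumset (A `\` (A `\` B)) M `|` sumset (B `\` A) M)) _.
    rewrite -cl_U; apply: sumsetSS => //; apply/fsubsetP=> z zB; rewrite !inE zB.
    by case: (z \in A).
  by rewrite cardfsU leq_subr.
have c3 := heq aJ bJ.
have c4 := cardfsDI A B; have c5 := cardfsDI B A; rewrite fsetIC in c5.
move: c1 c2; rewrite -ea -eb (card_sep Mg (hsep aJ)) (card_sep Mg (hsep bJ)) => c1 c2.
have M0 := sg_gt0 Mg.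
have c6 : (#|` A `\` B| * #|` M| <= #|` B `\` A| * #|` M| + #|` M|)%N.
  have : (#|` a| * #|` M| <= #|` b| * #|` M| + #|` M|)%N by rewrite addnC -mulSn leq_mul2r c3 orbT.
  by move: c1 c2; nlia.
have : (#|` A `\` B| <= #|` B `\` A| + 1)%N.
  by rewrite -(leq_pmul2r M0) mulnDl mul1n.
by move: lt c4 c5; nlia.
Qed.
End Fill2.

(** * The theorem applied modulo a stabilizer *)

Section Phi.
Variable G : zmodType.
Implicit Types (A B C D X Y W K H L : {fset G}) (x y z a b c g h k w : G) (As Bs R : seq {fset G}) (S : seq G).

Lemma phiE L x y : is_subgroup L -> (phi L x == phi L y) = (x - y \in L).
Proof.
move=> Lg; apply/eqP/idP => [e|h].
  by have : x \in phi L y by [rewrite -e /phi shiftP subrr sg0]; rewrite /phi shiftP.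
apply/fsetP=> z; rewrite /phi !shiftP; apply/idP/idP => hz.
  by have := sgD Lg hz h; rewrite (_ : _ + _ = z - y) //; zmod.
by have := sgB Lg hz h; rewrite (_ : _ - _ - _ = z - x) //; zmod.
Qed.

Lemma phi_sep L A : is_subgroup L -> (#|` phi_set L A| = #|` A|) <-> sep L A.
Proof.
move=> Lg; split=> [e x y xA yA h|s]; last first.
  by apply: card_in_imfset => x y xA yA /eqP; rewrite phiE //; exact: s.
apply/eqP; apply: contraT => xy.
have : phi_set L A `<=` [fset phi L a | a in A `\ x].
  apply/fsubsetP=> u /imfsetP[a /= aA ->]; apply/imfsetP.
  case: (eqVneq a x) => [->|ax]; last by exists a; rewrite //= !inE ax.
  by exists y; rewrite /= ?inE ?yA ?(eq_sym y) ?xy //; apply/eqP; rewrite phiE.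
move/fsubset_leq_card; rewrite e => h'; have := leq_trans h' (leq_imfset_card _ _ _).
by rewrite (cardfsD1 x A) xA ltnn.
Qed.

Lemma hmult_le L S n : is_subgroup L ->
  (hmult (map (phi L) S) <= n)%N <-> forall x, (count (fun y => (y - x)%R \in L) S <= n)%N.
Proof.
move=> Lg.
have e x : count_mem (phi L x) (map (phi L) S) = count (fun y => y - x \in L) S.
  by rewrite count_map; apply: eq_count => y /=; rewrite phiE.
rewrite /hmult; split=> [/bigmax_leqP_seq h x|h].
  rewrite -e; case: (boolP (phi L x \in map (phi L) S)) => [xS|/count_memPn->//]; exact: h.
by apply/bigmax_leqP_seq => u /mapP[x xS ->] _; rewrite e.
Qed.
End Phi.

Definition conclusion (G : zmodType) (n : nat) (X L : {fset G}) (S S' : seq G) : Prop :=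
  exists As : seq {fset G},
    [/\ size As = n, is_setpartition As,
        subseqm (Sseq As) S, size (Sseq As) = size S' &
        forall A, A \in As -> #|` phi_set L A| = #|` A| ] /\
    let Y := sumset X (Sigma_n n S) in
    let W := sumset X (bigsumset As) in
    [\/
      [/\ (#|` W| <= #|` Y|)%N,
       ((size S' - n) * #|` L| + #|` X| <= #|` W|)%N & equitable As],
      (let H := stab Y in
       let Z := fun x => all (fun A => in_sum_pred A H x) As in
       [/\ Y = W, equitable As,
           forall x, x \in seqdiff S (Sseq As) -> Z x &
           forall A, A \in As -> (#|` [fset a in A | ~~ Z a]| <= 1)%N])
    | n = 2%N /\
      exists A1 A2 : {fset G}, As = [:: A1; A2] /\
      exists beta : G, exists K : {fset G},
        let I := sumset A1 L `&` sumset A2 L in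
        [/\ [/\ beta \in X, is_subgroup K, L `<=` K & quot_is_Z2xZ2 K L],
            periodic K (X `\` shift beta L) /\ periodic K I,
            forall x, x \in seqdiff S (Sseq As) -> x \in I,
            (exists g, (sumset A1 L `|` sumset A2 L) `\` I = shift g K) &
            [/\ forall g, stab Y g = stab W g, forall g, stab W g = stab X g,
                forall g, stab X g = (g \in L) &
                #|` Y| = ((size S' - n) * #|` L| + #|` X|)%N]]].

Definition theorem_at (G : zmodType) (n : nat) : Prop := forall (X L : {fset G}) (S S' : seq G),
  (1 <= n)%N -> X != fset0 -> is_subgroup L -> {subset L <= stab X} -> subseqm S' S ->
  (hmult (map (phi L) S') <= n <= size S')%N -> conclusion n X L S S'.

Section Apply.
Variable G : zmodType.
Implicit Types (A B C D X Y W K H L M V : {fset G}) (x y z a b c g h k w : G) (As Bs R J : seq {fset G}) (S T : seq G).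

Lemma seqdiffP S T x : reflect (count_mem x T < count_mem x S)%N (x \in seqdiff S T).
Proof.
by rewrite -has_pred1 has_count count_seqdiff subn_gt0; apply: idP.
Qed.

(* The third alternative of the theorem for the pair [A1], [A2], with [L = M] and [X = V]. *)
Definition klein V M S A1 A2 beta K (N : nat) := let I := sumset A1 M `&` sumset A2 M in
  [/\ [/\ beta \in V, is_subgroup K, M `<=` K & quot_is_Z2xZ2 K M],
            periodic K (V `\` shift beta M) /\ periodic K I,
            forall x, (cnt x [:: A1; A2] < count_mem x S)%N -> x \in I &
            (exists g, (sumset A1 M `|` sumset A2 M) `\` I = shift g K) /\
            let Y := sumset V (Sigma_n 2 S) in
            (forall g, stab Y g = (g \in M)) /\ #|` Y| = ((N - 2) * #|` M| + #|` V|)%N].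

Lemma size_subseqm S T : subseqm T S -> (size T <= size S)%N.
Proof. by move/count_subseqP => [s /size_subseq h /perm_size->]. Qed.

Lemma count_coset M As y : is_subgroup M -> (forall A, A \in As -> sep M A) ->
  (count (fun z => (z - y)%R \in M) (Sseq As) <= count (fun A => y \in sumset A M) As)%N.
Proof.
move=> Mg; rewrite /Sseq; elim: As => [|A As IH] h //=.
rewrite count_cat leq_add ?IH //; last by move=> B hB; apply: h; rewrite inE hB orbT.
have sA := h A (mem_head _ _).
case: (boolP (y \in sumset A M)) => [_|yA]; last first.
  rewrite leqn0 eqn0Ngt -has_count; apply/hasP=> -[z zA hz]; case/negP: yA.
  by apply/in_cl; exists z; rewrite // sgBC.
rewrite leqNgt; apply/negP; rewrite -size_filter.
have := filter_uniq (fun z => z - y \in M) (fset_uniq A).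
case E : (filter _ _) => [|u [|v s]] //= /andP[]; rewrite inE => /norP[/eqP uv _] _ _; apply: uv.
have : u \in [seq z <- A | z - y \in M] by rewrite E inE eqxx.
have : v \in [seq z <- A | z - y \in M] by rewrite E !inE eqxx orbT.
rewrite !mem_filter => /andP[hv vA] /andP[hu uA]; apply: (sA u v uA vA).
by apply: sg_trans hu _; rewrite // sgBC.
Qed.

(** The theorem is applied to V, its stabilizer M, the terms of J, and a longest subsequence T with
    at most n terms in each coset of M. Transversals of the blocks compete with T, whence the lower
    bound on N. A term left over must meet every A + M, for otherwise it could be added to the terms
    in use, which are as many as those of T. *)
Lemma theorem_at_apply n V J : (0 < n)%N -> theorem_at G n -> V != fset0 -> nonempty J -> size J = n ->
  let M := Stab V in exists As N,
  [/\ [/\ size As = n, nonempty As, forall x, (cnt x As <= cnt x J)%N, tot As = N & forall A, A \in As -> sep M A],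
      (\sum_(D <- J) #|` sumset D M| <= N * #|` M|)%N,
      forall x, (cnt x As < cnt x J)%N -> forall A, A \in As -> x \in sumset A M &
   [\/ equitable As /\ (#|` V| + N * #|` M| <= #|` ssum V As| + n * #|` M|)%N,
      equitable As /\ (let W := ssum V As in let Z := fun x => all (fun A => x \in sumset A (Stab W)) As in
      [/\ sumset V (Sigma_n n (Sseq J)) = W, forall x, (cnt x As < cnt x J)%N -> Z x &
        forall A, A \in As -> forall x y, x \in A -> y \in A -> ~~ Z x -> ~~ Z y -> x = y])
    | n = 2%N /\ exists A1 A2 beta K, As = [:: A1; A2] /\ klein V M (Sseq J) A1 A2 beta K N]].
Proof.
move=> n0 hn V0 neJ sJ M; have Mg : is_subgroup M := Stab_subgroup V0.
pose P T := subseqm T (Sseq J) /\ forall x, (count (fun y => (y - x)%R \in M) T <= n)%N.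
have [||T [T1 T2] mxT] := @exists_max _ P size (size (Sseq J)).
- by exists [::]; split=> x /=.
- by move=> T [h _]; apply: size_subseqm.
have sepP As : size As = n -> (forall A, A \in As -> sep M A) -> (forall x, cnt x As <= cnt x J)%N -> P (Sseq As).
  move=> sA hs hc; split=> x; first by rewrite !count_Sseq.
  by apply: leq_trans (count_coset x Mg hs) _; rewrite -sA count_size.
have cJ : (\sum_(D <- J) #|` sumset D M| <= size T * #|` M|)%N.
  have [Ts [e1 e2 e3 e4]] : exists Ts, [/\ size Ts = size J, forall A, A \in Ts -> sep M A, forall x, (cnt x Ts <= cnt x J)%N &
     (\sum_(D <- J) #|` sumset D M| = tot Ts * #|` M|)%N].
    elim: {T mxT T1 T2 sepP P} J {sJ neJ} => [|D J [Ts [e1 e2 e3 e4]]].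
      by exists [::]; split=> //; rewrite /tot !big_nil.
    have [U [u1 u2 u3]] := ex_transversal D Mg; exists (U :: Ts); split=> /=.
    - by rewrite e1.
    - by move=> A; rewrite inE => /orP[/eqP->|/e2].
    - by move=> x; rewrite leq_add //; case: (boolP (x \in U)) => // /(fsubsetP u1)->.
    - by rewrite big_cons tot_cons e4 mulnDl -u3 card_sep.
  rewrite e4 leq_mul2r -size_Sseq; apply/orP; right; apply: mxT; apply: sepP => //; by rewrite e1.
have nT : (n <= size T)%N.
  rewrite -(leq_pmul2r (sg_gt0 Mg)); apply: leq_trans cJ; rewrite -sJ.
  elim: {sJ sepP mxT T1 T2 P} J neJ => [|D J IH] //; move/nonempty_cons=> [D0 /IH h].
  rewrite big_cons /= mulSn leq_add //; have [d dD] := fset0Pn _ D0.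
  rewrite -(card_shift d); apply: fsubset_leq_card; apply/fsubsetP=> z; rewrite shiftP => hz.
  by apply/in_cl; exists d.
have LV : {subset M <= stab V} by move=> g; rewrite in_Stab.
have hm : (hmult [seq phi M i | i <- T] <= n <= size T)%N by rewrite nT andbT; apply/hmult_le.
have [As [[sA neA subA szA sepA] out]] := hn V M (Sseq J) T n0 V0 Mg LV T1 hm.
have hs A : A \in As -> sep M A by move=> h; apply/phi_sep => //; apply: sepA.
have hc x : (cnt x As <= cnt x J)%N by rewrite -!count_Sseq.
have hsat x : (cnt x As < cnt x J)%N -> forall A, A \in As -> x \in sumset A M.
  move=> lx A AAs; apply: contraT => xA.
  have : P (x :: Sseq As).
    split=> y /=.
      by rewrite !count_Sseq; case: eqVneq => [<-|] //=; rewrite add0n.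
    case: (boolP (x - y \in M)) => hxy /=; last by rewrite add0n; have [_ h] := sepP As sA hs hc; apply: h.
    rewrite add1n; apply: leq_ltn_trans (count_coset y Mg hs) _; rewrite -sA ltn_neqAle count_size andbT.
    rewrite -all_count; apply/negP => /allP/(_ A AAs); rewrite -(per_mem Mg _ hxy) ?(negPf xA) //.
    exact: per_cl.
  by move/mxT; rewrite /= szA ltnn.
exists As, (size T); split=> //; first by split=> //; rewrite -size_Sseq.
case: out => [[h1 h2 h3]|[e1 h2 h3 h4]|[n2 [A1 [A2 [eA [beta [K [k1 k2 k3 k4 [k5 k6 k7 k8]]]]]]]]].
- apply: Or31; split=> //; move: h2; rewrite -/(ssum V As) mulnBl.
  by have : (n * #|` M| <= size T * #|` M|)%N by [rewrite leq_mul2r nT orbT]; nlia.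
- apply: Or32; split=> //; rewrite -/(ssum V As) in e1; have W0 := ssum_neq0 V0 neA.
  have eZ x : all (fun A => in_sum_pred A (stab (sumset V (Sigma_n n (Sseq J)))) x) As =
     all (fun A => x \in sumset A (Stab (ssum V As))) As.
    apply: eq_all => A; rewrite e1 /in_sum_pred; apply/hasP/in_cl => -[a aA ha]; exists a => //.
      by rewrite in_Stab.
    by rewrite in_Stab in ha.
  split=> // [x lx|A AAs x y xA yA Zx Zy].
    by rewrite -eZ; apply: h3; apply/seqdiffP; rewrite !count_Sseq.
  apply/eqP; apply: contraT => xy; have := h4 A AAs; rewrite leqNgt => /negP; case.
  rewrite (cardfsD1 x) !inE xA eZ Zx /= ltnS cardfs_gt0; apply/fset0Pn; exists y.
  by rewrite !inE yA eZ Zy eq_sym xy.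
- apply: Or33; split=> //; exists A1, A2, beta, K; split=> //; split=> //.
    by move=> x lx; apply: k3; apply/seqdiffP; rewrite (count_Sseq x As) eA.
  by split=> //; rewrite -n2; split=> // g; rewrite k5 k6 k7.
Qed.

Lemma count_le1 (p : pred G) As : (forall A, A \in As -> forall x y, x \in A -> y \in A -> p x -> p y -> x = y) ->
  (count p (Sseq As) <= count (fun A => has p (enum_fset A)) As)%N.
Proof.
rewrite /Sseq; elim: As => [|A As IH] h //=.
rewrite count_cat leq_add ?IH //; last by move=> B hB; apply: h; rewrite inE hB orbT.
have sA := h A (mem_head _ _).
case: (boolP (has p A)) => [_|]; last by rewrite has_count -eqn0Ngt => /eqP->.
rewrite leqNgt; apply/negP; rewrite -size_filter.
have := filter_uniq p (fset_uniq A).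
case E : (filter _ _) => [|u [|v s]] //= /andP[]; rewrite inE => /norP[/eqP uv _] _ _; apply: uv.
have : u \in [seq z <- A | p z] by rewrite E inE eqxx.
have : v \in [seq z <- A | p z] by rewrite E !inE eqxx orbT.
by rewrite !mem_filter => /andP[hv vA] /andP[hu uA]; apply: (sA u v).
Qed.

Lemma count_ge1 (p : pred G) As : (forall A, A \in As -> exists2 x, x \in A & p x) ->
  (size As <= count p (Sseq As))%N.
Proof.
rewrite /Sseq; elim: As => [|A As IH] h //=.
rewrite count_cat -add1n leq_add ?IH //; last by move=> B hB; apply: h; rewrite inE hB orbT.
by rewrite -has_count; apply/hasP; have [x xA px] := h A (mem_head _ _); exists x.
Qed.

Lemma eq_count_mem (p : pred G) S T : (forall x, p x -> count_mem x S = count_mem x T) -> count p S = count p T.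
Proof.
move=> h; rewrite -!size_filter; apply: perm_size; apply/allP=> x _ /=; rewrite !count_filter; apply/eqP.
case: (boolP (p x)) => px.
  by rewrite !(eq_count (_ : _ =1 pred1 x)) ?h // => y /=; case: eqP => // ->; rewrite px.
by rewrite !(eq_count (_ : _ =1 pred0)) ?count_pred0 // => y /=; case: eqP => // ->; rewrite (negPf px).
Qed.

Lemma ssum_unzip V M P : is_subgroup M -> per M V -> (forall p, p \in P -> sumset p.1 M = sumset p.2 M) ->
  ssum V (unzip1 P) = ssum V (unzip2 P).
Proof.
move=> Mg; elim: P V => [|[a b] P IH] V pV h //=.
rewrite !ssum_cons (_ : sumset V a = sumset V b).
  by apply: IH; [exact: per_sumset|move=> p hp; apply: h; rewrite inE hp orbT].
by rewrite -(per_cl_id Mg pV) -!sumsetA !(sumsetC M) (h (a, b)) ?mem_head.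
Qed.

(** Blocks that use only part of [J] are completed by [fill]; as M stabilizes V, the sum with V
    depends only on the closures, which do not change. *)
Lemma refill V As J : let M := Stab V in V != fset0 -> size As = size J -> nonempty As ->
  (forall x, (cnt x As <= cnt x J)%N) -> (forall A, A \in As -> sep M A) -> equitable As ->
  (forall x, (cnt x As < cnt x J)%N -> forall A, A \in As -> x \in sumset A M) ->
  exists P, [/\ coset_extension M As (Sseq J) P, forall x, cnt x (unzip2 P) = cnt x J, equitable (unzip2 P),
   nonempty (unzip2 P) & size (unzip2 P) = size J /\ ssum V (unzip2 P) = ssum V As].
Proof.
move=> M V0 sAJ neA hc hs eqA hsat; have Mg : is_subgroup M := Stab_subgroup V0.
have hc' x : (cnt x As <= count_mem x (Sseq J) <= size As)%N.
  by rewrite count_Sseq hc sAJ count_size.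
have hsat' x A : saturated M As (Sseq J) x -> A \in As -> x \in sumset A M.
  move=> [l]; rewrite count_Sseq => /hsat h hxl AAs; rewrite (per_mem Mg _ hxl) ?h //; exact: per_cl.
have [P [oP cP eP]] := fill Mg hs eqA hc' hsat'.
have [pP okP'] := oP; exists P; split=> //.
- by move=> x; rewrite cP count_Sseq.
- move=> _ /mapP[p pP' ->]; have [e _] := okP' p pP'.
  have : p.1 != fset0 by apply: neA; rewrite -(perm_mem pP); apply: map_f.
  move=> /(sumset_neq0)/(_ (sg_neq0 Mg)); rewrite e; apply: contra_neq => ->.
  by apply/fsetP=> z; rewrite inE; apply/negP=> /in_cl[y]; rewrite inE.
- split; first by rewrite size_map -(size_map fst) (perm_size pP).
  rewrite -(ssum_perm V pP); apply/esym/(ssum_unzip Mg); first by rewrite per_stab.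
  by move=> p /okP'[].
Qed.

Lemma equitable_k As : As <> [::] -> equitable As ->
  exists k : nat, all (fun A => (#|` A| == k) || (#|` A| == k.+1)) As.
Proof.
case: As => // A0 As _ e.
have [|A AAs mA] := @exists_min _ (fun A => A \in A0 :: As) (fun A => #|` A|).
  by exists A0; rewrite mem_head.
exists #|` A|; apply/allP=> B BAs; have := mA B BAs; have := e B A BAs AAs.
rewrite leq_eqVlt ltnS => /orP[-> _|h1 h2]; first by rewrite orbT.
by rewrite eqn_leq h1 h2.
Qed.
End Apply.

(** * Arrangements with minimal sum of squares *)

Section Misc.
Variable G : zmodType.
Implicit Types (A B C D X Y W K H L : {fset G}) (x y z a b c g h k w : G) (As Bs R : seq {fset G}) (S : seq G).

Lemma two_of A : (1 < #|` A|)%N -> exists x y, [/\ x \in A, y \in A & x != y].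
Proof.
case: (fset_0Vmem A) => [->|[x xA]]; first by rewrite cardfs0.
rewrite (cardfsD1 x) xA ltnS cardfs_gt0 => /fset0Pn[y]; rewrite !inE => /andP[yx yA].
by exists x, y; rewrite eq_sym.
Qed.

Lemma sub_of_card (k : nat) A : (k <= #|` A|)%N -> exists2 T : {fset G}, T `<=` A & #|` T| = k.
Proof.
elim: k => [|k IH] h; first by exists fset0; rewrite ?fsub0set ?cardfs0.
have [T TA cT] := IH (ltnW h).
have : (0 < #|` A `\` T|)%N by rewrite cardfsDS // cT subn_gt0.
rewrite cardfs_gt0 => /fset0Pn[x]; rewrite inE => /andP[xT xA].
by exists (x |` T); rewrite ?fsubUset ?fsub1set ?xA ?TA // cardfsU1 xT cT.
Qed.

Lemma lt_card_mem A B : (#|` A| < #|` B|)%N -> exists2 x, x \in B & x \notin A.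
Proof.
move=> h; have /fsubsetPn[x xB xA] : ~~ (B `<=` A) by apply/negP=> /fsubset_leq_card; rewrite leqNgt h.
by exists x.
Qed.

Lemma per_rem K V B p : is_subgroup K -> per K V -> ~ lone K B p -> sumset V (B `\ p) = sumset V B.
Proof.
move=> Kg pV nl; rewrite -(per_cl_id Kg pV) -!sumsetA !(sumsetC K).
by rewrite cl_rem.
Qed.

(** An element of B is sent to itself if it is in D, and to a congruent element of D otherwise.
    Equal images are congruent, and outside D the elements of B are alone. *)
Lemma card_inj K B D : is_subgroup K -> (forall p, p \in B -> p \notin D -> lone K B p) ->
  (#|` B `&` sumset D K| <= #|` D `&` sumset B K|)%N.
Proof.
(* On D + K the list is nonempty, so the default 0 is not returned there. *)
move=> Kg h; pose f p := if p \in D then p else nth 0 (enum_fset [fset d in D | d - p \in K]) 0.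
have fP p : p \in sumset D K -> f p \in D /\ f p - p \in K.
  move=> /in_cl[d dD hd]; rewrite /f; case: (boolP (p \in D)) => pD; first by rewrite subrr sg0.
  set F := [fset d in D | _].
  have : d \in F by rewrite !inE dD /= sgBC.
  have: nth 0 (enum_fset F) 0 \in F \/ F = fset0.
    case: (posnP #|` F|) => [/eqP|h0]; first by rewrite cardfs_eq0 => /eqP; right.
    by left; apply: mem_nth.
  by case=> [|->]; rewrite !inE //= => /andP.
rewrite -(@card_fim _ _ f (B `&` sumset D K)); last first.
  move=> p q; rewrite !inE => /andP[pB pD] /andP[qB qD] e.
  have pq : p - q \in K.
    have [_ h1] := fP p pD; have [_ h2] := fP q qD; rewrite e in h1.
    by apply: sg_trans h2; rewrite // sgBC.
  have qp : q - p \in K by rewrite sgBC.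
  case: (boolP (p \in D)) => pD'; last by apply/esym; exact: h pB pD' _ qB qp.
  case: (boolP (q \in D)) => qD'; last exact: h qB qD' _ pB pq.
  by move: e; rewrite /f pD' qD'.
apply: fsubset_leq_card; apply/fsubsetP=> z /imfsetP[p /=]; rewrite inE => /andP[pB pD] ->.
by have [h1 h2] := fP p pD; rewrite inE h1; apply/in_cl; exists p.
Qed.
End Misc.

Section PartB.
Variables (G : zmodType) (X : {fset G}) (S : seq G) (n : nat) (U : {fset G} -> Prop) (H Z : pred G).
Implicit Types (A B C D Y W K L : {fset G}) (x y z a b c g h k w p q : G) (As Bs R Q : seq {fset G}).
Hypothesis X0 : X != fset0.
Hypothesis hU : forall V V', V `<=` V' -> U V -> U V'.
Hypothesis HB : forall x y, H x -> H y -> H (x - y).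
Hypothesis ZH : forall x y, Z x -> H (y - x) -> Z y.
(* [U] records what the sumset must satisfy, and [Z] with [H] the structure of the second alternative.
   The choice [H = Z = predT] imposes no structure. *)
Definition admissible A := (forall z, Z z -> exists2 a, a \in A & H (a - z)) /\
  (forall x y, x \in A -> y \in A -> ~~ Z x -> ~~ Z y -> x = y).
(** All of [S] is used: it is instantiated with the terms of a setpartition found earlier, so only
    their distribution varies. *)
Definition arrangement As := [/\ size As = n, nonempty As & forall x, cnt x As = count_mem x S].
Definition good As := [/\ arrangement As, U (ssum X As) & forall A, A \in As -> admissible A].
Definition sum_squares As := (\sum_(A <- As) #|` A| ^ 2)%N.
Definition minimal_good As := good As /\ forall Bs, good Bs -> (sum_squares As <= sum_squares Bs)%N.
Hypothesis h2 : forall V g, V != fset0 -> U V -> V `<=` sumset X (Sigma_n n S) -> g \in Stab V -> H g.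
Hypothesis h3 : forall As, arrangement As -> (#|` X| + size S <= #|` ssum X As| + n)%N -> good As.

Lemma arrangement_perm As Bs : perm_eq As Bs -> arrangement As -> arrangement Bs.
Proof.
move=> pe [e1 e2 e3]; split; first by rewrite -(perm_size pe).
  exact: nonempty_perm pe e2.
by move=> x; rewrite -(cnt_perm x pe).
Qed.
Lemma sum_squares_perm As Bs : perm_eq As Bs -> sum_squares As = sum_squares Bs.
Proof. by move=> pe; apply: perm_big. Qed.
Lemma sum_squares_cons A As : sum_squares (A :: As) = (#|` A| ^ 2 + sum_squares As)%N. Proof. exact: big_cons. Qed.
Lemma good_perm As Bs : perm_eq As Bs -> good As -> good Bs.
Proof.
move=> pe [g1 g2 g3]; split; [exact: arrangement_perm pe g1|by rewrite -(ssum_perm X pe)|].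
by move=> A; rewrite -(perm_mem pe); apply: g3.
Qed.
Lemma minimal_good_perm As Bs : perm_eq As Bs -> minimal_good As -> minimal_good Bs.
Proof.
by move=> pe [g m]; split; [exact: good_perm pe g|rewrite -(sum_squares_perm pe)].
Qed.

(** Z is a union of classes modulo H, so if p were outside Z then q would be too, and a block has
    only one such term. *)
Lemma admissible_Z A p q : admissible A -> p \in A -> q \in A -> q != p -> H (q - p) -> Z p.
Proof.
move=> [_ h] pA qA qp hqp; apply: contraT => Zp.
have Zq : ~~ Z q.
  apply: contra Zp => Zq; apply: ZH Zq _.
  have H0 : H 0 by rewrite -(subrr (q - p)); apply: HB.
  by rewrite -(opprB q p) -sub0r; apply: HB.
by rewrite (h q p qA pA) ?eqxx in qp.
Qed.

Lemma admissible_rem A p q : admissible A -> q \in A -> q != p -> H (q - p) -> admissible (A `\ p).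
Proof.
move=> [h1 h] qA qp hqp; split=> [z /h1[a aA ha]|x y]; last first.
  by rewrite !inE => /andP[_ xA] /andP[_ yA]; apply: h.
case: (eqVneq a p) ha => [->|ap] ha; last by exists a; rewrite // !inE ap.
exists q; rewrite ?inE ?qp //.
have H0 : H 0 by rewrite -(subrr (q - p)); apply: HB.
have hN : H (0 - (p - z)) by apply: HB.
by have := HB hqp hN; rewrite (_ : _ - (0 - _) = q - z) //; zmod.
Qed.

Lemma admissible_add A p : admissible A -> Z p -> admissible (p |` A).
Proof.
move=> [h1 h] Zp; split=> [z /h1[a aA ha]|x y]; first by exists a; rewrite // !inE aA orbT.
by rewrite !inE => /orP[/eqP->|xA] /orP[/eqP->|yA]; rewrite ?Zp //; apply: h.
Qed.

Lemma arrangement_sub As : arrangement As -> ssum X As `<=` sumset X (Sigma_n n S).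
Proof. by move=> [<- _ e]; apply: ssum_Sigma => x; rewrite e. Qed.

Lemma good_stab As g : good As -> g \in Stab (ssum X As) -> H g.
Proof.
move=> [a u _]; apply: h2 => //; [by apply: ssum_neq0 => //; case: a|exact: arrangement_sub].
Qed.

Lemma arrangement_move B C R p : arrangement (B :: C :: R) -> p \in B -> p \notin C -> B `\ p != fset0 ->
  arrangement ((B `\ p) :: (p |` C) :: R).
Proof.
move=> [e1 /nonempty_cons[_ /nonempty_cons[_ e2]] e3] pB pC B0; split=> //.
  apply/nonempty_cons; split=> //; apply/nonempty_cons; split=> //.
  by apply/fset0Pn; exists p; rewrite !inE eqxx.
move=> x; rewrite -e3 !cnt_cons !inE; case: eqVneq => [->|] //=.
by rewrite pB (negPf pC).
Qed.

Lemma good_move B C R p q : good (B :: C :: R) -> p \in B -> p \notin C ->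
  q \in B -> q != p -> H (q - p) -> ssum X (B :: C :: R) `<=` ssum X ((B `\ p) :: (p |` C) :: R) ->
  good ((B `\ p) :: (p |` C) :: R).
Proof.
move=> [g1 g2 g3] pB pC qB qp hqp sub; split; last 1 first.
- have oB : admissible B by apply: g3; rewrite inE eqxx.
  have oC : admissible C by apply: g3; rewrite !inE eqxx orbT.
  move=> A; rewrite !inE => /or3P[/eqP->|/eqP->|AR]; last by apply: g3; rewrite !inE AR !orbT.
    exact: admissible_rem qB qp hqp.
  apply: admissible_add => //; exact: admissible_Z oB pB qB qp hqp.
- by apply: arrangement_move => //; apply/fset0Pn; exists q; rewrite !inE qp.
- exact: hU g2.
Qed.

Lemma sum_squares_move B C R p : p \in B -> p \notin C -> (#|` C| + 2 <= #|` B|)%N ->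
  (sum_squares ((B `\ p) :: (p |` C) :: R) < sum_squares (B :: C :: R))%N.
Proof.
move=> pB pC; rewrite !sum_squares_cons cardfsU1 pC (cardfsD1 p B) pB.
by move: (sum_squares R) => s; nlia.
Qed.

Lemma minimal_good_move B C R p q : minimal_good (B :: C :: R) -> p \in B -> p \notin C -> (#|` C| + 2 <= #|` B|)%N ->
  q \in B -> q != p -> H (q - p) ->
  ssum X (B :: C :: R) `<=` ssum X ((B `\ p) :: (p |` C) :: R) -> False.
Proof.
move=> [g m] pB pC cBC qB qp hqp sub.
have := m _ (good_move g pB pC qB qp hqp sub); rewrite leqNgt.
by rewrite sum_squares_move.
Qed.

Lemma good_stab_first A J g : good (A :: J) -> g \in Stab (sumset X A) -> H g.
Proof.
move=> gd gM; apply: (good_stab gd); rewrite ssum_cons; apply: (fsubsetP (Stab_ssum _ _)) gM.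
  by apply: sumset_neq0 => //; case: gd => -[_ ne _] _ _; apply: ne; rewrite inE eqxx.
by case: gd => -[_ /nonempty_cons[]].
Qed.

(** If p shared its coset, dropping it from B would not change X + A + B, since M stabilizes X + A;
    moving p to C would then lower the squares. *)
Lemma minimal_good_lone A B C R p : minimal_good (A :: B :: C :: R) -> (#|` C| + 2 <= #|` B|)%N ->
  p \in B -> p \notin C -> lone (Stab (sumset X A)) B p.
Proof.
move=> v cBC pB pC; apply: NNPP => nl; have gd := v.1.
have A0 : A != fset0 by case: gd => -[_ ne _] _ _; apply: ne; rewrite inE eqxx.
have V0 := sumset_neq0 X0 A0.
have [q [qB qp hqp]] := nlone nl.
have pe := perm_rot3 A B C R.
apply: (minimal_good_move (minimal_good_perm pe v) pB pC cBC qB qp (good_stab_first gd hqp)).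
rewrite -(ssum_perm X pe) -(ssum_perm X (perm_rot3 A _ _ R)) !ssum_cons.
rewrite (per_rem (Stab_subgroup V0) (Stab_per V0) nl).
by apply/ssumS/sumsetSS => //; apply: fsubsetUr.
Qed.

Lemma sub_mod K V B D B' D' : per K V ->
  (forall b d, b \in B -> d \in D -> exists b' d', [/\ b' \in B', d' \in D' & b + d - (b' + d') \in K]) ->
  sumset V (sumset B D) `<=` sumset V (sumset B' D').
Proof.
move=> pV h; apply/fsubsetP=> z /sumsetP[v [_ [vV /sumsetP[b [d [bB dD ->]]] ->]]].
have [b' [d' [bB' dD' hk]]] := h b d bB dD.
apply/sumsetP; exists (b + d - (b' + d') + v), (b' + d'); split; [exact: pV|exact: mem_sumset|zmod].
Qed.

(** By [card_inj] at least two terms of B are outside D + M, so one of them, p, lies in Z. It can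
    move from B to D: a lost sum p + d returns as b' + p, where b' in B is congruent to d. *)
Lemma rich_sub A B D Q : minimal_good (A :: B :: D :: Q) -> (#|` D| + 2 <= #|` B|)%N ->
  D `<=` sumset B (Stab (sumset X A)) -> False.
Proof.
move=> v cBD; set M := Stab _ => /fsubsetP DB.
have gd := v.1; have A0 : A != fset0 by case: gd => -[_ ne _] _ _; apply: ne; rewrite inE eqxx.
have V0 := sumset_neq0 X0 A0; have Mg : is_subgroup M := Stab_subgroup V0.
have lB p : p \in B -> p \notin D -> lone M B p by apply: minimal_good_lone v cBD.
have [oB oD] : admissible B /\ admissible D by case: gd => _ _ o; split; apply: o; rewrite !inE eqxx ?orbT.
have c2 : (1 < #|` B `\` sumset D M|)%N.
  have := card_inj Mg lB; have := cardfsDI B (sumset D M).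
  have := fsubset_leq_card (fsubsetIl D (sumset B M)); move: cBD; nlia.
have [p [pBD Zp]] : exists p, p \in B `\` sumset D M /\ Z p.
  have [x [y [xB yB xy]]] := two_of c2.
  case: (boolP (Z x)) => Zx; first by exists x.
  case: (boolP (Z y)) => Zy; first by exists y.
  case: oB => _ h; move: xB yB; rewrite !inE => /andP[_ xB] /andP[_ yB].
  by rewrite (h x y) ?eqxx in xy.
move: pBD; rewrite inE => /andP[pD pB].
have pD' : p \notin D by apply: contra pD => /(fsubsetP (sub_cl Mg D)).
have bp d b : d \in D -> b \in B -> d - b \in M -> b != p.
  by move=> dD bB hd; apply: contraNneq pD => e; apply/in_cl; exists d; rewrite // sgBC // -e.
have [d dD hdp] := oD.1 _ Zp; have /in_cl[b bB hdb] := DB _ dD.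
have hbp : H (b - p).
  by have := HB hdp (good_stab_first gd hdb); rewrite (_ : _ - _ - _ = b - p) //; zmod.
have pe := perm_rot3 A B D Q.
apply: (minimal_good_move (minimal_good_perm pe v) pB pD' cBD bB (bp _ _ dD bB hdb) hbp).
rewrite -(ssum_perm X pe) -(ssum_perm X (perm_rot3 A _ _ Q)) !ssum_cons; apply: ssumS.
rewrite -!(sumsetA (sumset X A)); apply: (sub_mod (Stab_per V0)) => b0 d0 bB0 dD0.
case: (eqVneq b0 p) => [->|b0p]; last first.
  by exists b0, d0; rewrite !inE b0p bB0 dD0 orbT subrr sg0.
have /in_cl[b' bB' hb'] := DB _ dD0.
exists b', p; rewrite !inE (bp _ _ dD0 bB' hb') bB' eqxx; split=> //.
by rewrite (_ : _ - _ = d0 - b') //; zmod.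
Qed.

Lemma tot_arr As : arrangement As -> tot As = size S.
Proof. by case=> _ _; apply: tot_count. Qed.

Lemma sum_lone K As : is_subgroup K -> (forall A, A \in As -> exists2 x, x \in A & lone K A x) ->
  (tot As + size As * #|` K| <= \sum_(A <- As) #|` sumset A K| + size As)%N.
Proof.
move=> Kg; elim: As => [|A As IH] h; first by rewrite /tot !big_nil.
have [x xA lx] := h A (mem_head _ _); have c := card_lone1 Kg xA lx.
have := IH (fun B hB => h B (mem_behead (s := A :: As) hB)).
by rewrite tot_cons big_cons /= mulSn; move: c; nlia.
Qed.

(* When this fails, the lower bound of the theorem for [n - 1] modulo [M] keeps the total sumset large. *)
Definition small_rest A J := let M := Stab (sumset X A) in
  (#|` sumset X A| + \sum_(D <- J) #|` sumset D M| + n < #|` X| + size S + n.-1 * #|` M|)%N.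

(** If each of the blocks after B had a lone term, each would gain |M| - 1 in its closure, and B
    gains this twice. Together with Kneser's theorem for X + A this contradicts [small_rest]. *)
Lemma exists_rich A B C R : minimal_good (A :: B :: C :: R) -> (#|` C| + 2 <= #|` B|)%N -> small_rest A (B :: C :: R) ->
  exists2 D, D \in C :: R & forall x, x \in D -> ~ lone (Stab (sumset X A)) D x.
Proof.
move=> v cBC; rewrite /small_rest /=; set M := Stab _ => hg.
have gd := v.1; have A0 : A != fset0 by case: gd => -[_ ne _] _ _; apply: ne; rewrite inE eqxx.
have V0 := sumset_neq0 X0 A0; have Mg : is_subgroup M := Stab_subgroup V0.
have lB p : p \in B -> p \notin C -> lone M B p by apply: minimal_good_lone v cBC.
apply: NNPP => no.
have h D : D \in C :: R -> exists2 x, x \in D & lone M D x.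
  move=> DC; apply: NNPP => no'; apply: no; exists D => // x xD lx; apply: no'; by exists x.
have c1 := sum_lone Mg h.
have [x [y [xB yB xy]]] : exists x y, [/\ x \in B `\` C, y \in B `\` C & x != y].
  apply: two_of; have := cardfsDI B C; have := fsubset_leq_card (fsubsetIr B C).
  by move: cBC; nlia.
move: xB yB; rewrite !inE => /andP[xC xB] /andP[yC yB].
have c2 := card_lone2 Mg xB yB xy (lB x xB xC) (lB y yB yC).
have c3 := kneser X0 A0; have c4 := card_cl_ge Mg X; have c5 := card_cl_ge Mg A.
have [ar _ _] := gd; have c6 := tot_arr ar; have c7 : n = (size (C :: R)).+2 by case: ar => <-.
move: hg c1 c2; rewrite big_cons c7 /= -c6 !tot_cons -/M => hg c1 c2.
rewrite mulSn in hg; move: c3 c4 c5; rewrite -/M => c3 c4 c5.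
by move: hg c1 c2; move: (size R).+1 => s; rewrite /tot !big_cons; nlia.
Qed.

(** Each coset of an element of [T] is met again by the rest of [D'], which therefore has at least
    |T| elements. *)
Lemma card_rich K D' T : is_subgroup K -> T `<=` D' -> sep K T ->
  (forall x, x \in T -> exists y, [/\ y \in D', y != x & y - x \in K]) -> (2 * #|` T| <= #|` D'|)%N.
Proof.
move=> Kg TD sT h.
have : sumset T K `<=` sumset (D' `\` T) K.
  apply: clS => //; apply/fsubsetP=> x xT; have [y [yD yx hy]] := h x xT.
  apply/in_cl; exists y; last by rewrite sgBC.
  by rewrite inE yD andbT; apply: contra yx => yT; apply/eqP/sT.
move=> /fsubset_leq_card; rewrite card_sep // => c1.
have := leq_trans c1 (card_cl_le _ Kg); rewrite leq_pmul2r ?sg_gt0 // cardfsDS //.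
by have := fsubset_leq_card TD; nlia.
Qed.

(* A transversal of the part of [D] outside [B + M] is traded for as many terms of [B] outside [D + M]. *)
Lemma exchange A B D Q : let M := Stab (sumset X A) in
  good (A :: B :: D :: Q) -> (#|` D| < #|` B|)%N -> ~ D `<=` sumset B M ->
  (forall x, x \in D -> ~ lone M D x) -> (forall p, p \in B -> p \notin D -> lone M B p) ->
  exists B' D', [/\ good (A :: B' :: D' :: Q), #|` B'| = #|` B|, #|` D'| = #|` D| &
    (#|` sumset B M| + #|` sumset D M| < #|` sumset B' M| + #|` sumset D' M|)%N].
Proof.
move=> M gd cBD nDB rD lB.
have A0 : A != fset0 by case: gd => -[_ ne _] _ _; apply: ne; rewrite inE eqxx.
have V0 := sumset_neq0 X0 A0; have Mg : is_subgroup M := Stab_subgroup V0.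
have [oB oD] : admissible B /\ admissible D by case: gd => _ _ o; split; apply: o; rewrite !inE eqxx ?orbT.
pose D' := D `\` sumset B M.
have [Tc [TcD' sTc eTc]] := ex_transversal D' Mg.
have TcD : Tc `<=` D by apply: fsubset_trans TcD' _; apply: fsubsetDl.
have TcB x : x \in Tc -> x \notin sumset B M by move=> /(fsubsetP TcD'); rewrite inE => /andP[].
have BM := fsubsetP (sub_cl Mg B); have DM := fsubsetP (sub_cl Mg D).
have c1 : (2 * #|` Tc| <= #|` D'|)%N.
  apply: (card_rich Mg TcD' sTc) => x xT; have [y [yD yx hy]] := nlone (rD x (fsubsetP TcD x xT)).
  exists y; rewrite inE yD yx hy andbT; split=> //.
  by rewrite (per_mem Mg _ hy) ?TcB //; apply: per_cl.
have Tc0 : (0 < #|` Tc|)%N.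
  have /fsubsetPn[x xD xB] : ~~ (D `<=` sumset B M) by apply/negP.
  rewrite cardfs_gt0; apply/fset0Pn.
  have : x \in sumset Tc M by rewrite eTc; apply: (fsubsetP (sub_cl Mg D')); rewrite inE xB.
  by move=> /in_cl[y yT _]; exists y.
pose F := [fset x in B `\` sumset D M | Z x].
(* By [card_inj], B has more terms outside D + M than D has outside B + M, namely at least 2|Tc| +
   1, and at most one of them is outside Z. *)
have cF : (#|` Tc| <= #|` F|)%N.
  have c2 := card_inj Mg lB; have c3 := cardfsDI B (sumset D M); have c4 := cardfsDI D (sumset B M).
  have c5 : (#|` (B `\` sumset D M) `\` F| <= 1)%N.
    rewrite leqNgt; apply/negP=> /two_of[x [y [xB yB xy]]]; move: xB yB; rewrite !inE.
    case: (boolP (x \in B)) => xB; last by rewrite !andbF.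
    case: (boolP (y \in B)) => yB; last by rewrite !andbF.
    case: (boolP (Z x)) => Zx; first by case: (x \in sumset D M).
    case: (boolP (Z y)) => Zy; first by case: (y \in sumset D M); rewrite ?andbF.
    by rewrite (oB.2 x y) ?eqxx in xy.
  have c6 : F `<=` B `\` sumset D M by apply/fsubsetP=> x; rewrite !inE => /andP[-> _].
  have c7 := cardfsDS c6; rewrite c7 in c5.
  have c8 := fsubset_leq_card c6; move: c1 c2 c3 c4 c5 c8 cBD; rewrite -/D'; nlia.
have [T TF cT] := sub_of_card cF.
have TP x : x \in T -> [/\ x \in B, x \notin sumset D M & Z x].
  by move=> /(fsubsetP TF); rewrite !inE => /andP[/andP[h1 h3'] h4].
have TB : T `<=` B by apply/fsubsetP=> x /TP[].
have clD : sumset (D `\` Tc) M = sumset D M.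
  apply/eqP; rewrite eqEfsubset sumsetSS ?fsubsetDl //= clS //; apply/fsubsetP=> x xD; apply/in_cl.
  case: (boolP (x \in Tc)) => xT; last by exists x; rewrite ?subrr ?sg0 // inE xT.
  have [y [yD yx hy]] := nlone (rD x xD); exists y; last by rewrite sgBC.
  by rewrite inE yD andbT; apply: contra yx => yT; apply/eqP/sTc.
have TcZ x : x \in Tc -> Z x.
  move=> /(fsubsetP TcD) xD; have [y [yD yx hy]] := nlone (rD x xD).
  exact: admissible_Z oD xD yD yx (good_stab_first gd hy).
have notT d b : d \in D -> b \in B -> d - b \in M -> b \notin T.
  move=> dD bB hd; apply/negP=> /TP[_ h _]; case/negP: h; apply/in_cl; exists d; rewrite // sgBC //.
(* The sizes stay the same. D keeps its closure without [Tc], having no lone terms, and gains the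
   cosets of [T]; B gains at least as much from [Tc] as it loses with [T]. *)
pose B' := Tc `|` (B `\` T); pose D2 := T `|` (D `\` Tc).
have repB d : d \in D -> exists2 b, b \in B' & d - b \in M.
  move=> dD; case: (boolP (d \in sumset B M)) => dB.
    by have /in_cl[b bB hb] := dB; exists b; rewrite // !inE (notT d b) ?bB ?orbT.
  have : d \in sumset Tc M by rewrite eTc; apply: (fsubsetP (sub_cl Mg D')); rewrite inE dB.
  by move=> /in_cl[b bT hb]; exists b; rewrite // !inE bT.
have repD d : d \in D -> exists2 b, b \in D2 & d - b \in M.
  move=> /DM; rewrite -clD => /in_cl[b bD hb]; exists b => //.
  by move: bD; rewrite !inE => ->; rewrite orbT.
have TcT x : x \in Tc -> x \in T -> False by move=> /TcB h /TP[/BM]; rewrite (negPf h).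
have dj1 : [disjoint Tc & B `\` T]%fset.
  by apply/fdisjointP=> x /TcB h; rewrite inE; apply: contra h => /andP[_ /BM].
have dj2 : [disjoint T & D `\` Tc]%fset.
  by apply/fdisjointP=> x /TP[_ h _]; rewrite inE; apply: contra h => /andP[_ /DM].
have cB' : #|` B'| = #|` B|.
  by rewrite cardfsU disjoint_fsetI0 // cardfs0 subn0 cardfsDS // cT; have := fsubset_leq_card TB; nlia.
have cD2 : #|` D2| = #|` D|.
  by rewrite cardfsU disjoint_fsetI0 // cardfs0 subn0 cardfsDS // cT; have := fsubset_leq_card TcD; nlia.
exists B', D2; split=> //; last first.
  have -> : #|` sumset B' M| = (#|` sumset (B `\` T) M| + #|` Tc| * #|` M|)%N.
    rewrite -(card_sep Mg sTc) /B' cl_U cardfsU addnC disjoint_fsetI0 ?cardfs0 ?subn0 //.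
    apply/fdisjointP=> x /in_cl[y yT hy]; apply: contra (TcB y yT) => /in_cl[b]; rewrite inE => /andP[_ bB] hb.
    by apply/in_cl; exists b => //; apply: sg_trans hb; rewrite // sgBC.
  have h1 : (#|` sumset B M| <= #|` sumset (B `\` T) M| + #|` Tc| * #|` M|)%N.
    rewrite -cT; apply: leq_trans (leq_add (leqnn _) (card_cl_le T Mg)).
    apply: leq_trans (leq_subr #|` sumset (B `\` T) M `&` sumset T M| _).
    rewrite -cardfsU -cl_U; apply/fsubset_leq_card/sumsetSS => //.
    by apply/fsubsetP=> x xB; rewrite !inE xB; case: (x \in T).
  have h2' : (#|` sumset D M| < #|` sumset D2 M|)%N.
    have : (0 < #|` T|)%N by rewrite cT.
    rewrite cardfs_gt0 => /fset0Pn[x xT]; have [_ h _] := TP x xT.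
    have : x |` sumset D M `<=` sumset D2 M.
      rewrite /D2 cl_U clD fsubUset fsub1set fsubsetUr andbT inE.
      by rewrite (fsubsetP (sub_cl Mg _) x xT).
    by move/fsubset_leq_card; rewrite cardfsU1 h.
  by move: h1 h2'; nlia.
have [[a1 a2 a3] u o] := gd.
have nT : T != fset0 by rewrite -cardfs_gt0 cT.
have nTc : Tc != fset0 by rewrite -cardfs_gt0.
split.
- split=> //.
    move/nonempty_cons: a2 => [_ /nonempty_cons[_ /nonempty_cons[_ ne]]].
    do !(apply/nonempty_cons; split=> //).
      by rewrite -cardfs_gt0 cB'; move: cBD; nlia.
    by rewrite -cardfs_gt0 (leq_trans _ (fsubset_leq_card (fsubsetUl T _))) // cardfs_gt0.
  move=> x; rewrite -a3 !cnt_cons !inE.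
  case: (boolP (x \in Tc)) => /= h.
    rewrite (fsubsetP TcD x h) orbF; have /negPf-> : x \notin B by apply: contra (TcB x h) => /BM.
    by case: (boolP (x \in T)) => // /(TcT x h).
  case: (boolP (x \in T)) => //= hT; have [xB xD _] := TP x hT; rewrite xB.
  have /negPf-> // : x \notin D by apply: contra xD => /DM.
- apply: hU u; rewrite !ssum_cons; apply: ssumS; rewrite -!(sumsetA (sumset X A)).
  apply: (sub_mod (Stab_per V0)) => b d bB dD; rewrite -/M.
  have [d1 d1D h1] := repD d dD.
  (* If b has gone to the other block, the two summands change places, and d is replaced by a
     congruent term of B'. *)
  case: (boolP (b \in T)) => bT; last first.
    exists b, d1; rewrite !inE bT bB orbT; split=> //.
      by move: d1D; rewrite !inE.
    by rewrite (_ : _ - _ = d - d1) //; zmod.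
  have [b1 b1B h1'] := repB d dD; exists b1, b; split=> //; first by rewrite !inE bT.
  by rewrite (_ : _ - _ = d - b1) //; zmod.
- move=> E; rewrite !inE => /or4P[/eqP->|/eqP->|/eqP->|EQ]; last by apply: o; rewrite !inE EQ !orbT.
  + by apply: o; rewrite inE eqxx.
  + split=> [z Zz|x y].
      have [d dD hd] := oD.1 z Zz; have [b bB hb] := repB d dD; exists b => //.
      by have := HB hd (good_stab_first gd hb); rewrite (_ : _ - _ - _ = b - z) //; zmod.
    rewrite !inE => /orP[/TcZ->//|/andP[_ xB]] /orP[/TcZ->//|/andP[_ yB]]; exact: oB.2.
  + split=> [z Zz|x y].
      have [d dD hd] := oD.1 z Zz; have [b bB hb] := repD d dD; exists b => //.
      by have := HB hd (good_stab_first gd hb); rewrite (_ : _ - _ - _ = b - z) //; zmod.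
    rewrite !inE => /orP[/TP[_ _ ->]//|/andP[_ xB]] /orP[/TP[_ _ ->]//|/andP[_ yB]]; exact: oD.2.
Qed.

Lemma good_size A Bs : good (A :: Bs) -> size Bs = n.-1.
Proof. by case=> -[<-]. Qed.

(** Among the minimal arrangements with first block A take one with the largest total closure modulo
    M. The exchange preserves the squares but increases this total. *)
Lemma not_all_small_rest A B C R : minimal_good (A :: B :: C :: R) -> (#|` C| + 2 <= #|` B|)%N ->
  (forall B C R, minimal_good (A :: B :: C :: R) -> (#|` C| + 2 <= #|` B|)%N -> small_rest A (B :: C :: R)) -> False.
Proof.
move=> v0 cBC0 hg; set M := Stab (sumset X A) in hg.
have A0 : A != fset0 by case: v0 => -[[_ ne _] _ _] _; apply: ne; rewrite inE eqxx.
have V0 := sumset_neq0 X0 A0; have Mg : is_subgroup M := Stab_subgroup V0.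
have [||[[B1 C1] R1] [/= v cBC] mx] := @exists_max _
   (fun t => minimal_good (A :: t.1.1 :: t.1.2 :: t.2) /\ (#|` t.1.2| + 2 <= #|` t.1.1|)%N)
   (fun t => \sum_(D <- t.1.1 :: t.1.2 :: t.2) #|` sumset D M|)%N (n.-1 * #|` sumset [fset x in S] M|)%N.
- by exists (B, C, R).
- move=> [[B1 C1] R1] [/= v _]; rewrite -(good_size v.1); apply: sum_leq => D DJ.
  apply/fsubset_leq_card/sumsetSS => //; apply/fsubsetP=> x xD; rewrite inE -has_pred1 has_count.
  case: v => -[[_ _ <-] _ _] _; rewrite -has_count; apply/hasP; exists D => //=.
  by move: DJ; rewrite !inE => ->; rewrite !orbT.
move: B1 C1 R1 v cBC mx {B C R v0 cBC0} => B C R v cBC mx.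
have [D DC rD] := exists_rich v cBC (hg _ _ _ v cBC); have gd := v.1.
have [Q pQ] := perm_pick DC.
have pA : perm_eq (A :: B :: C :: R) (A :: B :: D :: Q) by rewrite !perm_cons.
have vD := minimal_good_perm pA v.
(* Otherwise D and C form an unbalanced pair, and a term of D outside C would be lone. *)
have cDC : (#|` D| <= #|` C| + 1)%N.
  rewrite leqNgt; apply/negP=> lt.
  have DR : D \in R by move: DC; rewrite inE => /orP[/eqP e|//]; move: lt; rewrite e; nlia.
  have [R1 pR] := perm_pick DR.
  have [a aD aC] : exists2 a, a \in D & a \notin C by apply: lt_card_mem; move: lt; nlia.
  have pe : perm_eq (A :: B :: C :: R) (A :: D :: C :: B :: R1).
    rewrite perm_cons; apply: (perm_trans (y := B :: C :: D :: R1)); first by rewrite !perm_cons.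
    by apply: perm_trans (perm_rot3 B C D R1) (perm_swap _ _ _).
  have := minimal_good_lone (minimal_good_perm pe v) _ aD aC; rewrite -/M => h; apply: (rD a aD); apply: h; by move: lt; nlia.
(* If |D| = |B| - 1, then |D| = |C| + 1, and moving a term from D to C merely interchanges these
   sizes. The arrangement stays minimal and the smaller D forms an unbalanced pair with B. *)
have [D1 [Q1 [v1 D1D clD1 cD1]]] : exists D1 Q1, [/\ minimal_good (A :: B :: D1 :: Q1), D1 `<=` D,
    sumset D1 M = sumset D M & (#|` D1| + 2 <= #|` B|)%N].
  case: (leqP (#|` D| + 2) #|` B|) => h; first by exists D, Q.
  have [a aD aC] : exists2 a, a \in D & a \notin C by apply: lt_card_mem; move: h cBC; nlia.
  have DR : D \in R by move: DC; rewrite inE => /orP[/eqP e|//]; move: h cBC; rewrite e; nlia.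
  have [R1 pR] := perm_pick DR.
  have pe : perm_eq (A :: B :: C :: R) (D :: C :: A :: B :: R1).
    apply: (perm_trans (y := A :: B :: C :: D :: R1)); first by rewrite !perm_cons.
    by apply: perm_trans (perm_swap _ _ _); rewrite (perm_catCA [:: A; B] [:: C; D] R1).
  have pe' (x y : {fset G}) : perm_eq (x :: y :: A :: B :: R1) (A :: B :: x :: y :: R1).
    by rewrite (perm_catCA [:: x; y] [:: A; B] R1).
  have [q [qD qa hq]] := nlone (rD a aD).
  have g1 := good_perm pe gd.
  have g2 : good (D `\ a :: a |` C :: A :: B :: R1).
    apply: (good_move g1 aD aC qD qa (good_stab_first gd hq)).
    rewrite !(ssum_perm X (pe' _ _)) !ssum_cons; apply: ssumS.
    rewrite (per_rem Mg _ (rD a aD)); last by apply: per_sumset; apply: Stab_per.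
    by apply: sumsetSS => //; apply: fsubsetUr.
  have aD' := fsubsetP (fsubD1set D a).
  exists (D `\ a), (a |` C :: R1); split.
  - apply: (minimal_good_perm (pe' _ _)); split=> // Bs /v.2.
    rewrite (sum_squares_perm pe) !sum_squares_cons cardfsU1 aC (cardfsD1 a D) aD.
    by have := cardfsD1 a D; rewrite aD; move: (sum_squares R1) (sum_squares Bs) h cBC cDC => s1 s2; nlia.
  - exact/fsubsetP.
  - exact: cl_rem (rD a aD).
  - by have := cardfsD1 a D; rewrite aD; move: h cDC cBC; nlia.
have lB p : p \in B -> p \notin D -> lone M B p.
  by move=> pB pD; apply: minimal_good_lone v1 cD1 _ _ => //; apply: contra pD => /(fsubsetP D1D).
have nDB : ~ D `<=` sumset B M.
  move=> DB; apply: (rich_sub v1 cD1); exact: fsubset_trans D1D DB.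
have cDB : (#|` D| < #|` B|)%N by move: cDC cBC; nlia.
have [B' [D' [g' cB' cD' lt]]] := exchange vD.1 cDB nDB rD lB.
have v' : minimal_good (A :: B' :: D' :: Q).
  by split=> // Bs /vD.2; rewrite !sum_squares_cons cB' cD'.
have [E [R' [pR' cE]]] : exists E R', perm_eq (D' :: Q) (E :: R') /\ (#|` E| + 2 <= #|` B'|)%N.
  have : C \in D :: Q by rewrite -(perm_mem pQ) inE eqxx.
  rewrite inE => /orP[/eqP e|CQ]; first by exists D', Q; rewrite cB' cD' -e.
  have [R' pR'] := perm_pick CQ; exists C, (D' :: R'); split; last by rewrite cB'.
  exact: perm_ins.
have pE : perm_eq (A :: B' :: D' :: Q) (A :: B' :: E :: R') by rewrite !perm_cons.
have := mx (B', E, R') (conj (minimal_good_perm pE v') cE); rewrite leqNgt => /negP; apply=> /=.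
have -> : (\sum_(D0 <- [:: B', E & R']) #|` sumset D0 M| = \sum_(D0 <- [:: B', D' & Q]) #|` sumset D0 M|)%N.
  by apply: perm_big; rewrite perm_cons perm_sym.
have -> : (\sum_(D0 <- [:: B, C & R]) #|` sumset D0 M| = \sum_(D0 <- [:: B, D & Q]) #|` sumset D0 M|)%N.
  by apply: perm_big; rewrite perm_cons.
by rewrite !big_cons /=; move: lt; rewrite -/M; nlia.
Qed.

(** Translates the second alternative obtained modulo M, with its own set Z2, into the conditions
    for the given H and Z. Both halves compare numbers of terms with the number of blocks. *)
Lemma admissible_refill V As (J : seq {fset G}) P : let M := Stab V in let W := ssum V As in
  let Z2 := fun x => all (fun A => x \in sumset A (Stab W)) As in
  V != fset0 -> nonempty As -> (forall g, g \in M -> H g) -> (forall g, g \in Stab W -> H g) ->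
  (forall D, D \in J -> admissible D) -> size As = size J -> (forall x, cnt x As <= cnt x J)%N ->
  (forall x, (cnt x As < cnt x J)%N -> Z2 x) ->
  (forall A, A \in As -> forall x y, x \in A -> y \in A -> ~~ Z2 x -> ~~ Z2 y -> x = y) ->
  coset_extension M As (Sseq J) P -> (forall x, cnt x (unzip2 P) = cnt x J) -> size (unzip2 P) = size J ->
  forall B, B \in unzip2 P -> admissible B.
Proof.
move=> M W Z2 V0 neA MH WH oJ sAJ hc hZ uA oP cP sPJ b bP.
have Mg : is_subgroup M := Stab_subgroup V0.
have W0 : W != fset0 by apply: ssum_neq0.
have Wg : is_subgroup (Stab W) := Stab_subgroup W0.
have MW := fsubsetP (Stab_ssum V0 neA); rewrite -/M -/W in MW.
have [pP okP'] := oP; have /mapP[[a b0] abP /= eb] := bP; move: abP; rewrite -eb => abP {b0 eb}.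
have aAs : a \in As by rewrite -(perm_mem pP); apply: (map_f fst abP).
have [/= eab sab] := okP' _ abP.
have HD x y z : H (x - y) -> H (y - z) -> H (x - z).
  move=> h3' h4; have h0 : H (0 : G) by rewrite -(subrr (x - y)); apply: HB.
  have := HB h3' (HB h0 h4); rewrite (_ : x - y - _ = x - z) //; zmod.
have HN x y : H (x - y) -> H (y - x).
  by move=> h3'; have h0 : H (0 : G) by [rewrite -(subrr (x - y)); apply: HB];
     have := HB h0 h3'; rewrite (_ : 0 - _ = y - x) //; zmod.
have cJZ x : ~~ Z2 x -> count_mem x (Sseq As) = count_mem x (Sseq J).
  move=> Zx; rewrite !count_Sseq; apply/eqP; rewrite eqn_leq hc leqNgt; apply/negP=> /hZ; by rewrite (negPf Zx).
have meet (a' b' : {fset G}) u : (a', b') \in P -> Z2 u -> exists2 v, v \in b' & H (v - u).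
  move=> ab' /allP/(_ a'); rewrite -(perm_mem pP) (map_f fst ab') => /(_ isT)/in_cl[a0 a0a h].
  have : a0 \in sumset b' M by have [/= <- _] := okP' _ ab'; apply: (fsubsetP (sub_cl Mg a')).
  move=> /in_cl[v vb h']; exists v => //; apply: HN; apply: HD (WH _ h) (MH _ h').
split=> [z Zz|x y xb yb Zx Zy].
- case: (classic (exists y, [/\ y \in Sseq J, H (y - z) & Z2 y])) => [[y [_ hy Zy]]|no].
    by have [v vb hv] := meet _ _ _ abP Zy; exists v => //; apply: HD hv hy.
  (* Now no term congruent to z lies in Z2, so [As] uses all of them, at most one per block. There
     are at least as many as blocks, so each block has one. *)
  have noZ y : y \in Sseq J -> H (y - z) -> ~~ Z2 y by move=> yJ hy; apply/negP=> Zy; apply: no; exists y.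
  have e : count (fun y => H (y - z)) (Sseq J) = count (fun y => H (y - z)) (Sseq As).
    apply: eq_count_mem => y hy; case: (boolP (y \in Sseq J)) => yJ; first by rewrite cJZ ?noZ.
    rewrite (count_memPn yJ); apply/esym/eqP; rewrite -leqn0 -(count_memPn yJ) !count_Sseq; exact: hc.
  have c1 : (size J <= count (fun y => H (y - z)%R) (Sseq J))%N.
    by apply: count_ge1 => D DJ; have [h _] := oJ D DJ; have [d dD hd] := h z Zz; exists d.
  have mJ (A : {fset G}) x : A \in As -> x \in A -> x \in Sseq J.
    move=> AAs xA; rewrite -has_pred1 has_count count_Sseq; apply: leq_trans (hc x).
    by rewrite -has_count; apply/hasP; exists A.
  have c2 : (count (fun y => H (y - z)%R) (Sseq As) <= count (fun A => has (fun y => H (y - z)%R) (enum_fset A)) As)%N.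
    apply: count_le1 => A AAs x y xA yA hx hy; apply: (uA A AAs) => //; apply: noZ => //; exact: mJ AAs _.
  have : all (fun A => has (fun y => H (y - z)%R) (enum_fset A)) As.
    by rewrite all_count eqn_leq count_size sAJ (leq_trans c1) // e.
  move=> /allP/(_ a aAs)/hasP[a0 a0a ha].
  have : a0 \in sumset b M by rewrite -eab; apply: (fsubsetP (sub_cl Mg a)).
  by move=> /in_cl[v vb hv]; exists v => //; apply: HD (HN _ _ (MH _ hv)) ha.
- apply/eqP; apply: contraT => xy.
  (* If u outside Z were in Z2, every other block would contain a congruent term, also outside Z.
     With the two such terms of b there would be more of them than blocks. *)
  have bad u : ~~ Z u -> Z2 u -> False.
    move=> Zu Z2u; have [Q pQ] := perm_pick bP.
    have nZ v : H (v - u) -> ~~ Z v by move=> hv; apply: contra Zu => Zv; apply: ZH Zv _; apply: HN.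
    have c1 : (count (fun v => ~~ Z v) (Sseq (unzip2 P)) <= size J)%N.
      rewrite (@eq_count_mem _ _ _ (Sseq J)); last by move=> v _; rewrite !count_Sseq cP.
      apply: leq_trans (count_le1 _) (count_size _ _) => D DJ; exact: (oJ D DJ).2.
    have c2 : count (fun v => ~~ Z v) (Sseq (unzip2 P)) = count (fun v => ~~ Z v) (Sseq (b :: Q)).
      by apply: eq_count_mem => v _; rewrite !count_Sseq (cnt_perm v pQ).
    have c3 : (size Q <= count (fun v => ~~ Z v) (Sseq Q))%N.
      apply: count_ge1 => D DQ; have : D \in unzip2 P by rewrite (perm_mem pQ) inE DQ orbT.
      move=> /mapP[[a' b'] ab' /= ->]; have [v vb hv] := meet _ _ _ ab' Z2u; exists v => //; exact: nZ.
    have c4 : (1 < count (fun v => ~~ Z v) (enum_fset b))%N.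
      rewrite -size_filter; have xF : x \in [seq v <- b | ~~ Z v] by rewrite mem_filter Zx.
      have yF : y \in [seq v <- b | ~~ Z v] by rewrite mem_filter Zy.
      by move: xF yF xy; case: (filter _ _) => [|u1 [|u2 s]] //=; rewrite !inE => /eqP-> /eqP->; rewrite eqxx.
    have c5 := perm_size pQ; rewrite sPJ /= in c5.
    by move: c1; rewrite c2 /Sseq /= count_cat c5 leqNgt => /negP; apply; rewrite -addn2 addnC; apply: leq_add.
  have zx : ~~ Z2 x by apply/negP=> /(bad x Zx).
  have zy : ~~ Z2 y by apply/negP=> /(bad y Zy).
  have Z2per u v : u - v \in M -> Z2 v -> Z2 u.
    move=> huv /allP h; apply/allP=> A AAs; rewrite (per_mem Wg _ (MW _ huv)) ?h //; exact: per_cl.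
  have rp u : u \in b -> exists2 w, w \in a & u - w \in M.
    by move=> /(fsubsetP (sub_cl Mg b)); rewrite -eab => /in_cl.
  have [a1 a1a h1] := rp x xb; have [a2 a2a h2'] := rp y yb.
  have e : a1 = a2.
    apply: (uA a aAs) => //; [apply: contra zx|apply: contra zy]; exact: Z2per.
  have hxy : x - y \in M by apply: (sg_trans Mg h1); rewrite sgBC // e.
  have [e'|[l hl hxl]] := sab x y xb yb hxy; first by rewrite e' eqxx in xy.
  case/negP: zx; apply: Z2per hxl _; apply: hZ; by rewrite -(count_Sseq l J).
Qed.

Lemma equitable_lt A J J' B C R : perm_eq J (B :: C :: R) -> (#|` C| + 2 <= #|` B|)%N ->
  size J' = size J -> tot J' = tot J -> equitable J' -> (sum_squares (A :: J') < sum_squares (A :: J))%N.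
Proof.
move=> pe cBC sJ tJ eJ; rewrite !sum_squares_cons ltn_add2l.
have J0 : J' <> [::] by move=> e; move: sJ; rewrite e (perm_size pe).
have [k hk] := equitable_k J0 eJ.
apply: (@equitable_sq _ (fun D : {fset G} => #|` D|) J' J k #|` B| #|` C|) => //.
by exists [seq #|` D| | D : {fset G} <- R]; apply: (perm_map (fun D : {fset G} => #|` D|) pe).
Qed.

(** If [small_rest] fails, the first two alternatives for n - 1 blocks modulo M give equitable
    blocks. Refilled, these form a good arrangement with fewer squares than the minimum. *)
Lemma small_rest_or_klein A B C R : (1 < n.-1)%N -> theorem_at G n.-1 -> minimal_good (A :: B :: C :: R) -> (#|` C| + 2 <= #|` B|)%N ->
  small_rest A (B :: C :: R) \/
  let V := sumset X A in let M := Stab V in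
  [/\ n = 3%N, R = [::] & exists A1 A2 beta K N, [/\
     [/\ A1 != fset0, A2 != fset0, sep M A1, sep M A2 & tot [:: A1; A2] = N],
     forall x, (cnt x [:: A1; A2] <= cnt x [:: B; C])%N,
     (#|` X| + size S + 2 * #|` M| <= #|` V| + N * #|` M| + 3)%N &
     klein V M (Sseq [:: B; C]) A1 A2 beta K N]].
Proof.
move=> n1 hn v cBC; set J := B :: C :: R; have gd := v.1.
have A0 : A != fset0 by case: gd => -[_ ne _] _ _; apply: ne; rewrite inE eqxx.
have V0 := sumset_neq0 X0 A0; have sJ : size J = n.-1 := good_size gd.
have neJ : nonempty J by case: gd => -[_ /nonempty_cons[]].
have n0 : n = n.-1.+1 by case: (n) n1.
have [As [N [[sA neA hc tA hs] cJ hsat out]]] := theorem_at_apply (ltnW n1) hn V0 neJ sJ.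
case: (classic (small_rest A J)) => hg; [by left|right].
have ng : (#|` X| + size S + n.-1 * #|` Stab (sumset X A)| <= #|` sumset X A| + N * #|` Stab (sumset X A)| + n)%N.
  by rewrite leqNgt; apply/negP=> h; apply: hg; apply: leq_ltn_trans h; rewrite leq_add2r leq_add2l.
have key : equitable As -> (forall P, coset_extension (Stab (sumset X A)) As (Sseq J) P -> (forall x, cnt x (unzip2 P) = cnt x J) ->
    size (unzip2 P) = size J -> ssum (sumset X A) (unzip2 P) = ssum (sumset X A) As ->
    arrangement (A :: unzip2 P) -> good (A :: unzip2 P)) -> False.
  move=> eqA h.
  have [P [oP cP eP neP [szP eW]]] := refill V0 (etrans sA (esym sJ)) neA hc hs eqA hsat.
  have a' : arrangement (A :: unzip2 P).
    case: gd => -[a1 a2 a3] _ _; split; first by rewrite /= szP sJ.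
      by apply/nonempty_cons.
    by move=> x; rewrite -a3 !cnt_cons cP.
  have := v.2 _ (h P oP cP szP eW a'); rewrite leqNgt => /negP; apply.
  apply: (equitable_lt A (perm_refl J) cBC) => //.
  rewrite (tot_count (S := Sseq J)) ?size_Sseq // => x; by rewrite count_Sseq.
case: out => [[eqA big]|[eqA [eY hZ uA]]|[n2 [A1 [A2 [beta [K [eA kl]]]]]]].
- case: (key eqA) => P oP cP szP eW a'; apply: h3 => //; rewrite ssum_cons eW.
  by move: big ng; move: (n.-1 * _)%N (N * _)%N => u w; nlia.
- case: (key eqA) => P oP cP szP eW a'.
  have u' : U (ssum X (A :: unzip2 P)).
    rewrite ssum_cons eW -eY; apply: hU (_ : U (ssum X (A :: J))); last by case: gd.
    rewrite ssum_cons -sJ; apply: ssum_Sigma => x; by rewrite count_Sseq.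
  have WH g : g \in Stab (ssum (sumset X A) As) -> H g.
    rewrite -eW -ssum_cons; apply: h2 => //; last exact: arrangement_sub.
    by rewrite ssum_cons eW; apply: ssum_neq0.
  split=> // b; rewrite inE => /orP[/eqP->|bP]; first by case: gd => _ _; apply; rewrite inE eqxx.
  apply: (admissible_refill V0 neA (fun g => good_stab_first gd) WH _ (etrans sA (esym sJ)) hc hZ uA oP cP szP bP).
  by move=> D DJ; case: gd => _ _; apply; rewrite inE DJ orbT.
- have n3 : n = 3%N by rewrite n0 n2.
  have R0 : R = [::] by move: sJ; rewrite n2 /J /=; case: (R).
  move: neA hs tA hc ng; rewrite eA => /nonempty_cons[ne1 /nonempty_cons[ne2 _]] hs tA hc ng.
  split=> //; exists A1, A2, beta, K, N; split=> //.
  + by split=> //; apply: hs; rewrite !inE eqxx ?orbT.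
  + by move=> x; have := hc x; rewrite /J R0.
  + by move: ng; rewrite n3.
  + by move: kl; rewrite /J R0.
Qed.
End PartB.

(** * The Klein configuration *)

Section KleinGroup.
Variables (G : zmodType) (M K : {fset G}).
Implicit Types (A B C D X Y W L V : {fset G}) (x y z a b c g h w p q u v : G).
Hypotheses (Mg : is_subgroup M) (Kg : is_subgroup K) (MK : M `<=` K) (qKM : quot_is_Z2xZ2 K M).

Lemma Z2_cases (x : 'Z_2) : x = 0 \/ x = 1.
Proof. by case: x => [[|[|//]] hx]; [left|right]; apply: val_inj. Qed.

Lemma klein_double h : h \in K -> h + h \in M.
Proof.
case: qKM => f [fD [_ fM]] hK; rewrite -fM; last exact: sgD.
rewrite fD //; case: (f h) => u v; apply/eqP.
by case: (Z2_cases u) => ->; case: (Z2_cases v) => ->; congr pair; apply: val_inj.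
Qed.

Lemma klein_sum x y z : x \in K -> y \in K -> z \in K -> x \notin M -> y \notin M -> z \notin M ->
  x - y \notin M -> x - z \notin M -> y - z \notin M -> x + y - z \in M.
Proof.
case: qKM => f [fD [_ fM]] xK yK zK.
have f0 : f 0 = 0 by apply/eqP; rewrite fM ?sg0.
have fE u v : u \in K -> v \in K -> (u - v \in M) = (f u == f v).
  move=> uK vK; rewrite -fM; last exact: sgB.
  have e : f v + f (- v) = 0 by rewrite -fD ?subrr ?sgN.
  rewrite fD ?sgN //; apply/eqP/eqP => [e'|->//].
  by apply: (addIr (f (- v))); rewrite e'.
rewrite !fE // ?sgD // fD //; do 3!rewrite -fM //.
move: (f x) (f y) (f z) => [a a'] [b b'] [c c'].
case: (Z2_cases a) => ->; case: (Z2_cases a') => ->; case: (Z2_cases b) => ->;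
case: (Z2_cases b') => ->; case: (Z2_cases c) => ->; by case: (Z2_cases c') => ->.
Qed.

Lemma card_klein : #|` K| = (4 * #|` M|)%N.
Proof.
have [T [TK sT eT]] := ex_transversal K Mg.
have -> : K = sumset T M.
  rewrite eT; apply/esym/(per_cl_id Mg) => k a /(fsubsetP MK); exact: sgD.
rewrite card_sep //; congr (_ * _)%N.
case: qKM => f [fD [fs fM]]; have KT := fsubsetP TK.
have fN v : v \in K -> f v + f (- v) = 0 by move=> vK; rewrite -fD ?sgN //; apply/eqP; rewrite fM ?subrr ?sg0.
rewrite -(@card_fim G _ f T); last first.
  move=> x y /= xT yT e; apply: sT => //; rewrite -fM; last by apply: sgB => //; apply: KT.
  by rewrite fD ?sgN ?KT // e fN // KT.
rewrite (_ : [fset f x | x in T] = [fset v in [:: (0, 0); (0, 1); (1, 0); (1, 1)]]) /=.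
  by rewrite card_fseq.
apply/fsetP=> -[u v]; rewrite !inE; apply/imfsetP/idP => [_|_].
  by case: (Z2_cases u) => ->; case: (Z2_cases v) => ->.
have [x xK <-] := fs (u, v).
have /in_cl[t tT h] : x \in sumset T M by rewrite eT; apply: (fsubsetP (sub_cl Mg K)).
exists t => //=; have tK := KT t tT.
have : f (x - t) == 0 by rewrite fM // sgB.
by rewrite fD ?sgN // => /eqP e; apply: (addIr (f (- t))); rewrite e fN.
Qed.
End KleinGroup.

Section PerAdd.
Variables (G : zmodType) (M : {fset G}).
Implicit Types (A C : {fset G}) (p q : G).
Hypothesis Mg : is_subgroup M.
Lemma per_add1 A C p : per M A -> per M C -> A `<=` C -> p \in C -> p \notin A -> (#|` A| + #|` M| <= #|` C|)%N.
Proof.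
move=> pA pC AC pC' pA'.
have e := cl_add (A := A) Mg (x := p); rewrite (per_cl_id Mg pA) in e; rewrite -e //.
apply: fsubset_leq_card; rewrite -[X in _ `<=` X](per_cl_id Mg pC); apply: sumsetSS => //.
by rewrite fsubUset fsub1set pC'.
Qed.
Lemma per_add2 A C p q : per M A -> per M C -> A `<=` C -> p \in C -> p \notin A -> q \in C -> q \notin A ->
  p - q \notin M -> (#|` A| + 2 * #|` M| <= #|` C|)%N.
Proof.
move=> pA pC AC pC' pA' qC qA pq; have e := cl_add (A := A) Mg (x := q); rewrite (per_cl_id Mg pA) in e.
rewrite mul2n -addnn addnA -e //; apply: (per_add1 (p := p)) => //; first exact: per_cl.
  by rewrite -[X in _ `<=` X](per_cl_id Mg pC); apply: sumsetSS => //; rewrite fsubUset fsub1set qC.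
apply/negP=> /in_cl[u]; rewrite !inE => /orP[/eqP->|uA] h; first by rewrite h in pq.
by rewrite (per_mem Mg pA h) uA in pA'.
Qed.
End PerAdd.

(* [V] is [K]-periodic but for one [M]-coset [beta + M], every term of [SJ] lies in [I], which is [K]-periodic, or is one of the
   four representatives [DS] of the cosets of [M] in a coset of [K]. So a sum [V + (B1 + B2)] is [K]-periodic up to the
   cosets [beta + b + c + M] with [b] and [c] in [DS]. *)
Section Quad.
Variables (G : zmodType) (M K I V DS : {fset G}) (beta : G) (SJ : seq G).
Implicit Types (A B C D X W L : {fset G}) (x y z a b c g h w p q u v i j k l d e : G).
Hypotheses (Mg : is_subgroup M) (Kg : is_subgroup K) (MK : M `<=` K) (qKM : quot_is_Z2xZ2 K M).
Hypotheses (Vb : beta \in V) (VM : per M V).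
Hypothesis VK : forall h v, h \in K -> v \in V -> v - beta \notin M -> h + v \in V.
Hypothesis IK : per K I.
Hypothesis dK : forall d e, d \in DS -> e \in DS -> d - e \in K.
Hypothesis dM : forall d e, d \in DS -> e \in DS -> d - e \in M -> d = e.
Hypothesis dI : forall d, d \in DS -> d \notin I.
Hypothesis sSJ : forall x, x \in SJ -> x \in I \/ x \in DS.
Hypothesis cSJ : forall d, d \in DS -> (count_mem d SJ <= 1)%N.
Let Y := sumset V (Sigma_n 2 SJ).
Hypothesis nY : ~ per K Y.
Variables (i j k l : G).
Hypothesis eDS : DS = [fset i; j; k; l].
Hypothesis uDS : uniq [:: i; j; k; l].

Let iD : i \in DS. Proof. by rewrite eDS !inE eqxx. Qed.
Let jD : j \in DS. Proof. by rewrite eDS !inE eqxx !orbT. Qed.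
Let kD : k \in DS. Proof. by rewrite eDS !inE eqxx !orbT. Qed.
Let lD : l \in DS. Proof. by rewrite eDS !inE eqxx !orbT. Qed.

Let M_K g : g \in M -> g \in K. Proof. exact: (fsubsetP MK). Qed.

Lemma dneM d e : d \in DS -> e \in DS -> d != e -> d - e \notin M.
Proof. by move=> dD eD de; apply/negP=> h; rewrite (dM dD eD h) eqxx in de. Qed.

Let ne : [/\ i != j, i != k, i != l & [/\ j != k, j != l & k != l]].
Proof. by move: uDS; rewrite /= !inE !negb_or => /and4P[/and3P[? ? ?] /andP[? ?] ? _]. Qed.

(** The differences of i, j, k with l are the three nonzero classes of K/M, each the sum of the
    other two. Hence the sum of two labels is congruent to that of the complementary pair. *)
Lemma klein_labels_sum : i + j - (k + l) \in M.
Proof.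
have [ij ik il [jk jl kl]] := ne.
have h := @klein_sum G M K Mg Kg qKM (i - l) (j - l) (k - l).
have e u v : u - l - (v - l) = u - v by zmod.
rewrite !e (_ : i - l + (j - l) - (k - l) = i + j - (k + l)) in h; last by zmod.
by apply: h; rewrite ?dK ?dneM.
Qed.

Lemma pair_case B1 B2 z : (forall h b, h \in K -> b \in B1 -> b \in I -> h + b \in B1) ->
  (forall h b, h \in K -> b \in B2 -> b \in I -> h + b \in B2) ->
  z \in sumset V (sumset B1 B2) -> (forall h, h \in K -> h + z \in sumset V (sumset B1 B2)) \/
  exists b c, [/\ b \in B1, c \in B2, b \notin I, c \notin I & z - (beta + b + c) \in M].
Proof.
move=> h1 h2 /sumsetP[v [_ [vV /sumsetP[b [c [bB cC ->]]] ->]]].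
case: (boolP (v - beta \in M)) => hv; last first.
  by left=> h hK; rewrite addrA mem_sumset ?mem_sumset // VK.
case: (boolP (b \in I)) => bI.
  by left=> h hK; have e := mem_sumset vV (mem_sumset (h1 h b hK bB bI) cC); inz e.
case: (boolP (c \in I)) => cI.
  by left=> h hK; have e := mem_sumset vV (mem_sumset bB (h2 h c hK cC cI)); inz e.
by right; exists b, c; split=> //; inz hv.
Qed.

(** If a term lies in I, or the summand from V is not in beta + M, a translation by K is free to
    move the sum into X-like form with summands from B1 and B2. Otherwise both terms are labels, and
    different ones, as a label occurs once. *)
Lemma Sigma_case B1 B2 d1 d2 z : I `<=` sumset B1 M -> I `<=` sumset B2 M -> d1 \in DS -> d2 \in DS -> d1 \in B1 -> d2 \in B2 ->
  z \in Y -> z \in sumset V (sumset B1 B2) \/ exists d e, [/\ d \in DS, e \in DS, d != e & z - (beta + d + e) \in M].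
Proof.
move=> /fsubsetP I1 /fsubsetP I2 d1D d2D d1B d2B /sumsetP[v [u [vV /SigmaP[T [sT szT ->]] ->]]].
case: T sT szT => [|x [|y [|? ?]]] // sT _; rewrite /sigma !big_cons big_nil addr0.
have mT w : w \in [:: x; y] -> w \in SJ.
  by rewrite -!has_pred1 !has_count => h; apply: leq_trans h (sT w).
have VV w b c w' : b \in B1 -> c \in B2 -> w' \in V -> w - (w' + (b + c)) \in M -> w \in sumset V (sumset B1 B2).
  move=> bB cB wV h; have e := mem_sumset (VM h wV) (mem_sumset bB cB); inz e.
have II x' y' : x' \in I -> y' \in I -> v + (x' + y') \in sumset V (sumset B1 B2).
  move=> /I1/in_cl[b bB hb] /I2/in_cl[c cB hc]; apply: (VV _ b c v) => //.
  by have e := sgD Mg hb hc; inz e.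
have ID x' d : x' \in I -> d \in DS -> v + (x' + d) \in sumset V (sumset B1 B2).
  move=> x'I dD; have := IK (dK dD d2D) x'I => /I1/in_cl[b bB hb].
  by apply: (VV _ b d2 v) => //; inz hb.
case: (sSJ (mT x (mem_head _ _))) => xI; case: (sSJ (mT y (mem_last x [:: y]))) => yI.
- by left; apply: II.
- by left; apply: ID.
- by left; rewrite (addrC x); apply: ID.
have xy : x != y.
  apply/eqP=> e; have := leq_trans (sT x) (cSJ xI); by rewrite /= e !eqxx.
case: (boolP (v - beta \in M)) => hv; last first.
  left; apply: (VV _ d1 d2 (x + y - d1 - d2 + v)) => //; last by have e := sg0 Mg; inz e.
  apply: VK => //; have e := sgD Kg (dK xI d1D) (dK yI d2D); inz e.
by right; exists x, y; split=> //; inz hv.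
Qed.

Lemma per_congr W z w : per M W -> w \in W -> z - w \in M -> z \in W.
Proof. by move=> pW wW h; rewrite (per_mem Mg pW h). Qed.

(** By complementary pairs the six sums of two labels represent only three classes, those of k + j,
    l + j and k + l; the blocks produce the former two. *)
Lemma Sigma_sub_21 B1 B2 : I `<=` sumset B1 M -> I `<=` sumset B2 M -> k \in B1 -> l \in B1 -> j \in B2 ->
  Y `<=` sumset V (sumset B1 B2) `|` shift (beta + k + l) M.
Proof.
move=> I1 I2 k1 l1 j2; apply/fsubsetP=> z zY; rewrite inE shiftP.
have s4 := klein_labels_sum.
have pW : per M (sumset V (sumset B1 B2)) by apply: per_sumset.
have kj : beta + k + j \in sumset V (sumset B1 B2) by rewrite -addrA !mem_sumset.
have lj : beta + l + j \in sumset V (sumset B1 B2) by rewrite -addrA !mem_sumset.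
have dbl d e : d \in DS -> e \in DS -> d - e + (d - e) \in M by move=> dD eD; apply: klein_double Kg qKM _ _; apply: dK.
case: (Sigma_case I1 I2 kD jD k1 j2 zY) => [->//|[d [e [dD eD de h]]]].
have H w : d + e - w \in M -> z - (beta + w) \in M by move=> h'; have e' := sgD Mg h h'; inz e'.
have [ij ik il [jk jl kl]] := ne.
have {}kj : d + e - (k + j) \in M -> z \in sumset V (sumset B1 B2).
  by move=> /H h'; apply: per_congr pW kj _; inz h'.
have {}lj : d + e - (l + j) \in M -> z \in sumset V (sumset B1 B2).
  by move=> /H h'; apply: per_congr pW lj _; inz h'.
have {H}kl' : d + e - (k + l) \in M -> z - (beta + k + l) \in M by move=> /H h'; inz h'.
have z0 := sg0 Mg; have s4' : i + k - (j + l) \in M.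
  by have e' := sgD Mg s4 (dbl k j kD jD); inz e'.
have s4'' : i + l - (j + k) \in M.
  by have e' := sgD Mg s4 (dbl l j lD jD); inz e'.
move: dD eD de; rewrite eDS !inE => /orP[/orP[/orP[]|]|] /eqP ed /orP[/orP[/orP[]|]|] /eqP ee; subst d e; rewrite ?eqxx // => _.
all: apply/orP.
all: solve [left; apply: kj; ((inz z0) || (inz s4'')) | left; apply: lj; ((inz z0) || (inz s4')) |
  right; apply: kl'; ((inz z0) || (inz s4))].
Qed.

Lemma Sigma_sub_31 B1 B2 : I `<=` sumset B1 M -> I `<=` sumset B2 M -> i \in B1 -> k \in B1 -> l \in B1 -> j \in B2 ->
  Y `<=` sumset V (sumset B1 B2).
Proof.
move=> I1 I2 i1 k1 l1 j2; apply: fsubset_trans (Sigma_sub_21 I1 I2 k1 l1 j2) _.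
rewrite fsubUset fsubset_refl /=; apply/fsubsetP=> z; rewrite shiftP => h.
have ij : beta + i + j \in sumset V (sumset B1 B2) by rewrite -addrA !mem_sumset.
apply: per_congr (per_sumset _) ij _ => //.
by have e := sgB Mg h klein_labels_sum; inz e.
Qed.

Hypothesis YI : forall x, ((x \in I).*2 + (x \in DS) <= count_mem x SJ)%N.
Let B1 := k |` (l |` I).
Let B2 := j |` I.
Let W21 := sumset V (sumset B1 B2).

Let IB1 : I `<=` sumset B1 M.
Proof. by apply: fsubset_trans (sub_cl Mg _); rewrite /B1 fsetUA fsubsetUr. Qed.
Let IB2 : I `<=` sumset B2 M.
Proof. by apply: fsubset_trans (sub_cl Mg _); rewrite fsubsetUr. Qed.
Let kB1 : k \in B1. Proof. by rewrite !inE eqxx. Qed.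
Let lB1 : l \in B1. Proof. by rewrite !inE eqxx orbT. Qed.
Let jB2 : j \in B2. Proof. by rewrite !inE eqxx. Qed.

Let pW21 : per M W21. Proof. exact: per_sumset. Qed.

Lemma pair_case_21 z : z \in W21 -> (forall h, h \in K -> h + z \in W21) \/
  z - (beta + k + j) \in M \/ z - (beta + l + j) \in M.
Proof.
have cI B h b : I `<=` B -> h \in K -> b \in B -> b \in I -> h + b \in B.
  by move=> /fsubsetP s hK _ bI; apply/s/IK.
have IB : I `<=` B1 by rewrite /B1 fsetUA fsubsetUr.
move=> zW; have [|[b [c [bB cB bI cI' h]]]] := pair_case (fun h b => cI B1 h b IB) (fun h b => cI B2 h b (fsubsetUr _ _)) zW; first by left.
right; move: bB cB h; rewrite !inE (negPf bI) (negPf cI') !orbF.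
by case/orP=> /eqP-> /eqP-> h; [left|right].
Qed.

Lemma sub_Sigma_21 : W21 `<=` Y.
Proof.
have -> : W21 = ssum V [:: B1; B2] by rewrite !ssum_cons ssum_nil -sumsetA.
apply: ssum_Sigma => x; apply: leq_trans (YI x); rewrite /= !inE eDS !inE.
have := dI iD; have := dI jD; have := dI kD; have := dI lD.
have [ij ik il [jk jl kl]] := ne.
case: (eqVneq x k) => [->|xk].
  by rewrite (negPf kl) eq_sym (negPf jk) => _ /negPf-> _ _; rewrite ?orbT.
case: (eqVneq x l) => [->|xl].
  by rewrite eq_sym (negPf jl) => /negPf-> _ _ _; rewrite ?orbT.
case: (eqVneq x j) => [->|xj]; first by move=> _ _ /negPf-> _; rewrite ?orbT.
by move=> _ _ _ _; case: (x \in I); case: (x == i).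
Qed.

(** If this point were present, W21 would be all of Y, and it would contain the full orbit under K
    of its exceptional points, making Y periodic. *)
Lemma notin21 : beta + k + l \notin W21.
Proof.
have [ij ik il [jk jl kl]] := ne.
apply/negP=> qW; case: (pair_case_21 qW) => [hq|[h|h]].
- have YW : Y = W21.
    apply/eqP; rewrite eqEfsubset sub_Sigma_21 andbT; apply: fsubset_trans (Sigma_sub_21 IB1 IB2 kB1 lB1 jB2) _.
    rewrite fsubUset fsubset_refl /=; apply/fsubsetP=> z; rewrite shiftP => h.
    by have e := hq _ (M_K h); inz e.
  apply: nY; rewrite YW => h z hK /pair_case_21[hz|hz]; first exact: hz.
  suff e : z - (beta + k + l) \in K by have e' := hq _ (sgD Kg hK e); inz e'.
  case: hz => /M_K hz.
    by have e := sgD Kg hz (dK jD lD); inz e.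
  by have e := sgD Kg hz (dK jD kD); inz e.
- by case/negP: (dneM jD lD jl); rewrite sgBC //; inz h.
- by case/negP: (dneM jD kD jk); rewrite sgBC //; inz h.
Qed.

Let W210 : W21 != fset0.
Proof. by apply/fset0Pn; exists (beta + (k + j)); rewrite !mem_sumset. Qed.

(** Translation by k - l interchanges the cosets of beta + k + j and beta + l + j. A stabilizing g
    moving beta + k + j into the K-periodic part would bring the missing point beta + k + l into
    W21. *)
Lemma stab21 g : (g \in Stab W21) = (g \in M) || (g - (k - l) \in M).
Proof.
have s0 := sg0 Mg; have dbl := klein_double Kg qKM (dK kD lD).
have kj : beta + k + j \in W21 by rewrite -addrA !mem_sumset.
have lj : beta + l + j \in W21 by rewrite -addrA !mem_sumset.
have M_s h : h \in M -> stab W21 h by move=> hM; apply/stabP=> z; apply: pW21.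
have kl_s : stab W21 (k - l).
  apply/stabP=> z /pair_case_21[h|[h|h]]; first exact: h (dK kD lD).
    by apply: (per_congr pW21 lj); have e := sgD Mg h dbl; inz e.
  by apply: (per_congr pW21 kj); inz h.
rewrite in_Stab //; apply/idP/orP => [hg|[/M_s//|h]]; last first.
  by have := stabD (M_s _ h) kl_s; rewrite (_ : _ + _ = g) //; zmod.
have /stabP/(_ _ kj)/pair_case_21 := hg; case=> [h|[h|h]].
- have qg := h _ (dK lD jD); case/negP: notin21.
  by have /stabP/(_ _ qg) e := stabN hg; inz e.
- by left; inz h.
- by right; have e := sgB Mg h dbl; inz e.
Qed.

Let s := Stab W21.
Let sg : is_subgroup s. Proof. exact: Stab_subgroup. Qed.
Let Ms : M `<=` s. Proof. by apply/fsubsetP=> g gM; rewrite stab21 gM. Qed.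
Let kls : k - l \in s. Proof. by rewrite stab21 subrr sg0 ?orbT. Qed.
Let per_sM A : per s A -> per M A. Proof. by move=> h u v /(fsubsetP Ms); apply: h. Qed.

Lemma card_stab21 : (#|` s| <= 2 * #|` M|)%N.
Proof.
have -> : s = M `|` shift (k - l) M.
  by apply/fsetP=> g; rewrite stab21 inE shiftP.
by rewrite cardfsU card_shift mul2n -addnn leq_subr.
Qed.

Let cl2 A d e : d \in DS -> e \in DS -> d != e -> I `<=` sumset A s -> d \in sumset A s -> e \in sumset A s ->
  (#|` I| + 2 * #|` M| <= #|` sumset A s|)%N.
Proof.
move=> dD eD de h1 h2 h3; apply: (per_add2 Mg _ _ h1 h2 _ h3) => //; rewrite ?dI ?dneM //.
  by move=> u v /M_K; apply: IK.
exact/per_sM/per_cl.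
Qed.

Let cB1 : (#|` I| + 2 * #|` M| <= #|` sumset B1 s|)%N.
Proof.
have h := fsubsetP (sub_cl sg B1); have [ij ik il [jk jl kl]] := ne.
apply: (cl2 kD lD kl); rewrite ?h //; apply: fsubset_trans (sub_cl sg _); by rewrite /B1 fsetUA fsubsetUr.
Qed.

Let ijs e : e \in [:: i; j] -> forall A, e \in sumset A s -> i \in sumset A s /\ j \in sumset A s.
Proof.
have h : i - j \in s.
  rewrite stab21; apply/orP; right; have e' := sgB Mg klein_labels_sum (klein_double Kg qKM (dK jD lD)); inz e'.
move=> eij A; have pA := @per_cl _ _ sg A; rewrite !inE in eij; case/orP: eij => /eqP-> hA; split=> //.
  by rewrite -(per_mem sg pA h).
by rewrite (per_mem sg pA h).
Qed.

Let cB e B : e \in [:: i; j] -> e \in B -> I `<=` B -> (#|` I| + 2 * #|` M| <= #|` sumset B s|)%N.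
Proof.
move=> eij eB IB; have h := sub_cl sg B; have [ij _ _ _] := ne.
have [h1 h2] := ijs eij (fsubsetP h e eB).
by apply: (cl2 iD jD ij) => //; apply: fsubset_trans h.
Qed.

Variables (X A : {fset G}) (x a : G).
Hypotheses (eV : V = sumset X A) (pX : per M X) (pA : per M A) (xX : x \in X) (aA : a \in A).
Hypothesis hX : forall y, y \in X -> y - x \in K -> y - x \in M.
Hypothesis hA : forall y, y \in A -> y - a \in K -> y - a \in M.
Hypothesis cY : (#|` Y| = #|` X| + #|` A| + 2 * #|` I| + #|` M|)%N.

Let kl_ : k - l \notin M. Proof. by apply: dneM => //; have [_ _ _ [_ _]] := ne. Qed.

Let cW21 : (#|` X| + #|` A| + 2 * #|` I| <= #|` W21|)%N.
Proof.
have := fsubset_leq_card (Sigma_sub_21 IB1 IB2 kB1 lB1 jB2); rewrite cardfsU card_shift cY -/W21 => h.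
by have := leq_trans h (leq_subr _ _); nlia.
Qed.

Let cXs : (#|` X| + #|` M| <= #|` sumset X s|)%N.
Proof.
apply: (per_add1 Mg pX (p := k - l + x)); rewrite ?sub_cl //; first exact/per_sM/per_cl.
  by apply: per_cl kls _ => //; apply: (fsubsetP (sub_cl sg X)).
have e : k - l + x - x = k - l by zmod.
by apply/negP=> /hX; rewrite e dK // => /(_ isT); apply/negP.
Qed.

Let klaA : k - l + a \notin A.
Proof.
have e : k - l + a - a = k - l by zmod.
by apply/negP=> /hA; rewrite e dK // => /(_ isT); apply/negP.
Qed.

(** Otherwise the sum is still W21, whose stabilizer has at most 2|M| elements, so Kneser's theorem
    for the three blocks loses at most 6|M|. But closing up adds |M| to X, and the closures of the
    blocks exceed A, I and I by 2|M| each, 7|M| in all. *)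
Lemma card_enlarge_first : i \notin A -> j - a \notin M ->
  (#|` X| + #|` A| + 2 * #|` I| < #|` ssum X [:: i |` A; B1; B2]|)%N.
Proof.
move=> iA jaM; rewrite ltnNge; apply/negP=> hW.
have WW : W21 `<=` ssum X [:: i |` A; B1; B2].
  rewrite !ssum_cons ssum_nil -(sumsetA _ B1) /W21 eV; apply: sumsetSS => //; apply: sumsetSS => //.
  exact: fsubsetUr.
have eW : ssum X [:: i |` A; B1; B2] = W21.
  by apply/esym/eqP; rewrite eqEfcard WW (leq_trans hW cW21).
have X0 : X != fset0 by apply/fset0Pn; exists x.
have ne3 : nonempty [:: i |` A; B1; B2].
  move=> C; rewrite !inE => /or3P[] /eqP->; apply/fset0Pn; [exists i|exists k|exists j]; by rewrite !inE eqxx.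
have := kneser_list X0 ne3; rewrite eW -/s !big_cons big_nil addn0 /= => kn.
have c4 : (#|` A| + 2 * #|` M| <= #|` sumset (i |` A) s|)%N.
  have h := sub_cl sg (i |` A); have pC : per M (sumset (i |` A) s) by exact/per_sM/per_cl.
  apply: (per_add2 Mg pA pC (p := k - l + a) (q := i)) => //.
  - by apply: fsubset_trans h; apply: fsubsetUr.
  - by apply: per_cl kls _ => //; apply: (fsubsetP h); rewrite !inE aA orbT.
  - by apply: (fsubsetP h); rewrite !inE eqxx.
  - apply: contra jaM => h'.
    by have e := sgD Mg (sgB Mg klein_labels_sum h') (klein_double Kg qKM (dK kD iD)); inz e.
have c5 : (#|` I| + 2 * #|` M| <= #|` sumset B2 s|)%N.
  by apply: (cB (e := j)); rewrite ?inE ?eqxx ?orbT // fsubsetUr.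
have m0 := sg_gt0 Mg; have c6 := card_stab21; rewrite eW in hW.
by move: kn hW cXs cB1 c4 c5 c6 m0; rewrite -/s; nlia.
Qed.

(** The same count: if some z of A outside a + M left A under k - l, the closure of A would exceed
    it by two cosets, and again 7|M| stands against 6|M|. *)
Lemma stab_enlarge_second : (#|` ssum X [:: A; B1; i |` B2]| <= #|` X| + #|` A| + 2 * #|` I|)%N ->
  forall z, z \in A -> z - a \notin M -> k - l + z \in A.
Proof.
move=> hW z zA za; apply: contraT => zn.
have WW : W21 `<=` ssum X [:: A; B1; i |` B2].
  rewrite !ssum_cons ssum_nil -(sumsetA _ B1) /W21 eV; do !apply: sumsetSS => //.
  exact: fsubsetUr.
have eW : ssum X [:: A; B1; i |` B2] = W21.
  by apply/esym/eqP; rewrite eqEfcard WW (leq_trans hW cW21).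
have X0 : X != fset0 by apply/fset0Pn; exists x.
have ne3 : nonempty [:: A; B1; i |` B2].
  move=> C; rewrite !inE => /or3P[] /eqP->; apply/fset0Pn; [exists a|exists k|exists i]; by rewrite ?inE ?eqxx.
have := kneser_list X0 ne3; rewrite eW -/s !big_cons big_nil addn0 /= => kn.
have h := sub_cl sg A; have hm := fsubsetP h.
have c4 : (#|` A| + 2 * #|` M| <= #|` sumset A s|)%N.
  apply: (per_add2 Mg pA _ (p := k - l + z) (q := k - l + a)) => //.
  - exact/per_sM/per_cl.
  - by apply: per_cl kls _ => //; apply: hm.
  - by apply: per_cl kls _ => //; apply: hm.
  - by apply: contra za => h'; inz h'.
have c5 : (#|` I| + 2 * #|` M| <= #|` sumset (i |` B2) s|)%N.
  apply: (cB (e := j)); rewrite ?inE ?eqxx ?orbT //.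
  by rewrite /B2 fsetUA fsubsetUr.
have m0 := sg_gt0 Mg; have c6 := card_stab21; rewrite eW in hW.
by move: kn hW cXs cB1 c4 c5 c6 m0; rewrite -/s; nlia.
Qed.
End Quad.

(** * Three blocks two of which form a Klein configuration *)

Section Special.
Variable G : zmodType.
Implicit Types (A B C D X Y W L V M K DS I : {fset G}) (x y z a b c g h w p q u v d e : G).

Lemma four_pick DS e c : #|` DS| = 4%N -> e \in DS -> c \in DS -> e != c ->
  exists p q, [/\ DS = [fset e; c; p; q], uniq [:: e; c; p; q], DS = [fset p; q; e; c] & uniq [:: p; q; e; c]].
Proof.
move=> c4 eD cD ec.
have ce : c \in DS `\ e by rewrite !inE cD eq_sym ec.
have : (1 < #|` (DS `\ e) `\ c|)%N.
  by move: c4; rewrite (cardfsD1 e) eD (cardfsD1 c) ce; nlia.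
move=> /two_of[p [q [pD qD pq]]]; exists p, q.
have u1 : uniq [:: e; c; p; q].
  rewrite /= !inE; move: pD qD; rewrite !inE => /and3P[pc pe _] /and3P[qc qe _].
  by rewrite (negPf ec) (eq_sym e) (negPf pe) (eq_sym e q) (negPf qe) (eq_sym c) (negPf pc) (eq_sym c q) (negPf qc) (negPf pq).
have u2 : uniq [:: p; q; e; c] by rewrite (perm_uniq (permEl (perm_catC [:: p; q] [:: e; c]))).
have e1 : DS = [fset x in [:: e; c; p; q]].
  apply/esym/eqP; rewrite eqEfcard card_fseq undup_id // c4 leqnn andbT.
  apply/fsubsetP=> x; move: pD qD; rewrite !inE => /and3P[_ _ pD] /and3P[_ _ qD].
  by case/or4P=> [/eqP->|/eqP->|/eqP->|] //; rewrite orbF => /eqP->.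
split=> //; rewrite e1; apply/fsetP=> x; rewrite !inE ?orbA //;
  by case: (x == e); case: (x == c); case: (x == p); case: (x == q).
Qed.

Lemma periodic_per K A : periodic K A -> per K A.
Proof. by move=> h k a kK aA; rewrite -(h k kK) mem_shift. Qed.

Lemma per_cl_eq K A : is_subgroup K -> (#|` sumset A K| <= #|` A|)%N -> per K A.
Proof.
move=> Kg h; have e : A = sumset A K by apply/eqP; rewrite eqEfcard sub_cl.
rewrite e; exact: per_cl.
Qed.

Lemma card_per K A : is_subgroup K -> per K A -> exists q : nat, (#|` A| = q * #|` K|)%N.
Proof.
move=> Kg pA; have [T [_ sT eT]] := ex_transversal A Kg.
by exists #|` T|; rewrite -(card_sep Kg sT) eT per_cl_id.
Qed.

Lemma subgroup_nonzero K : is_subgroup K -> (1 < #|` K|)%N -> exists2 u, u \in K & u != 0.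
Proof.
move=> Kg; rewrite (cardfsD1 0) sg0 // ltnS cardfs_gt0 => /fset0Pn[u]; rewrite !inE => /andP[u0 uK].
by exists u.
Qed.

Lemma ssum3 X A B C : ssum X [:: A; B; C] = sumset (sumset X A) (sumset B C).
Proof. by rewrite !ssum_cons ssum_nil sumsetA. Qed.

Lemma sum_squares3 A B C : sum_squares [:: A; B; C] = (#|` A| ^ 2 + #|` B| ^ 2 + #|` C| ^ 2)%N.
Proof. by rewrite /sum_squares !big_cons big_nil addn0 addnA. Qed.

Variables (X A B C A1 A2 K : {fset G}) (beta : G) (N : nat).
Hypotheses (X0 : X != fset0) (A0 : A != fset0).
Let V := sumset X A.
Let M := Stab V.
Hypothesis BC : (#|` C| + 2 <= #|` B|)%N.
Hypothesis drop : forall As, size As = 3%N -> nonempty As -> (forall x, cnt x As = cnt x [:: A; B; C]) ->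
  (#|` X| + tot [:: A; B; C] <= #|` ssum X As| + 3)%N -> (sum_squares [:: A; B; C] <= sum_squares As)%N.
Hypotheses (A10 : A1 != fset0) (A20 : A2 != fset0) (sA1 : sep M A1) (sA2 : sep M A2).
Hypothesis tN : tot [:: A1; A2] = N.
Hypothesis cA : forall x, (cnt x [:: A1; A2] <= cnt x [:: B; C])%N.
Hypothesis kl : klein V M (Sseq [:: B; C]) A1 A2 beta K N.

Let V0 : V != fset0. Proof. exact: sumset_neq0. Qed.
Let Mg : is_subgroup M. Proof. exact: Stab_subgroup. Qed.
Let Kg : is_subgroup K. Proof. by case: kl => -[]. Qed.
Let MK : M `<=` K. Proof. by case: kl => -[]. Qed.
Let qKM : quot_is_Z2xZ2 K M. Proof. by case: kl => -[]. Qed.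
Let Vb : beta \in V. Proof. by case: kl => -[]. Qed.
Let VM : per M V. Proof. by rewrite per_stab. Qed.
Let I := sumset A1 M `&` sumset A2 M.
Let IK : per K I. Proof. by case: kl => _ [_ /periodic_per]. Qed.
Let MKs := fsubsetP MK.
Let IM : per M I. Proof. by move=> k a /MKs; apply: IK. Qed.
Let VK' h v : h \in K -> v \in V -> v - beta \notin M -> h + v \in V /\ h + v - beta \notin M.
Proof.
move=> hK vV vb; have [_ [/periodic_per pV _] _ _] := kl.
have : v \in V `\` shift beta M by rewrite inE shiftP vb.
by move=> /(pV h v hK); rewrite inE shiftP => /andP[].
Qed.
Let VK h v : h \in K -> v \in V -> v - beta \notin M -> h + v \in V.
Proof. by move=> h1 h2 h3; case: (VK' h1 h2 h3). Qed.
Let DS := (A1 `|` A2) `\` I.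
Let free x : (cnt x [:: A1; A2] < cnt x [:: B; C])%N -> x \in I.
Proof. by move=> h; case: kl => _ _ f _; apply: f; rewrite count_Sseq. Qed.
Let sub1 := fsubsetP (sub_cl Mg A1).
Let sub2 := fsubsetP (sub_cl Mg A2).

Let dI d : d \in DS -> d \notin I. Proof. by rewrite /DS inE => /andP[]. Qed.
Let DSM : sumset DS M = (sumset A1 M `|` sumset A2 M) `\` I.
Proof.
apply/fsetP=> z; apply/in_cl/idP => [[d dD h]|].
  rewrite inE; have dI' := dI dD; rewrite (per_mem Mg IM h) dI' /=.
  move: dD; rewrite /DS !inE => /andP[_ /orP[/sub1|/sub2]] h'; apply/orP; [left|right];
  by rewrite (per_mem Mg _ h) //; apply: per_cl.
rewrite inE => /andP[zI]; rewrite inE => /orP[] /in_cl[d dA h]; exists d => //;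
by rewrite /DS inE -(per_mem Mg IM h) zI inE dA ?orbT.
Qed.
Let gK : exists g, sumset DS M = shift g K.
Proof. by case: kl => _ _ _ [[g e] _]; exists g; rewrite DSM. Qed.
Let dK d e : d \in DS -> e \in DS -> d - e \in K.
Proof.
have [g eg] := gK; have h := fsubsetP (sub_cl Mg DS); rewrite eg in h.
by move=> /h; rewrite shiftP => h1 /h; rewrite shiftP => h2; have e' := sgB Kg h1 h2; inz e'.
Qed.
Let dM d e : d \in DS -> e \in DS -> d - e \in M -> d = e.
Proof.
move=> dD eD h; have dI' := dI dD.
have bad u v : u \in A1 -> v \in A2 -> u - v \in M -> u \in I.
  by move=> uA vA huv; rewrite inE sub1 // (per_mem Mg _ huv) ?sub2 //; apply: per_cl.
have eI' := dI eD.
move: dD eD; rewrite /DS !inE => /andP[_ /orP[dA|dA]] /andP[_ /orP[eA|eA]].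
- exact: sA1.
- by rewrite (bad d e) in dI'.
- by rewrite sgBC // in h; rewrite (bad e d) in eI'.
- exact: sA2.
Qed.
Let c4 : #|` DS| = 4%N.
Proof.
have [g eg] := gK; have := card_sep Mg dM; rewrite eg card_shift (card_klein Mg Kg MK qKM) => /eqP.
by rewrite eqn_pmul2r ?sg_gt0 // => /eqP.
Qed.
Let SJ := Sseq [:: B; C].
Let sBC x : x \in SJ = (0 < cnt x [:: B; C])%N.
Proof. by rewrite -has_pred1 has_count count_Sseq. Qed.
Let cDS d : d \in DS -> cnt d [:: B; C] = 1%N.
Proof.
move=> dD; have dI' := dI dD.
have -> : cnt d [:: B; C] = cnt d [:: A1; A2].
  by apply/eqP; rewrite eqn_leq cA andbT leqNgt; apply: contra dI' => /free.
have nb : ~~ ((d \in A1) && (d \in A2)).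
  by apply: contra dI' => /andP[h1 h2]; rewrite inE sub1 // sub2.
move: dD; rewrite /DS !inE /= => /andP[_].
by case: (d \in A1) nb; case: (d \in A2).
Qed.
Let cN x : x \notin I -> x \notin DS -> cnt x [:: B; C] = 0%N.
Proof.
move=> xI xD; apply/eqP; rewrite -leqn0.
have : ~~ (cnt x [:: A1; A2] < cnt x [:: B; C])%N by apply: contra xI => /free.
rewrite -leqNgt => h; apply: leq_trans h _; rewrite /=.
by move: xD; rewrite /DS inE xI /= inE negb_or => /andP[/negPf-> /negPf->].
Qed.
Let sSJ x : x \in SJ -> x \in I \/ x \in DS.
Proof.
rewrite sBC; case: (boolP (x \in I)) => xI; first by left.
by case: (boolP (x \in DS)) => xD; [right|rewrite cN].
Qed.
Let cSJ d : d \in DS -> (count_mem d SJ <= 1)%N.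
Proof. by move=> dD; rewrite count_Sseq cDS. Qed.
Let Y := sumset V (Sigma_n 2 SJ).
Let nY : ~ per K Y.
Proof.
move=> pY; have [_ _ _ [_ [sY _]]] := kl.
have : K `<=` M.
  by apply/fsubsetP=> k kK; rewrite -sY; apply/stabP=> a; apply: pY.
by move/fsubset_leq_card; rewrite (card_klein Mg Kg MK qKM); have := sg_gt0 Mg; nlia.
Qed.
Let cY1 : (#|` Y| = #|` V| + 2 * #|` I| + 2 * #|` M|)%N.
Proof.
have [_ _ _ [_ [_ e]]] := kl; rewrite -/SJ -/Y in e.
have h1 := card_sep Mg sA1; have h2 := card_sep Mg sA2.
have := cardfsUI (sumset A1 M) (sumset A2 M); rewrite -/I.
have IU : I `<=` sumset A1 M `|` sumset A2 M by rewrite (fsubset_trans (fsubsetIl _ _)) // fsubsetUl.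
have := cardfsDS IU; have := fsubset_leq_card IU; rewrite -DSM card_sep // c4 h1 h2.
rewrite e -tN /tot !big_cons big_nil addn0 mulnBl mulnDl.
have : (2 * #|` M| <= #|` A1| * #|` M| + #|` A2| * #|` M|)%N.
  by rewrite mul2n -addnn leq_add // leq_pmull // cardfs_gt0.
nlia.
Qed.
Let cBC : (#|` B `\` I| + #|` C `\` I| = 4)%N.
Proof.
have e : (B `\` I) `|` (C `\` I) = DS.
  apply/fsetP=> z; case: (boolP (z \in DS)) => zD; rewrite in_fsetU !in_fsetD.
    by rewrite (dI zD) /=; have := cDS zD; rewrite /=; case: (z \in B); case: (z \in C).
  case: (boolP (z \in I)) => zI //=.
  by have := cN zI zD; rewrite /=; case: (z \in B); case: (z \in C).
have : (B `\` I) `&` (C `\` I) = fset0.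
  apply/fsetP=> z; rewrite [RHS]in_fset0; apply/negbTE/negP; rewrite in_fsetI !in_fsetD => /andP[/andP[zI zB] /andP[_ zC]].
  have : z \in DS by rewrite -e in_fsetU in_fsetD zI zB.
  by move=> /cDS; rewrite /= zB zC.
by move=> e2; rewrite -cardfsUI e e2 cardfs0 c4.
Qed.

Let repI E0 : E0 = A1 \/ E0 = A2 -> sumset (E0 `&` I) M = I /\ sep M (E0 `&` I).
Proof.
move=> e; split; last first.
  by case: e => ->; move=> x y; rewrite !in_fsetI => /andP[xA _] /andP[yA _]; [apply: sA1|apply: sA2].
apply/fsetP=> z; apply/in_cl/idP => [[y]|zI].
  by rewrite in_fsetI => /andP[_ yI] h; rewrite (per_mem Mg IM h).
have : z \in sumset E0 M by move: zI; rewrite in_fsetI => /andP[h1 h2]; case: e => ->.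
by move=> /in_cl[y yA h]; exists y => //; rewrite in_fsetI yA -(per_mem Mg IM h).
Qed.

(** The four labels are split two and two, giving equal blocks that refill to an equitable pair. As
    this would lower the squares, the resulting sum must be small; by [Sigma_sub_21] it still misses
    at most one coset of Y. *)
Let stepone : exists W1, (#|` W1| + 3 < #|` X| + tot [:: A; B; C])%N /\ (#|` Y| <= #|` W1| + #|` M|)%N.
Proof.
have [e [c [eD cD ec]]] : exists x y, [/\ x \in DS, y \in DS & x != y] by apply: two_of; rewrite c4.
have [k [l [_ _ eDS uDS]]] := four_pick c4 eD cD ec.
move: k l e c eDS uDS {eD cD ec} => i j k l eDS uDS.
have mDS x : x \in DS = [|| x == i, x == j, x == k | x == l] by rewrite eDS !inE -!orbA.
have [iD jD kD lD] : [/\ i \in DS, j \in DS, k \in DS & l \in DS] by rewrite !mDS !eqxx !orbT.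
have [ij kl' dis] : [/\ i != j, k != l & forall x, (x == i) || (x == j) -> (x == k) || (x == l) -> False].
  move: uDS; rewrite /= !inE !negb_or => /and4P[/and3P[ij ik il] /andP[jk jl] kl' _]; split=> //.
  by move=> x /orP[] /eqP-> /orP[] h; move: ik il jk jl; rewrite h.
pose F E0 d e := (E0 `&` I) `|` [fset d; e].
pose As := [:: F A1 k l; F A2 i j].
have mF E0 d e x : x \in F E0 d e = (x \in E0 `&` I) || ((x == d) || (x == e)).
  by rewrite in_fsetU in_fset2.
have FM E0 d e : E0 = A1 \/ E0 = A2 -> sumset (F E0 d e) M = I `|` sumset [fset d; e] M.
  by move=> h; rewrite [LHS](cl_U (E0 `&` I)) (repI h).1.
have IF E0 d e : E0 = A1 \/ E0 = A2 -> I `<=` sumset (F E0 d e) M by move=> h; rewrite FM // fsubsetUl.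
have sF E0 d e : E0 = A1 \/ E0 = A2 -> d \in DS -> e \in DS -> sep M (F E0 d e).
  move=> hE dD eD x y; rewrite !mF => /orP[xA|xd] /orP[yA|yd] h.
  - exact: (repI hE).2.
  - have yD : y \in DS by case/orP: yd => /eqP->.
    by case/negP: (dI yD); rewrite -(per_mem Mg IM h); move: xA; rewrite in_fsetI => /andP[].
  - have xD : x \in DS by case/orP: xd => /eqP->.
    by case/negP: (dI xD); rewrite (per_mem Mg IM h); move: yA; rewrite in_fsetI => /andP[].
  - by apply: dM => //; [case/orP: xd => /eqP->|case/orP: yd => /eqP->].
have cF E0 d e : E0 = A1 \/ E0 = A2 -> d \in DS -> e \in DS -> d != e -> (#|` F E0 d e| * #|` M| = #|` I| + 2 * #|` M|)%N.
  move=> hE dD eD de; rewrite -(card_sep Mg (sF _ _ _ hE dD eD)) FM // cardfsU disjoint_fsetI0 ?cardfs0 ?subn0.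
    rewrite card_sep ?cardfs2 ?de //.
    by move=> x y; rewrite !in_fset2 => xd yd; apply: dM; [case/orP: xd => /eqP->|case/orP: yd => /eqP->].
  apply/fdisjointP=> x xI; apply/negP=> /in_cl[y yd h].
  have yD : y \in DS by move: yd; rewrite in_fset2 => /orP[] /eqP->.
  by case/negP: (dI yD); rewrite -(per_mem Mg IM h).
have o1 : A1 = A1 \/ A1 = A2 by left.
have o2 : A2 = A1 \/ A2 = A2 by right.
have eqc : #|` F A1 k l| = #|` F A2 i j|.
  by apply/eqP; rewrite -(eqn_pmul2r (sg_gt0 Mg)) !cF.
have inF E0 d e x : x \in F E0 d e = (x \in E0) && (x \in I) || ((x == d) || (x == e)).
  by rewrite mF in_fsetI.
have cAs1 x : x \in DS -> cnt x As = 1%N.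
  move=> xD; rewrite /= !inF (negPf (dI xD)) !andbF /=.
  have := dis x; move: xD; rewrite mDS.
  by case: (x == i); case: (x == j); case: (x == k); case: (x == l) => //= _ /(_ isT isT).
have cAs x : (cnt x As <= cnt x [:: B; C])%N.
  case: (boolP (x \in DS)) => xD; first by rewrite cAs1 // cDS.
  apply: leq_trans (cA x); rewrite /= !inF.
  move: xD; rewrite mDS !negb_or => /and4P[/negPf-> /negPf-> /negPf-> /negPf->]; rewrite !orbF.
  by apply: leq_add; last apply: leq_add => //; case: (x \in I); rewrite ?andbT ?andbF.
have satAs x : (cnt x As < cnt x [:: B; C])%N -> forall E0, E0 \in As -> x \in sumset E0 M.
  move=> lt; have xI : x \in I.
    apply: contraT => xI; case: (boolP (x \in DS)) => xD; first by rewrite cAs1 ?cDS in lt.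
    by rewrite (cN xI xD) in lt.
  by move=> E0; rewrite !inE => /orP[] /eqP->; apply: (fsubsetP (IF _ _ _ _)).
have neAs : nonempty As.
  by move=> E0; rewrite !inE => /orP[] /eqP->; apply/fset0Pn; [exists k|exists i]; rewrite inF eqxx !orbT.
have sAs E0 : E0 \in As -> sep M E0.
  by rewrite !inE => /orP[] /eqP->; apply: sF.
have eAs : equitable As.
  by move=> U1 U2; rewrite !inE => /orP[] /eqP-> /orP[] /eqP->; rewrite ?eqc.
have [P [oP cP eP neP [szP eW]]] := @refill _ V As [:: B; C] V0 (erefl _) neAs cAs sAs eAs satAs.
exists (ssum V As); split; last first.
  have := Sigma_sub_21 Mg Kg qKM Vb VM VK IK dK dM sSJ cSJ eDS uDS (IF A1 k l o1) (IF A2 i j o2).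
  rewrite !inF !eqxx !orbT => /(_ isT isT isT)/fsubset_leq_card.
  by rewrite cardfsU card_shift !ssum_cons ssum_nil -sumsetA => h; apply: leq_trans h (leq_subr _ _).
rewrite ltnNge; apply/negP=> big.
have ne3 : nonempty (A :: unzip2 P) by apply/nonempty_cons.
have c3 x : ((x \in A) + cnt x (unzip2 P) = cnt x [:: A; B; C])%N by rewrite cP.
have s3 : size (A :: unzip2 P) = 3%N by rewrite /= szP.
have b3 : (#|` X| + tot [:: A; B; C] <= #|` ssum X (A :: unzip2 P)| + 3)%N by rewrite ssum_cons eW.
have := drop s3 ne3 c3 b3; rewrite leqNgt => /negP; apply.
apply: (equitable_lt A (perm_refl _) BC) => //.
rewrite (tot_count (S := SJ)) ?size_Sseq // => x; by rewrite count_Sseq.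
Qed.

(** The bounds of [stepone], Kneser's theorem for X + A and the sizes of B and C inside and outside
    I close up to a cycle of inequalities, so each is an equality. *)
Let facts : [/\ per M X, per M A, I `<=` B, I `<=` C & (#|` V| + #|` M| = #|` X| + #|` A|)%N].
Proof.
have [W1 [h1 h2]] := stepone.
have k1 := kneser X0 A0; rewrite -/V -/M in k1.
have k2 := card_cl_ge Mg X; have k3 := card_cl_ge Mg A.
have k4 := fsubset_leq_card (fsubsetIr B I); have k5 := fsubset_leq_card (fsubsetIr C I).
have k6 := cardfsDI B I; have k7 := cardfsDI C I; have k8 := cBC; have k9 := cY1.
rewrite !tot_cons /tot big_nil in h1.
have [e1 e2 e3 [e4 e5]] : [/\ #|` sumset X M| <= #|` X|, #|` sumset A M| <= #|` A|, #|` I| <= #|` B `&` I| &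
   #|` I| <= #|` C `&` I| /\ #|` V| + #|` M| = #|` X| + #|` A| ]%N.
  by move: h1 h2 k1 k2 k3 k4 k5 k6 k7 k8 k9; rewrite -/M; clear; split; last split; nlia.
split=> //; try exact: per_cl_eq.
- have -> : I = B `&` I by apply/esym/eqP; rewrite eqEfcard fsubsetIr.
  exact: fsubsetIl.
- have -> : I = C `&` I by apply/esym/eqP; rewrite eqEfcard fsubsetIr.
  exact: fsubsetIl.
Qed.
Let pX : per M X. Proof. by case: facts. Qed.
Let pA : per M A. Proof. by case: facts. Qed.
Let IB := fsubsetP (let: And5 _ _ h _ _ := facts in h).
Let IC := fsubsetP (let: And5 _ _ _ h _ := facts in h).
Let cY : (#|` Y| = #|` X| + #|` A| + 2 * #|` I| + #|` M|)%N.
Proof. by case: facts => _ _ _ _; rewrite cY1; nlia. Qed.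
Let m0 := sg_gt0 Mg.
Let cB : #|` B| = (#|` I| + #|` B `\` I|)%N.
Proof.
by have := cardfsDI B I; rewrite (fsetIidPr _) //; case: facts.
Qed.
Let cC : #|` C| = (#|` I| + #|` C `\` I|)%N.
Proof.
by have := cardfsDI C I; rewrite (fsetIidPr _) //; case: facts.
Qed.
Let BDS x : x \in B -> x \notin I -> x \in DS.
Proof. by move=> xB xI; apply: contraT => xD; have := cN xI xD; rewrite /= xB. Qed.
Let CDS x : x \in C -> x \notin I -> x \in DS.
Proof. by move=> xB xI; apply: contraT => xD; have := cN xI xD; rewrite /= xB; case: (x \in B). Qed.

Let dropS As : size As = 3%N -> nonempty As -> (forall x, cnt x As = cnt x [:: A; B; C]) ->
  (#|` X| + #|` A| + 2 * #|` I| < #|` ssum X As|)%N -> (sum_squares As < sum_squares [:: A; B; C])%N -> False.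
Proof.
move=> h1 h2 h3 h4; rewrite ltnNge => /negP; apply; apply: drop => //.
rewrite !tot_cons /tot big_nil cB cC; move: cBC h4; clear; nlia.
Qed.

Let YI x : ((x \in I).*2 + (x \in DS) <= count_mem x SJ)%N.
Proof.
rewrite count_Sseq; case: (boolP (x \in DS)) => xD; first by rewrite (negPf (dI xD)) cDS.
by case: (boolP (x \in I)) => //= xI; rewrite IB // IC.
Qed.

Let I_M D : I `<=` D -> I `<=` sumset D M.
Proof. by move=> h; apply: fsubset_trans h (sub_cl Mg D). Qed.

Let kM : (1 < #|` K|)%N.
Proof. by rewrite (card_klein Mg Kg MK qKM); move: m0; nlia. Qed.

(** The four labels are split 3 + 1 or 4 + 0 because |B| >= |C| + 2. In the latter case one label
    can move to C, and the new sum still contains Y. *)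
Let shape : exists i j k l, [/\ DS = [fset i; j; k; l], uniq [:: i; j; k; l], B = i |` (k |` (l |` I)) & C = j |` I].
Proof.
have hB : B `\` I `<=` DS.
  by apply/fsubsetP=> z; rewrite in_fsetD => /andP[zI zB]; apply: BDS.
have hC : C `\` I `<=` DS.
  by apply/fsubsetP=> z; rewrite in_fsetD => /andP[zI zB]; apply: CDS.
have [e3 | e4] : (#|` B `\` I| = 3 /\ #|` C `\` I| = 1 \/ #|` B `\` I| = 4 /\ #|` C `\` I| = 0)%N.
- by move: BC cBC; rewrite cB cC; clear; nlia.
- have : (0 < #|` C `\` I|)%N by rewrite e3.2.
  rewrite cardfs_gt0 => /fset0Pn[j]; rewrite in_fsetD => /andP[jI jC].
  have eC : C `\` I = [fset j].
    apply/esym/eqP; rewrite eqEfcard cardfs1 e3.2 leqnn andbT fsub1set in_fsetD jI.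
    exact: jC.
  have jD := CDS jC jI.
  have : (0 < #|` B `\` I|)%N by rewrite e3.1.
  rewrite cardfs_gt0 => /fset0Pn[i]; rewrite in_fsetD => /andP[iI iB].
  have iD := BDS iB iI.
  have ij : i != j by apply/eqP=> e; have := cDS iD; rewrite /= iB e jC.
  have [k [l [eD uD _ _]]] := four_pick c4 iD jD ij.
  exists i, j, k, l; split=> //.
    have eB : B `\` I = [fset i; k; l].
      apply/eqP; rewrite eqEfcard e3.1; apply/andP; split; last first.
        rewrite -!fsetUA !cardfsU1 cardfs1 !inE; move: uD; rewrite /= !inE !negb_or => /and4P[/and3P[_ -> ->] _ -> _].
        by [].
      apply/fsubsetP=> z zB; have : z \in DS := fsubsetP hB z zB.
      have zj : z != j.
        by apply: contraTneq zB => ->; rewrite in_fsetD; apply/negP=> /andP[_ jB]; have := cDS jD; rewrite /= jB jC.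
      by rewrite eD !inE (negPf zj) orbF.
    apply/fsetP=> z; have /fsetP/(_ z) := eB; rewrite in_fsetD !in_fsetU !in_fset1.
    case: (boolP (z \in I)) => zI /=; first by rewrite IB // !orbT.
    by move=> ->; rewrite orbF -orbA.
  apply/fsetP=> z; have /fsetP/(_ z) := eC; rewrite in_fsetD !in_fsetU !in_fset1.
  case: (boolP (z \in I)) => zI /=; first by rewrite IC // !orbT.
  by move=> ->; rewrite orbF.
- have eC : C = I.
    apply/esym/eqP; rewrite eqEfcard cC e4.2 addn0 leqnn andbT.
    by case: facts.
  have eB : B `\` I = DS by apply/eqP; rewrite eqEfcard hB c4 e4.1.
  have [i [j [iD jD ij]]] : exists x y, [/\ x \in DS, y \in DS & x != y] by apply: two_of; rewrite c4.
  have [k [l [eD uD _ _]]] := four_pick c4 iD jD ij.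
  have DB x : x \in DS -> x \in B by rewrite -eB in_fsetD => /andP[].
  have jB := DB _ jD; have jC : j \notin C by rewrite eC dI.
  have [kD lD] : k \in DS /\ l \in DS by rewrite eD !inE !eqxx !orbT.
  have uD' : [/\ j != k, j != l & j != i].
    by move: uD; rewrite /= !inE !negb_or eq_sym => /and4P[/and3P[-> _ _] /andP[-> ->] _ _].
  case: (@dropS [:: A; B `\ j; j |` C]) => //.
  + move=> D; rewrite !inE => /or3P[] /eqP-> //; apply/fset0Pn; [exists i|exists j]; rewrite !in_fsetE ?eqxx //.
    by rewrite ij DB.
  + by move=> x; rewrite /= !in_fsetE; case: eqVneq => [->|] //=; rewrite jB (negPf jC).
  + rewrite ssum3 -/V; have h : Y `<=` sumset V (sumset (B `\ j) (j |` C)).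
      have [h1 h2 h3] := uD'.
      apply: (Sigma_sub_31 Mg Kg qKM Vb VM VK IK dK dM sSJ cSJ eD uD).
      * apply: I_M; apply/fsubsetP=> z zI; rewrite !in_fsetE IB // andbT.
        by apply: contraTneq zI => ->; apply: dI.
      * by apply: I_M; rewrite eC fsubsetUr.
      * by rewrite !in_fsetE DB // ij.
      * by rewrite !in_fsetE DB // eq_sym h1.
      * by rewrite !in_fsetE DB // eq_sym h2.
      * by rewrite !in_fsetE eqxx.
    by have := fsubset_leq_card h; rewrite cY; move: m0; clear; nlia.
  + rewrite !sum_squares3 cardfsU1 jC; have := cardfsD1 j B; rewrite jB; move: BC; clear; nlia.
Qed.

Let cntBC x : cnt x [:: B; C] = ((x \in I).*2 + (x \in DS))%N.
Proof.
case: (boolP (x \in DS)) => xD; first by rewrite (negPf (dI xD)) cDS.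
by case: (boolP (x \in I)) => xI; [rewrite /= IB // IC|rewrite cN].
Qed.

Lemma excl4 x i j k l : uniq [:: i; j; k; l] -> ((x == i) + (x == j) + (x == k) + (x == l) <= 1)%N.
Proof.
move=> h; have /= e := count_uniq_mem x h; rewrite !(eq_sym x).
by move: e; case: (i == x); case: (j == x); case: (k == x); case: (l == x); rewrite //=; case: (_ \in _).
Qed.

(** The third block A, inactive so far, is used to even out the sizes |I| + 3 and |I| + 1 of B and
    C. In every case some rearrangement has fewer squares and a sum larger than |X| + |A| + 2|I|,
    against [dropS]. *)
Lemma klein_triple_False : False.
Proof.
clearbody DS I.
have [i0 [j0 [k0 [l0 [eD uD eB eC]]]]] := shape.
have [i0D j0D k0D l0D] : [/\ i0 \in DS, j0 \in DS, k0 \in DS & l0 \in DS] by rewrite eD !inE !eqxx !orbT.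
have sC : #|` C| = (#|` I| + 1)%N by rewrite eC cardfsU1 dI // addnC.
have sB : #|` B| = (#|` I| + 3)%N by move: cB cC cBC sC; clear; nlia.
have [i0B k0B l0B j0C] : [/\ i0 \in B, k0 \in B, l0 \in B & j0 \in C] by rewrite eB eC !in_fsetE !eqxx !orbT.
have subIB : I `<=` B by apply/fsubsetP.
have subIC : I `<=` C by apply/fsubsetP.
have WY : Y `<=` sumset V (sumset B C).
  exact: (Sigma_sub_31 Mg Kg qKM Vb VM VK IK dK dM sSJ cSJ eD uD (I_M subIB) (I_M subIC)).
have bigY W : Y `<=` W -> (#|` X| + #|` A| + 2 * #|` I| < #|` W|)%N.
  by move/fsubset_leq_card; rewrite cY; move: m0; clear; nlia.
have [u uK u0] := subgroup_nonzero Kg kM.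
(* A term of I can be spared in B: y + c is recovered by a shift along K if c is in I, and by i0 and
   a point of I in C if c is a label. *)
have hrem y : y \in I -> sumset V (sumset B C) `<=` sumset V (sumset (B `\ y) C).
  move=> yI; apply: sumsetSS => //; apply/fsubsetP=> z /sumsetP[b [c [bB cC' ->]]].
  case: (eqVneq b y) => [->|by_]; last by rewrite mem_sumset // !in_fsetE by_.
  case: (boolP (c \in I)) => cI.
    apply/sumsetP; exists (u + y), (- u + c); split; last by zmod.
      by rewrite !in_fsetE IB ?IK // andbT -subr_eq0 (_ : u + y - y = u) //; zmod.
    by rewrite IC // IK // sgN.
  apply/sumsetP; exists i0, (c - i0 + y); split; last by zmod.
    by rewrite !in_fsetE i0B andbT; apply: contraTneq yI => <-; apply: dI.
  by rewrite IC // IK // dK // CDS.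
have [x [a [xX aA eb]]] := sumsetP _ _ _ Vb.
(* V without beta + M is K-periodic, so beta + M is all that V has in beta + K; the same passes to X
   at x and to A at a. *)
have Vx v : v \in V -> v - beta \in K -> v - beta \in M.
  move=> vV h; apply: contraT => h'; have hK : beta - v \in K by rewrite sgBC.
  have [_] := VK' hK vV h'; rewrite (_ : _ - _ = 0) ?sg0 //; zmod.
have hX y : y \in X -> y - x \in K -> y - x \in M.
  have e : y + a - beta = y - x by rewrite eb; zmod.
  by move=> yX; rewrite -e; apply/Vx/mem_sumset.
have hA y : y \in A -> y - a \in K -> y - a \in M.
  have e : x + y - beta = y - a by rewrite eb; zmod.
  by move=> yA; rewrite -e; apply/Vx/mem_sumset.
have [w wK wM] : exists2 w, w \in K & w \notin M.
  apply: lt_card_mem; rewrite (card_klein Mg Kg MK qKM); move: m0; clear; nlia.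
have aI : I `<=` A -> a \notin I.
  move=> /fsubsetP IA; apply: contra wM => aI'.
  have e : w + a - a = w by zmod.
  by rewrite -e hA ?e // IA // IK.
have pick2 : exists i j k l, [/\ DS = [fset i; j; k; l], uniq [:: i; j; k; l], i - a \notin M & j - a \notin M].
  have [i [j [iD jD ij [ia ja]]]] : exists i j, [/\ i \in DS, j \in DS, i != j & i - a \notin M /\ j - a \notin M].
    case: (classic (exists2 d, d \in DS & d - a \in M)) => [[d dD da]|no]; last first.
      have [i [j [iD jD ij]]] : exists x y, [/\ x \in DS, y \in DS & x != y] by apply: two_of; rewrite c4.
      by exists i, j; split=> //; split; apply/negP=> h; apply: no; [exists i|exists j].
    have : (1 < #|` DS `\ d|)%N by have := c4; rewrite (cardfsD1 d) dD add1n => -[->].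
    have h e : e \in DS -> e != d -> e - a \notin M.
      move=> eD'; apply: contra => ha; apply/eqP/dM => //; apply: (sg_trans Mg ha); by rewrite sgBC.
    move=> /two_of[i [j [iD jD ij]]]; exists i, j; move: iD jD; rewrite !in_fsetD1 => /andP[id iD] /andP[jd jD].
    by split=> //; split; apply: h.
  by have [k [l [e1 e2 _ _]]] := four_pick c4 iD jD ij; exists i, j, k, l.
have cntAr i j k l y : DS = [fset i; j; k; l] -> uniq [:: i; j; k; l] -> i \notin A ->
    cnt y [:: i |` A; k |` (l |` I); j |` I] = cnt y [:: A; B; C].
  move=> e1 e2 iA; rewrite [RHS]cnt_cons cntBC; have ex := excl4 y e2.
  have yI : y \in I -> ((y == i) || (y == j) || (y == k) || (y == l)) = false.
    by move=> yI; apply/negbTE/negP=> h; have /dI : y \in DS by [rewrite e1 !inE]; rewrite yI.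
  have yA : y == i -> y \notin A by move/eqP->.
  rewrite e1 !cnt_cons !in_fsetU !in_fset1; move: ex yI yA.
  by case: (y == i); case: (y == j); case: (y == k); case: (y == l); case: (y \in I); case: (y \in A) => //= _ h1 h2;
     (try by have := h1 isT); have := h2 isT.
have clmS i j k l : DS = [fset i; j; k; l] -> uniq [:: i; j; k; l] -> i \notin A -> j - a \notin M ->
   (#|` X| + #|` A| + 2 * #|` I| < #|` ssum X [:: i |` A; k |` (l |` I); j |` I]|)%N.
  move=> e1 e2; apply: (card_enlarge_first Mg Kg MK qKM Vb VM VK IK dK dM dI sSJ cSJ nY e1 e2 YI (erefl V) pX pA xX aA hX hA cY).
have cI2 k l : k \in DS -> l \in DS -> k != l -> #|` k |` (l |` I)| = (#|` I| + 2)%N.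
  move=> kD lD kl'; rewrite !cardfsU1 !in_fsetE (negPf kl') (negPf (dI kD)) (negPf (dI lD)) /=; clear; nlia.
have cI1 j : j \in DS -> #|` j |` I| = (#|` I| + 1)%N.
  by move=> jD; rewrite cardfsU1 dI // addnC.
have in4 i j k l : DS = [fset i; j; k; l] -> uniq [:: i; j; k; l] ->
   [/\ i \in DS, j \in DS, k \in DS & l \in DS] /\ k != l /\ i != j.
  move=> e1 e2; split; first by rewrite e1 !inE !eqxx !orbT.
  by move: e2; rewrite /= !inE !negb_or => /and4P[/and3P[-> _ _] _ -> _].
have neU z D : z |` D != fset0 by apply/fset0Pn; exists z; rewrite !inE eqxx.
have neBy y : y \in I -> B `\ y != fset0.
  by move=> yI; apply/fset0Pn; exists i0; rewrite !in_fsetE i0B andbT; apply: contraTneq yI => <-; apply: dI.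
(* The cases compare |A| with |C| = |I| + 1 and |B| = |I| + 3, and depend on whether M is
   trivial. *)
case: (leqP #|` A| (#|` I| + 1)) => hA1.
  case: (boolP (I `<=` A)) => [IA|/fsubsetPn[y yI yA]]; last first.
    apply: (@dropS [:: y |` A; B `\ y; C]) => //.
    - by move=> D; rewrite !inE => /or3P[] /eqP-> //; [exact: neBy|apply/fset0Pn; exists j0].
    - by move=> z; rewrite /= !in_fsetE; case: eqVneq => [->|] //=; rewrite (negPf yA) IB.
    - apply: bigY; rewrite ssum3; apply: fsubset_trans WY (fsubset_trans (hrem y yI) _).
      by do !apply: sumsetSS => //; apply: fsubsetUr.
    - have := cardfsD1 y B; rewrite IB // !sum_squares3 cardfsU1 yA; move: hA1 sB; clear; nlia.
  have h1 := per_add1 Mg IM pA IA aA (aI IA).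
  have m1 : #|` M| = 1%N by move: h1 hA1 m0; clear; nlia.
  have eA z : z \in A -> z \notin I -> z - a \in M.
    move=> zA zI; apply: contraT => za.
    by have := per_add2 Mg IM pA IA zA zI aA (aI IA) za; rewrite m1; move: hA1; clear; nlia.
  have [i [j [k [l [e1 e2 ia ja]]]]] := pick2; have [[iD jD kD lD] [kl' ij]] := in4 _ _ _ _ e1 e2.
  have iA : i \notin A by apply: contra ia => iA; apply: eA => //; apply: dI.
  apply: (@dropS [:: i |` A; k |` (l |` I); j |` I]) => //.
  - by move=> D; rewrite !inE => /or3P[] /eqP->; apply: neU.
  - by move=> z; apply: cntAr.
  - exact: clmS.
  - rewrite !sum_squares3 cI2 // cI1 // cardfsU1 iA sB sC; move: hA1 h1; rewrite m1; clear; nlia.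
have nl D : (1 < #|` M|)%N -> forall p, per M D -> p \in D -> ~ lone M D p.
  move=> m2 p pD pD' lp; have [v vM v0] := subgroup_nonzero Mg m2.
  have := lp (v + p) (pD _ _ vM pD'); have e : v + p - p = v by zmod.
  rewrite e => /(_ vM) e'; move: e; rewrite e' subrr => e; by rewrite -e eqxx in v0.
have [a' a'A a'C] : exists2 z, z \in A & z \notin C by apply: lt_card_mem; rewrite sC.
have a'I : a' \notin I by apply: contra a'C => /IC.
case: (leqP #|` M| 1) => [m1|m2].
  have {}m1 : #|` M| = 1%N by move: m1 m0; clear; nlia.
  (* For each label e other than i0, the split of the labels into two and two must not give a large
     sum; this makes A closed under e - i0 away from a, and these differences exhaust K modulo M. *)
  have KA h z : h \in K -> z \in A -> z - a \notin M -> h + z \in A.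
    move=> hK zA za; have hd : h + i0 \in sumset DS M.
      have [g eg] := gK; rewrite eg shiftP.
      have : i0 \in shift g K by rewrite -eg; apply: (fsubsetP (sub_cl Mg DS)).
      by rewrite shiftP => h'; have e := sgD Kg hK h'; inz e.
    have [e eDS he] := in_cl _ _ _ hd.
    suff h' : e - i0 + z \in A by have e' := pA he h'; inz e'.
    case: (eqVneq e i0) => [->|ei]; first by rewrite subrr add0r.
    have [p [q [_ _ e1 e2]]] := four_pick c4 eDS i0D ei.
    have [[pD qD _ _] [_ pq]] := in4 _ _ _ _ e1 e2.
    apply: (stab_enlarge_second Mg Kg MK qKM Vb VM VK IK dK dM dI sSJ cSJ nY e1 e2 YI (erefl V) pX pA xX aA hX hA cY) => //.
    rewrite leqNgt; apply/negP=> big; apply: (dropS _ _ _ big) => //.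
    - by move=> D; rewrite !inE => /or3P[] /eqP->.
    - move=> y; rewrite [RHS]cnt_cons cntBC; have ex := excl4 y e2.
      have yI : y \in I -> ((y == p) || (y == q) || (y == e) || (y == i0)) = false.
        by move=> yI; apply/negbTE/negP=> h0; have /dI : y \in DS by [rewrite e1 !inE]; rewrite yI.
      rewrite e1 !cnt_cons !in_fsetU !in_fset1; move: ex yI.
      by case: (y == p); case: (y == q); case: (y == e); case: (y == i0); case: (y \in I) => //= _ h1; have := h1 isT.
    - by rewrite !sum_squares3 !cI2 // sB sC; clear; nlia.
  have pAa : per K (A `\ a).
    move=> h z hK; rewrite !in_fsetE => /andP[za zA].
    have za' : z - a \notin M.
      apply: contra za => h0; rewrite -subr_eq0; have := m1; rewrite (cardfsD1 0) sg0 // => -[/eqP].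
      by rewrite cardfs_eq0 => /eqP/fsetP/(_ (z - a)); rewrite !in_fsetE h0 andbT => /negbFE.
    rewrite KA // andbT; apply: contra za' => /eqP e; apply: hA => //.
    by rewrite -e (_ : z - (h + z) = - h) ?sgN //; zmod.
  (* Both |A \ a| and |I| are multiples of |K| = 4, so a positive difference is at least 4. *)
  have [q eq] := card_per Kg pAa; have [q' eq'] := card_per Kg IK.
  have cK := card_klein Mg Kg MK qKM; rewrite m1 muln1 in cK; rewrite cK in eq eq'.
  have cAa := cardfsD1 a A; rewrite aA in cAa.
  have lt : (#|` I| + 4 <= #|` A `\ a|)%N by move: eq eq' cAa hA1; clear; nlia.
  have [y yA yC] : exists2 y, y \in A `\ a & y \notin C by apply: lt_card_mem; rewrite sC; move: lt; clear; nlia.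
  have [ya yA'] : y != a /\ y \in A by move: yA; rewrite !in_fsetE => /andP[].
  have sh b : b \in B -> exists v, [/\ v \in K, v != 0 & v + b \in B].
    move=> bB; case: (boolP (b \in I)) => bI; first by exists u; rewrite IB // IK.
    have bD := BDS bB bI.
    have [d dB [dD db]] : exists2 d, d \in B & d \in DS /\ d != b.
      case: (eqVneq i0 b) => [<-|ib]; last by exists i0.
      exists k0 => //; split=> //; apply/eqP=> e; move: uD; rewrite e /= !inE eqxx !orbT //.
    by exists (d - b); rewrite dK // subr_eq0 db (_ : d - b + b = d) //; zmod.
  (* The term y is redundant in A: a sum y + b returns as (y - v) + (v + b), with v chosen so that v
     + b is in B. *)
  apply: (@dropS [:: A `\ y; B; y |` C]) => //.
  - move=> D; rewrite !inE => /or3P[] /eqP-> //; apply/fset0Pn; [exists a|by exists i0].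
    by rewrite !in_fsetE eq_sym ya.
  - by move=> z; rewrite /= !in_fsetE; case: eqVneq => [->|] //=; rewrite yA' (negPf yC); case: (y \in B).
  - apply: bigY; apply: fsubset_trans WY _; rewrite ssum3; apply/fsubsetP=> z.
    move=> /sumsetP[_ [_ [/sumsetP[x1 [a1 [x1X a1A ->]]] /sumsetP[b [c [bB cC' ->]]] ->]]].
    have cC2 : c \in y |` C by rewrite !in_fsetE cC' orbT.
    case: (eqVneq a1 y) => [->|a1y]; last by rewrite !mem_sumset // !in_fsetE a1y.
    have [v [vK v0 vB]] := sh b bB.
    have := pAa (- v) y; rewrite sgN // => /(_ isT yA); rewrite !in_fsetE => /andP[_ vy].
    have vy' : - v + y \in A `\ y.
      rewrite !in_fsetE vy andbT -subr_eq0 (_ : - v + y - y = - v) ?oppr_eq0 //; zmod.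
    have e := mem_sumset (mem_sumset x1X vy') (mem_sumset vB cC2); inz e.
  - have := cardfsD1 y A; rewrite yA' !sum_squares3 cardfsU1 yC sC sB; move: lt cAa; clear; nlia.
have rX D p : p \in D -> ~ lone M D p -> sumset X (D `\ p) = sumset X D.
  by move=> pD; apply: per_rem.
have nA := nl A m2 a' pA a'A.
have eA' : sumset X (A `\ a') = V by rewrite rX.
have neA' : A `\ a' != fset0 by apply: nlone_rem_neq0 nA.
have cA' := cardfsD1 a' A; rewrite a'A in cA'.
case: (leqP (#|` I| + 3) #|` A|) => hA2.
  apply: (@dropS [:: A `\ a'; B; a' |` C]) => //.
  - by move=> D; rewrite !inE => /or3P[] /eqP-> //; apply/fset0Pn; exists i0.
  - by move=> z; rewrite /= !in_fsetE; case: eqVneq => [->|] //=; rewrite a'A (negPf a'C); case: (a' \in B).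
  - apply: bigY; apply: fsubset_trans WY _; rewrite ssum3 eA'.
    by do !apply: sumsetSS => //; apply: fsubsetUr.
  - rewrite !sum_squares3 cardfsU1 a'C sC sB; move: cA' hA2; clear; nlia.
(* Now |A| = |I| + 2, and two simultaneous moves give three blocks of |I| + 2 terms. *)
case: (boolP (I `<=` A `\ a')) => [IA'|/fsubsetPn[y yI yA]]; last first.
  have ya' : y != a' by apply: contraNneq a'I => <-.
  have yA' : y \notin A by move: yA; rewrite !in_fsetE ya'.
  apply: (@dropS [:: y |` (A `\ a'); B `\ y; a' |` C]) => //.
  - by move=> D; rewrite !inE => /or3P[] /eqP-> //; exact: neBy.
  - move=> z; rewrite /= !in_fsetE; case: (eqVneq z y) => [->|] /=.
      by rewrite (negPf ya') (negPf yA') IB.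
    by case: (eqVneq z a') => [->|] //=; rewrite a'A (negPf a'C) => _; case: (a' \in B).
  - apply: bigY; rewrite ssum3; apply: fsubset_trans WY (fsubset_trans (hrem y yI) _).
    rewrite -eA'; do !apply: sumsetSS => //; apply: fsubsetUr.
  - have := cardfsD1 y B; rewrite IB // !sum_squares3 !cardfsU1 yA a'C sB sC; move: cA' hA1 hA2; clear; nlia.
have IA : I `<=` A by apply: fsubset_trans IA' _; apply: fsubD1set.
have eA z : z \in A -> z \notin I -> z - a \in M.
  move=> zA zI; apply: contraT => za.
  by have := per_add2 Mg IM pA IA zA zI aA (aI IA) za; move: hA2 m2; clear; nlia.
have [i [j [k [l [e1 e2 ia ja]]]]] := pick2; have [[iD jD kD lD] [kl' ij]] := in4 _ _ _ _ e1 e2.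
have iA : i \notin A by apply: contra ia => iA; apply: eA => //; apply: dI.
have a'a := eA a' a'A a'I.
have a'i : a' != i by apply: contraNneq iA => <-.
have a'j : a' != j by apply: contraNneq ja => <-.
apply: (@dropS [:: (i |` A) `\ a'; k |` (l |` I); a' |` (j |` I)]) => //.
- move=> D; rewrite !inE => /or3P[] /eqP-> //; apply/fset0Pn; exists i.
  by rewrite !in_fsetE eqxx eq_sym a'i.
- move=> z; rewrite -(cntAr _ _ _ _ z e1 e2 iA) /= !in_fsetE.
  case: (eqVneq z a') => [->|] //=; rewrite (negPf a'i) a'A (negPf a'j) (negPf a'I) /=.
  by case: (a' == k); case: (a' == l).
- apply: leq_trans (clmS _ _ _ _ e1 e2 iA ja) _; apply: fsubset_leq_card.
  rewrite !ssum3 rX; [|by rewrite !in_fsetE a'A orbT|].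
    by do !apply: sumsetSS => //; apply: fsubsetUr.
  by move=> l'; apply: nA => y yA; apply: l'; rewrite !in_fsetE yA orbT.
- have := cardfsD1 a' (i |` A); rewrite !in_fsetE a'A orbT cardfsU1 iA => e.
  rewrite !sum_squares3 cI2 // (cardfsU1 a') !in_fsetE (negPf a'j) (negPf a'I) cI1 // sB sC.
  by move: e hA1 hA2; clear; nlia.
Qed.
End Special.

(** * Unbalanced pairs with minimal sum of squares *)

Section PairMin.
Variables (G : zmodType) (X B C : {fset G}).
Implicit Types (A D Y W L V M K DS I : {fset G}) (x y z a b c g h w p q u v d e : G).
Hypotheses (X0 : X != fset0) (C0 : C != fset0).
Hypothesis hBC : (#|` C| + 2 <= #|` B|)%N.
Hypothesis hW : (#|` X| + #|` B| + #|` C| <= #|` sumset X (sumset B C)| + 2)%N.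
Hypothesis hmin : forall B' C' : {fset G}, B' != fset0 -> C' != fset0 ->
  (forall y, cnt y [:: B'; C'] = cnt y [:: B; C]) ->
  (#|` X| + #|` B| + #|` C| <= #|` sumset X (sumset B' C')| + 2)%N -> (sum_squares [:: B; C] <= sum_squares [:: B'; C'])%N.

Let E := sumset X C.
Let P := B `\` C.
Let E0 : E != fset0. Proof. exact: sumset_neq0. Qed.
Let WE D : sumset X (sumset D C) = sumset D E. Proof. by rewrite sumsetCA. Qed.
Let Wb b := sumset (B `\ b) E.

Lemma sum_squares2 A D : sum_squares [:: A; D] = (#|` A| ^ 2 + #|` D| ^ 2)%N.
Proof. by rewrite /sum_squares !big_cons big_nil addn0. Qed.

Let PP b : b \in P = (b \in B) && (b \notin C). Proof. by rewrite in_fsetD andbC. Qed.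
Let cB b : b \in B -> #|` B| = (#|` B `\ b|).+1. Proof. by move=> h; rewrite (cardfsD1 b) h. Qed.
Let Bb0 b : B `\ b != fset0.
Proof.
rewrite -cardfs_gt0; have := cardfsD1 b B; move: hBC; case: (b \in B); clear; nlia.
Qed.
Let Wb0 b : Wb b != fset0. Proof. exact: sumset_neq0. Qed.
Let Hg b : is_subgroup (Stab (Wb b)). Proof. exact: Stab_subgroup. Qed.

Let mv b : b \in P -> (#|` sumset X (sumset (B `\ b) (b |` C))| + 2 < #|` X| + #|` B| + #|` C|)%N.
Proof.
rewrite PP => /andP[bB bC]; rewrite ltnNge; apply/negP=> h.
have := @hmin (B `\ b) (b |` C) (Bb0 b) _ _ h; rewrite !sum_squares2 cardfsU1 bC (cB bB).
have ne : b |` C != fset0 by apply/fset0Pn; exists b; rewrite !inE eqxx.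
have ec y : cnt y [:: B `\ b; b |` C] = cnt y [:: B; C].
  by rewrite /= !in_fsetE; case: eqVneq => [->|] //=; rewrite bB (negPf bC).
move=> /(_ ne ec); have := cB bB; move: hBC; clear; nlia.
Qed.

Let wb b : b \in P -> (#|` Wb b| + 2 < #|` X| + #|` B| + #|` C|)%N.
Proof.
move=> /mv; apply: leq_ltn_trans; rewrite leq_add2r /Wb -WE; apply: fsubset_leq_card.
by do 2!apply: sumsetSS => //; apply: fsubsetUr.
Qed.

Let noW b : b \in P -> ~ sumset B E `<=` Wb b.
Proof.
move=> /wb h /fsubset_leq_card; rewrite -WE; move: hW h; clear; nlia.
Qed.

(** If C were contained in B, any term of B outside C could be moved to C without loss, by
    [swap_sub]. *)
Let Rn : exists2 c, c \in C & c \notin B.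
Proof.
case: (boolP (C `<=` B)) => [sub|/fsubsetPn//].
have : (0 < #|` P|)%N.
  have := cardfsDI B C; have := fsubset_leq_card (fsubsetIr B C); rewrite -/P; move: hBC; clear; nlia.
rewrite cardfs_gt0 => /fset0Pn[b bP]; have := mv bP.
have h : sumset X (sumset B C) `<=` sumset X (sumset (B `\ b) (b |` C)).
  by apply: sumsetSS => //; apply: swap_sub => //; move: bP; rewrite PP => /andP[].
by have := fsubset_leq_card h; move: hW; clear; nlia.
Qed.

Let cP : (3 <= #|` P|)%N.
Proof.
have [c cC cB'] := Rn.
have : (0 < #|` C `\` B|)%N by rewrite cardfs_gt0; apply/fset0Pn; exists c; rewrite in_fsetD cB'.
have := cardfsDI B C; have := cardfsDI C B; rewrite fsetIC -/P; move: hBC; clear; nlia.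
Qed.

Let third b b' : exists d, [/\ d \in P, d != b & d != b'].
Proof.
have : (#|` [fset b; b']| < #|` P|)%N by apply: leq_trans cP; rewrite ltnS cardfs2; case: (_ != _).
by move=> /lt_card_mem[d dP]; rewrite in_fset2 negb_or => /andP[h1 h2]; exists d.
Qed.

(** If b' were redundant after the removal of b, it would be redundant in B, which [noW]
    excludes. *)
Let notrem b b' : b' \in P -> b' != b -> sumset ((B `\ b) `\ b') E <> Wb b.
Proof.
move=> b'P b'b e; apply: (noW b'P); apply/fsubsetP=> z /sumsetP[y [u [yB uE ->]]].
case: (eqVneq y b') => [->|yb]; last by rewrite mem_sumset // !in_fsetE yb.
have b'B : b' \in B by move: b'P; rewrite PP => /andP[].
have : b' + u \in Wb b by rewrite mem_sumset // !in_fsetE b'b.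
rewrite -e => h; apply: (fsubsetP (sumsetSS _ _)) h => //; apply: fsetSD; exact: fsubD1set.
Qed.

Let Pn b : b \in P -> exists b', [/\ b' \in P, b' != b & b' \in B `\ b].
Proof.
move=> bP; have [b' [h1 h2 _]] := third b b; exists b'; split=> //.
by rewrite !in_fsetE h2; move: h1; rewrite PP => /andP[].
Qed.

Let c3 b : b \in P -> (#|` X| + #|` B `\ b| <= #|` sumset X (B `\ b)| + 1)%N.
Proof.
move=> bP; have [b' [b'P b'b b'B]] := Pn bP; rewrite leqNgt; apply/negP=> h.
have lt : (#|` sumset (B `\ b) X| + 1 < #|` B `\ b| + #|` X|)%N.
  by rewrite sumsetC; move: h; clear; nlia.
have e := redundant_of_deficit b'B lt.
by apply: (notrem b'P b'b); rewrite /Wb /E !sumsetA e.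
Qed.

(** By minimality the sum after moving b is small, so b is redundant in its new block and shares a
    coset of the stabilizer with some c of C. *)
Let c4 b : b \in P -> Wb b = sumset X (sumset (B `\ b) (b |` C)) /\ exists c, [/\ c \in C, c != b & c - b \in Stab (Wb b)].
Proof.
move=> bP; have h := c3 bP; have h2 := mv bP; have := bP; rewrite PP => /andP[bB bC].
have cb := cB bB.
have e1 : sumset X (sumset (B `\ b) (b |` C)) = sumset (b |` C) (sumset X (B `\ b)) by rewrite sumsetA sumsetC.
have lt : (#|` sumset (b |` C) (sumset X (B `\ b))| + 1 < #|` b |` C| + #|` sumset X (B `\ b)|)%N.
  rewrite -e1 cardfsU1 bC; move: h h2 cb; clear; nlia.
have bm : b \in b |` C by rewrite !inE eqxx.
have := redundant_of_deficit bm lt; rewrite fsetU1K // -e1 => e2.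
have e3 : Wb b = sumset X (sumset (B `\ b) (b |` C)) by rewrite -e2 sumsetC -sumsetA /Wb sumsetCA.
split=> //; have ne : b |` C != fset0 by apply/fset0Pn; exists b.
have := nlone_of_deficit ne (sumset_neq0 X0 (Bb0 b)) bm lt; rewrite -e1 -e3 => /nlone[c [cC cb' hc]].
by exists c; split=> //; move: cC; rewrite !in_fsetE (negPf cb').
Qed.

Let c6 b : b \in P -> (#|` B `\ b| + #|` E| <= #|` Wb b| + 1)%N.
Proof.
move=> bP; have [b' [b'P b'b b'B]] := Pn bP; rewrite leqNgt; apply/negP=> h.
exact: (notrem b'P b'b (redundant_of_deficit b'B h)).
Qed.

Let Pnonempty : exists b, b \in P.
Proof. by apply/fset0Pn; rewrite -cardfs_gt0; move: cP; clear; nlia. Qed.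

Let cE1 : (#|` E| + 1 <= #|` X| + #|` C|)%N.
Proof.
have [b bP] := Pnonempty; have h1 := wb bP; have h2 := c6 bP.
have := bP; rewrite PP => /andP[/cB e _]; move: h1 h2 e; clear; nlia.
Qed.

(** Otherwise E has a nontrivial stabilizer K, modulo which the terms of P are alone. Counting lone
    terms leaves |P| = 3, C periodic and C \ B a single point c. Adjoining c to B \ b keeps its
    closure and two lone terms, one point too many. *)
Let caseN : (#|` E| + 1 = #|` X| + #|` C|)%N.
Proof.
apply/eqP; rewrite eqn_leq cE1 leqNgt; apply/negP=> lt.
pose K := Stab E; have Kg : is_subgroup K by apply: Stab_subgroup.
have pE : per K E by rewrite per_stab.
have lP D p : p \in P -> D `<=` B -> lone K D p.
  move=> pP /fsubsetP s y yD h; apply: NNPP => yp; apply: (noW pP); rewrite /Wb.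
  have nl : ~ lone K B p by move=> l; apply: yp; apply: l => //; apply: s.
  by rewrite sumsetC -(per_rem Kg pE nl) sumsetC.
have [b bP] := Pnonempty; have [b' [b'P b'b b'B]] := Pn bP.
have subB : B `\ b `<=` B by apply: fsubD1set.
have h1 := irredundant_card_cl Kg pE b'B (lP _ _ b'P subB) (notrem b'P b'b).
have h2 := wb bP; have := bP; rewrite PP => /andP[bB bC]; have cb := cB bB.
have h3 := kneser X0 C0; rewrite -/E -/K in h3.
have h4 := card_cl_ge Kg X; have h5 := card_cl_ge Kg C.
have TP : P `\ b `<=` B `\ b by apply: fsetSD; apply: fsubsetDl.
have h6 := @card_lone _ K (B `\ b) (P `\ b) Kg TP _.
have {}h6 := h6 (fun x xP => lP _ x (fsubsetP (fsubD1set P b) x xP) subB).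
have cPb := cardfsD1 b P; rewrite bP in cPb.
have K2 : (2 <= #|` K|)%N by move: h3 h4 h5 lt; clear; nlia.
have T2 : #|` P `\ b| = 2%N.
  have : (2 <= #|` P `\ b|)%N by move: cPb cP; clear; nlia.
  case: (ltngtP 2 #|` P `\ b|) => // h _.
  have : (3 * #|` K| + #|` P `\ b| <= #|` P `\ b| * #|` K| + 3)%N.
    have [s ->] : exists s, #|` P `\ b| = (3 + s)%N by exists (#|` P `\ b| - 3)%N; rewrite subnKC.
    rewrite mulnDl; have : (s <= s * #|` K|)%N by rewrite leq_pmulr // (leq_trans _ K2).
    by clear; nlia.
  by move: h1 h2 h3 h4 h5 h6 cb K2; rewrite -/(Wb b); clear; nlia.
rewrite T2 in h6.
have pC : per K C.
  by apply: per_cl_eq => //; move: h1 h2 h3 h4 h5 h6 cb; rewrite -/(Wb b); clear; nlia.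
have [c cC cB'] := Rn.
have R1 : C `\` B = [fset c].
  apply/esym/eqP; rewrite eqEfcard cardfs1 fsub1set in_fsetD cB' cC /=.
  have := cardfsDI B C; have := cardfsDI C B; rewrite fsetIC -/P; move: hBC cPb; rewrite T2; clear; nlia.
have [u uK u0] := subgroup_nonzero Kg K2.
have cuB : u + c \in B.
  apply: contraT => n; have : u + c \in C `\` B by rewrite in_fsetD n pC.
  by rewrite R1 in_fset1 -subr_eq0 (_ : u + c - c = u) ?(negPf u0) //; zmod.
have cuC : u + c \in C by apply: pC.
have cl : c \in sumset (B `\ b) K.
  apply/in_cl; exists (u + c); last by rewrite (_ : c - (u + c) = - u) ?sgN //; zmod.
  by rewrite !in_fsetE cuB andbT; apply: contraNneq bC => <-.
have [p [q [pP qP pq]]] : exists x y, [/\ x \in P `\ b, y \in P `\ b & x != y] by apply: two_of; rewrite T2.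
have lc r : r \in P `\ b -> r \in c |` (B `\ b) /\ lone K (c |` (B `\ b)) r.
  move=> rP; have rB := fsubsetP TP r rP; split; first by rewrite !in_fsetE; move: rB; rewrite !in_fsetE => ->; rewrite orbT.
  have rP' := fsubsetP (fsubD1set P b) r rP.
  move=> y; rewrite in_fsetU in_fset1 => /orP[/eqP->|yB] h; last exact: (lP _ r rP' subB).
  have : r \in C by rewrite (per_mem Kg pC (y := c)) // sgBC.
  by move: rP'; rewrite PP => /andP[_ /negPf->].
have [pM lp] := lc p pP; have [qM lq] := lc q qP.
have := card_lone2 Kg pM qM pq lp lq.
rewrite (cl_addin Kg cl) cardfsU1 !in_fsetE (negPf cB') andbF /=.
by move: h1 h2 h3 h4 h5 cb; rewrite -/(Wb b); clear; nlia.
Qed.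

Let H b := Stab (Wb b).
Let pW b : per (H b) (Wb b). Proof. exact: Stab_per. Qed.
Let PB b : b \in P -> b \in B. Proof. by rewrite PP => /andP[]. Qed.
Let PC b : b \in P -> b \notin C. Proof. by rewrite PP => /andP[]. Qed.

Let inW b y u : y \in B -> y != b -> u \in E -> y + u \in Wb b.
Proof. by move=> yB yb uE; rewrite mem_sumset // !in_fsetE yb. Qed.

Let outW b : b \in P -> exists2 u, u \in E & b + u \notin Wb b.
Proof.
move=> bP; apply: NNPP => no; apply: (noW bP); apply/fsubsetP=> z /sumsetP[y [u [yB uE ->]]].
case: (eqVneq y b) => [->|yb]; last exact: inW.
by apply: contraT => h; case: no; exists u.
Qed.

Let lone_b b y : b \in P -> y \in B -> y - b \in H b -> y = b.
Proof.
move=> bP yB h; apply/eqP; apply: contraT => yb.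
have [u uE] := outW bP; case/negP.
have e := pW (sgN (Hg b) h) (inW yB yb uE); inz e.
Qed.

Let cW b : b \in P -> (#|` Wb b| + 1 = #|` B `\ b| + #|` E|)%N.
Proof.
move=> bP; have h1 := c6 bP; have h2 := wb bP; have h3 := cB (PB bP); have h4 := caseN.
move: h1 h2 h3 h4; clear; nlia.
Qed.

(* The data attached to a move of [b]: the point [b' + e] of [Wb b] has [b'] as its only left summand, so [B] and [E] are full in every
   coset of [H b] other than those of [b'] and [e]. *)
Let str b b' : b \in P -> b' \in P -> b' != b -> exists e,
  [/\ e \in E, (forall y u, y \in B -> y != b -> u \in E -> y + u = b' + e -> y = b'),
    (forall y, y \in B -> y != b -> y - b' \notin H b -> forall h, h \in H b -> h + y \in B),
    (forall u, u \in E -> u - e \notin H b -> forall h, h \in H b -> h + u \in E) &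
    (forall h, h \in H b -> b' + h \in B \/ e - h \in E)].
Proof.
move=> bP b'P b'b; have [w wW wn] : exists2 w, w \in Wb b & w \notin sumset ((B `\ b) `\ b') E.
  apply: NNPP => no; apply: (notrem b'P b'b); apply/eqP; rewrite eqEfsubset; apply/andP; split.
    by apply: sumsetSS => //; apply: fsubD1set.
  by apply/fsubsetP=> w wW; apply: contraT => h; case: no; exists w.
have un y u : y \in B -> y != b -> u \in E -> w = y + u -> y = b'.
  move=> yB yb uE e; apply/eqP; apply: contraR wn => yb'; by rewrite e mem_sumset // !in_fsetE yb' yb.
have [b1 [e [b1B eE we]]] := sumsetP _ _ _ wW.
have {b1B} eb1 : b1 = b' by move: b1B; rewrite !in_fsetE => /andP[h1 h2]; apply: un we.
move: we; rewrite eb1 => we {b1 eb1}.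
(* For nonzero h one of b' + h and e - h must be missing, or w would be a sum without b'. This gives
   at least |H b| - 1 holes, and Kneser's theorem with [cW] allows no more, so these are all. *)
pose Hb := [fset h in H b | b' + h \notin B `\ b].
pose He := [fset h in H b | e - h \notin E].
have inHb h : h \in Hb = (h \in H b) && (b' + h \notin B `\ b) by rewrite !inE.
have inHe h : h \in He = (h \in H b) && (e - h \notin E) by rewrite !inE.
have cov h : h \in H b -> h != 0 -> (h \in Hb) || (h \in He).
  move=> hH h0; rewrite inHb inHe hH /= -negb_and; apply/negP=> /andP[]; rewrite in_fsetD1 => /andP[h1 h2] h3.
  have ew : w = b' + h + (e - h) by rewrite we; zmod.
  have e' := un _ _ h2 h1 h3 ew; case/negP: h0; apply/eqP.
  by apply: (addrI b'); rewrite e' addr0.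
have hH0 := sg0 (Hg b).
have c1 : (#|` H b| <= #|` Hb `|` He| + 1)%N.
  have : H b `<=` 0 |` (Hb `|` He).
    apply/fsubsetP=> h hH; rewrite in_fsetU in_fset1 in_fsetU; case: (eqVneq h 0) => //= h0; exact: cov.
  move/fsubset_leq_card; rewrite cardfsU1; case: (0 \notin _) => /=; clear; nlia.
pose B1 := [fset b' + h | h in Hb]; pose E1 := [fset e - h | h in He].
have cB1 : #|` B1| = #|` Hb| by apply: card_fim => h1 h2 _ _ /addrI.
have cE1' : #|` E1| = #|` He| by apply: card_fim => h1 h2 _ _ /addrI/oppr_inj.
have b'B : b' \in B `\ b by rewrite in_fsetD1 b'b PB.
have B1s : B1 `<=` sumset (B `\ b) (H b) `\` (B `\ b).
  apply/fsubsetP=> z /imfsetP[h /=]; rewrite inHb => /andP[hH hn] ->; rewrite in_fsetD hn /=.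
  have e2 : b' + h - b' = h by zmod.
  by apply/in_cl; exists b'; rewrite // e2.
have E1s : E1 `<=` sumset E (H b) `\` E.
  apply/fsubsetP=> z /imfsetP[h /=]; rewrite inHe => /andP[hH hn] ->; rewrite in_fsetD hn /=.
  have e2 : e - h - e = - h by zmod.
  by apply/in_cl; exists e; rewrite // e2; apply: sgN (Hg b) _ hH.
have d1 := cardfsDS (sub_cl (Hg b) (B `\ b)); have d2 := cardfsDS (sub_cl (Hg b) E).
have d3 := card_cl_ge (Hg b) (B `\ b); have d4 := card_cl_ge (Hg b) E.
have d5 := fsubset_leq_card B1s; have d6 := fsubset_leq_card E1s; have d7 := cW bP.
have d8 := kneser (Bb0 b) E0; rewrite -/(Wb b) -/(H b) in d8.
have d9 := cardfsUI Hb He.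
rewrite d1 cB1 in d5; rewrite d2 cE1' in d6; rewrite -/(H b) in d3 d4.
have [f1 f2 f3] : [/\ #|` Hb `&` He| = 0, #|` sumset (B `\ b) (H b) `\` (B `\ b)| <= #|` B1| &
    #|` sumset E (H b) `\` E| <= #|` E1|]%N.
  by rewrite cB1 cE1' d1 d2; move: c1 d3 d4 d5 d6 d7 d8 d9; rewrite -/(H b); clear; split; nlia.
have g1 : B1 = sumset (B `\ b) (H b) `\` (B `\ b) by apply/eqP; rewrite eqEfcard B1s.
have g2 : E1 = sumset E (H b) `\` E by apply/eqP; rewrite eqEfcard E1s.
exists e; split=> //.
- by move=> y u yB yb uE e'; apply: un yB yb uE _; rewrite we.
- move=> y yB yb yb' h hH; apply: contraT => hn.
  have : h + y \in B1.
    rewrite g1 in_fsetD; apply/andP; split; first by rewrite in_fsetD1 (negPf hn) andbF.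
    by apply: (per_cl (Hg b) hH); apply: (fsubsetP (sub_cl (Hg b) _)); rewrite in_fsetD1 yb.
  move=> /imfsetP[h' /=]; rewrite inHb => /andP[h'H _] e'; case/negP: yb'.
  have e2 := sgB (Hg b) h'H hH; rewrite (_ : y - b' = h + y - b' - h); last by zmod.
  by rewrite e' (_ : b' + h' - b' - h = h' - h) //; zmod.
- move=> u uE ue h hH; apply: contraT => hn.
  have : h + u \in E1.
    by rewrite g2 in_fsetD hn; apply: (per_cl (Hg b) hH); apply: (fsubsetP (sub_cl (Hg b) _)).
  move=> /imfsetP[h' /=]; rewrite inHe => /andP[h'H _] e'; case/negP: ue.
  have e2 := sgN (Hg b) (sgD (Hg b) h'H hH); rewrite (_ : u - e = h + u - e - h); last by zmod.
  by rewrite e' (_ : e - h' - e - h = - (h' + h)) //; zmod.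
- move=> h hH; case: (boolP (b' + h \in B `\ b)) => hb; first by left; move: hb; rewrite in_fsetD1 => /andP[].
  right; apply: contraT => he; move/eqP: f1; rewrite cardfs_eq0 => /eqP/fsetP/(_ h).
  by rewrite in_fsetI inHb inHe hH hb he in_fset0.
Qed.

Let Hne b : b \in P -> exists2 h, h \in H b & h != 0.
Proof.
move=> /c4[_ [c [cC cb hc]]]; exists (c - b) => //; by rewrite subr_eq0.
Qed.

Let two b b' : b \in P -> b' \in P -> b' != b -> exists y, [/\ y \in B, y != b' & y - b' \in H b].
Proof.
move=> bP b'P b'b; have [d [dP db db']] := third b b'.
case: (boolP (d - b' \in H b)) => h; first by exists d; split=> //; apply: PB.
have [e [_ _ hc _ _]] := str bP dP db; have [g gH g0] := Hne bP.
exists (g + b'); rewrite (_ : g + b' - b' = g); last by zmod.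
split=> //; last by rewrite -subr_eq0 (_ : g + b' - b' = g) //; zmod.
by apply: hc => //; [exact: PB|rewrite (sgBC (Hg b))].
Qed.

(** If g + b2 were missing, [str] would confine the other terms of P to b2 + H b1, and then also to
    b1 + H b2. A third term b3 ties the two stabilizers together: they meet trivially, and the part
    of E in e1 + H b1 shrinks to one point e0. But e1 and e1 - g both lie there, so g = 0. *)
Let N1 b1 b2 g : b1 \in P -> b2 \in P -> b2 != b1 -> g \in H b1 -> g + b2 \in B.
Proof.
move=> p1 p2 n21 gH; apply: contraT => gB.
have G1 := Hg b1; have G2 := Hg b2; have n12 : b1 != b2 by rewrite eq_sym.
have [e1 [e1E _ q1c q1d q1v]] := str p1 p2 n21.
have [_ [_ _ q2c _ _]] := str p2 p1 n12.
have i1 y : y \in P -> y != b1 -> y - b2 \in H b1.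
  move=> yP y1; apply: contraT => h; have [_ [_ _ hc _ _]] := str p1 yP y1.
  by case/negP: gB; apply: (hc b2 (PB p2) n21 _ g gH); rewrite sgBC.
have i2 y h1 h2 : y \in B -> y != b1 -> h1 \in H b1 -> h2 \in H b2 -> y = b2 + h1 + h2 -> y - b2 \in H b1.
  move=> yB y1 h1H h2H ey; apply: contraT => h.
  have hb : - h1 + y \in B by apply: (q1c y yB y1 h); apply: sgN.
  have e : - h1 + y - b2 = h2 by rewrite ey; zmod.
  have := lone_b p2 hb; rewrite e => /(_ h2H) e'; case/negP: h.
  by rewrite -e'; inz h1H.
have i3 y : y \in B -> y - b2 \in H b1 -> y != b2 -> y - b1 \in H b2.
  move=> yB yH y2; apply: contraT => h.
  have y1 h' : h' \in H b2 -> h' + y != b1.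
    move=> h'H; apply: contra h => /eqP <-; rewrite (_ : y - (h' + y) = - h') ?sgN //; zmod.
  have sub h' : h' \in H b2 -> h' \in H b1.
    move=> h'H; have hB := q2c y yB y2 h h' h'H.
    have := i2 _ _ _ hB (y1 _ h'H) yH h'H; have -> : h' + y = b2 + (y - b2) + h' by zmod.
    move=> /(_ erefl) e; have e' := sgB G1 e yH; inz e'.
  have [v [vB v1 vH]] := two p2 p1 n12.
  by case/negP: v1; apply/eqP; apply: (lone_b p1) => //; apply: sub.
have [b3 [p3 n31 n32]] := third b1 b2.
have h3 := i1 b3 p3 n31; have h3' := i3 b3 (PB p3) h3 n32.
have [e3 [e3E q3u _ q3d q3v]] := str p2 p3 n32.
have iv u : u \in E -> b1 + u \notin Wb b1 -> u + b1 - b3 \notin E.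
  move=> uE; apply: contra => h; have := inW (PB p3) n31 h.
  by rewrite (_ : b3 + _ = b1 + u) //; zmod.
have v5 u : u \in E -> b1 + u \notin Wb b1 -> u - e3 \in H b2.
  move=> uE un; apply: contraT => h; case/negP: (iv u uE un).
  have h' : b1 - b3 \in H b2 by rewrite sgBC.
  by have e := q3d u uE h _ h'; inz e.
have [e0 e0E e0n] := outW p1; have e03 := v5 _ e0E e0n.
have mvW u : u - e0 \in H b1 -> b1 + u \notin Wb b1.
  move=> h; apply: contra e0n => h'; have e := pW (sgN G1 h) h'; inz e.
have e01 : e0 - e1 \in H b1.
  apply: contraT => h; have sub h' : h' \in H b1 -> h' \in H b2.
    move=> h'H; have hE := q1d e0 e0E h h' h'H.
    have e' : h' + e0 - e0 = h' by zmod.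
    have := v5 _ hE; rewrite mvW ?e' // => /(_ isT) e; have e2 := sgB G2 e e03; inz e2.
  by case/negP: n32; apply/eqP; apply: (lone_b p2 (PB p3)); apply: sub.
have v6 u : u \in E -> u - e1 \in H b1 -> u - e0 \in H b1 /\ u - e0 \in H b2.
  move=> uE h; have h1 : u - e0 \in H b1 by have e := sgB G1 h e01; inz e.
  by split=> //; have e := sgB G2 (v5 u uE (mvW u h1)) e03; inz e.
pose z := e3 + b3 - b1.
have zE : z \notin E.
  apply/negP=> h; have := q3u b1 z (PB p1) n12 h.
  by rewrite /z (_ : b1 + _ = b3 + e3); [move=> /(_ erefl) e; rewrite e eqxx in n31|zmod].
have zg q : q \in H b1 -> q \in H b2 -> z + q \notin E.
  move=> q1 q2; apply/negP=> h; case: (boolP (z + q - e1 \in H b1)) => h1.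
    have [h2 _] := v6 _ h h1; case/negP: (mvW _ h2).
    by have e := pW q1 (inW (PB p3) n31 e3E); move: e; rewrite /z; move=> e; inz e.
  case/negP: zE; have e := q1d _ h h1 _ (sgN G1 q1); inz e.
have triv q : q \in H b1 -> q \in H b2 -> q = 0.
  move=> q1 q2; have hq : b1 - b3 - q \in H b2.
    by have e := sgN G2 (sgD G2 h3' q2); inz e.
  case: (q3v _ hq) => h.
    have e : b3 + (b1 - b3 - q) - b1 = - q by zmod.
    have := lone_b p1 h; rewrite e sgN // => /(_ isT) e'.
    by apply: oppr_inj; rewrite oppr0 -e e' subrr.
  by case/negP: (zg q q1 q2); rewrite /z; inz h.
have e11 : e1 - e1 \in H b1 by rewrite subrr sg0.
have [f1 f2] := v6 e1 e1E e11.
have f0 := triv _ f1 f2.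
case: (q1v g gH) => h; first by case/negP: gB; inz h.
have e12 : e1 - g - e1 \in H b1 by have e := sgN G1 gH; inz e.
have [k1 k2] := v6 _ h e12.
have k0 := triv _ k1 k2.
have g0 : g = 0.
  have e : g = (e1 - e0) - (e1 - g - e0) by zmod.
  by rewrite e f0 k0 subrr.
by case/negP: gB; rewrite g0 add0r PB.
Qed.

Let perB b y h : b \in P -> y \in B -> y != b -> h \in H b -> h + y \in B.
Proof.
move=> bP yB yb hH; have [b' [b'P b'b _]] := Pn bP.
case: (boolP (y - b' \in H b)) => yb'; last by have [e [_ _ hc _ _]] := str bP b'P b'b; apply: hc.
by have e := N1 bP b'P b'b (sgD (Hg b) hH yb'); inz e.
Qed.

(** Walk from b1 by h2, h1 and - h2. By [perB] the walk stays in B unless its third vertex is b2;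
    completed, it would reach h1 + b1, against [lone_b]. *)
Let cross b1 b2 h1 h2 : b1 \in P -> b2 \in P -> b2 != b1 -> h1 \in H b1 -> h1 != 0 -> h2 \in H b2 -> h2 != 0 ->
  h1 + h2 + b1 = b2.
Proof.
move=> p1 p2 n21 h1H h10 h2H h20; apply/eqP; apply: contraT => ne.
have n12 : b1 != b2 by rewrite eq_sym.
have k1 := perB p2 (PB p1) n12 h2H.
have k2 : h2 + b1 != b1 by rewrite -subr_eq0 (_ : h2 + b1 - b1 = h2) //; zmod.
have k3 := perB p1 k1 k2 h1H.
have k4 : h1 + (h2 + b1) != b2 by rewrite addrA.
have k5 := perB p2 k3 k4 (sgN (Hg b2) h2H).
have k6 : - h2 + (h1 + (h2 + b1)) - b1 = h1 by zmod.
have := lone_b p1 k5; rewrite k6 => /(_ h1H) e; case/negP: h10.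
by rewrite -k6 e subrr.
Qed.

(** By [cross], two nonzero elements of a stabilizer H b are related to the same pair of points and
    hence coincide, so H b has order 2; the same identity shows that c does not depend on b. *)
Let common : exists c, [/\ c \in C, c \notin B & forall b, b \in P ->
  [/\ c != b, (c - b) + (c - b) = 0, c - b \in H b & forall h, h \in H b -> h != 0 -> h = c - b]].
Proof.
have [b0 b0P] := Pnonempty; have [_ [c [cC cb hc]]] := c4 b0P.
have cb' : c - b0 != 0 by rewrite subr_eq0.
have oth b : b \in P -> b != b0 -> forall h, h \in H b -> h != 0 -> h = c - b /\ h + h = 0.
  move=> bP bb0 h hH h0; have e1 := cross b0P bP bb0 hc cb' hH h0.
  have hN : - h != 0 by rewrite oppr_eq0.
  have e2 := cross b0P bP bb0 hc cb' (sgN (Hg b) hH) hN.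
  have hh : h + h = 0.
    have : c - b0 + h + b0 - (c - b0 + - h + b0) = h + h by zmod.
    by rewrite e1 e2 subrr.
  split=> //; rewrite -e1; have : c - (c - b0 + h + b0) = h - (h + h) by zmod.
  by rewrite hh subr0.
have [b1 [b1P b10 _]] := Pn b0P; have [h1 h1H h10] := Hne b1P.
have b01 : b0 != b1 by rewrite eq_sym.
have [eh1 hh1] := oth _ b1P b10 _ h1H h10.
have self h : h \in H b0 -> h != 0 -> h = c - b0.
  move=> hH h0; have e1 := cross b0P b1P b10 hH h0 h1H h10; have e2 := cross b0P b1P b10 hc cb' h1H h10.
  have : h + h1 + b0 - (c - b0 + h1 + b0) = h - (c - b0) by zmod.
  by rewrite e1 e2 subrr => /esym/eqP; rewrite subr_eq0 => /eqP.
exists c; split=> //.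
  by apply/negP=> cB'; case/negP: cb; apply/eqP; apply: (lone_b b0P).
move=> b bP; case: (eqVneq b b0) => [->|bb0].
  split=> //; have := self _ (sgN (Hg b0) hc); rewrite oppr_eq0 => /(_ cb') e.
  by rewrite -{1}e addNr.
have [h hH h0] := Hne bP; have [e1 e2] := oth b bP bb0 h hH h0; rewrite -e1.
split=> //; first by rewrite -subr_eq0 -e1.
by move=> h' h'H h'0; rewrite e1; case: (oth b bP bb0 h' h'H h'0).
Qed.

(** With H b = {0, h}, Kneser's theorem for X, B \ b and C with b adjoined leaves a single hole. X
    is not h-periodic, since otherwise E would be, so the hole is in X and C with b adjoined is
    periodic. *)
Let Xhole c b : (forall b, b \in P -> [/\ c != b, (c - b) + (c - b) = 0, c - b \in H b & forall h, h \in H b -> h != 0 -> h = c - b]) ->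
  c \in C -> b \in P ->
  exists x, [/\ x \in X, c - b + x \notin X, (forall y, y \in X -> y != x -> c - b + y \in X) &
   [/\ (forall d, d \in C -> d != c -> c - b + d \in C), c - b + (x + c) \notin E &
       forall u, u \in E -> u != x + c -> c - b + u \in E]].
Proof.
move=> hc cC bP; have [cb hh hH hu] := hc b bP; set h := c - b in hh hH hu *.
have h0 : h != 0 by rewrite subr_eq0.
have [b' [b'P b'b b'B]] := Pn bP; have [e [eE un _ hd _]] := str bP b'P b'b.
have bB := PB bP; have bC := PC bP; have G1 := Hg b.
have he : h + e \notin E.
  apply/negP=> k; have k2 := perB bP (PB b'P) b'b (sgN G1 hH).
  have k3 : - h + b' != b by apply: contraTneq hH => e3; apply/negP=> hH';
     have := lone_b bP (PB b'P); rewrite -{1}e3 (_ : b' - (- h + b') = h) ?hH' //; [move=> /(_ isT) e4; rewrite e4 eqxx in b'b|zmod].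
  have k4 : - h + b' + (h + e) = b' + e by zmod.
  have k5 := un _ _ k2 k3 k k4.
  by case/negP: h0; have : b' - (- h + b') = h by [zmod]; rewrite k5 subrr => <-.
have hE u : u \in E -> u != e -> h + u \in E.
  move=> uE ue; case: (boolP (u - e \in H b)) => k; last exact: hd.
  have := hu _ k; rewrite subr_eq0 => /(_ ue) k2; case/negP: he; rewrite -k2; inz uE.
have [eW _] := c4 bP.
have ne2 : nonempty [:: B `\ b; b |` C].
  move=> D; rewrite !inE => /orP[] /eqP-> //; by apply/fset0Pn; exists b; rewrite !inE eqxx.
have eW' : ssum X [:: B `\ b; b |` C] = Wb b by rewrite eW !ssum_cons ssum_nil -sumsetA.
have := kneser_list X0 ne2; rewrite eW' -/(H b) !big_cons big_nil addn0 /= => kn.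
have cH : (#|` H b| <= 2)%N.
  have -> : H b = [fset 0; h].
    apply/fsetP=> g; rewrite in_fset2; apply/idP/orP => [gH|[/eqP->|/eqP->]] //; last exact: sg0.
    by case: (eqVneq g 0) => g0; [left|right; apply/eqP/hu].
  by rewrite cardfs2; case: (_ != _).
have m1 := card_cl_ge G1 (B `\ b); have m2 := cW bP; have m3 := caseN.
have m4 : #|` b |` C| = #|` C|.+1 by rewrite cardfsU1 bC.
have m5 := card_cl_ge G1 (b |` C); have m6 := card_cl_ge G1 X.
have nX : exists2 x, x \in X & h + x \notin X.
  apply: NNPP => no; case/negP: he; have [y [d [yX dC ->]]] := sumsetP _ _ _ eE.
  rewrite addrA mem_sumset //; apply: contraT => n; by case: no; exists y.
have [x xX hx] := nX.
have xS : h + x |` X `<=` sumset X (H b).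
  rewrite fsubUset fsub1set sub_cl // andbT; apply/in_cl; exists x => //.
  by rewrite (_ : h + x - x = h) //; zmod.
have m7 : (#|` X| + 1 <= #|` sumset X (H b)|)%N by have := fsubset_leq_card xS; rewrite cardfsU1 hx; clear; nlia.
have pC : per (H b) (b |` C).
  by apply: per_cl_eq => //; move: kn cH m1 m2 m3 m4 m7; rewrite -/(H b); clear; nlia.
have eX : sumset X (H b) = h + x |` X.
  apply/esym/eqP; rewrite eqEfcard xS cardfsU1 hx; move: kn cH m1 m2 m3 m4 m5; rewrite -/(H b); clear; nlia.
have hX y : y \in X -> y != x -> h + y \in X.
  move=> yX yx; have : h + y \in sumset X (H b).
    by apply/in_cl; exists y => //; rewrite (_ : h + y - y = h) //; zmod.
  rewrite eX in_fsetU in_fset1 => /orP[/eqP/addrI e'|//]; by rewrite e' eqxx in yx.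
have hC d : d \in C -> d != c -> h + d \in C.
  move=> dC dc; have : h + d \in b |` C by apply: pC => //; rewrite in_fsetU dC orbT.
  rewrite in_fsetU in_fset1 => /orP[/eqP e'|//]; case/negP: dc.
  have : d = b + h - (h + h) by rewrite -e'; zmod.
  by rewrite hh subr0 /h => ->; apply/eqP; zmod.
have ex : e = x + c.
  have [y [d [yX dC ee]]] := sumsetP _ _ _ eE.
  case: (eqVneq y x) => yx; last by case/negP: he; rewrite ee addrA mem_sumset // hX.
  case: (eqVneq d c) => dc; last by case/negP: he; rewrite ee addrCA mem_sumset // hC.
  by rewrite ee yx dc.
exists x; split=> //; split=> //; first by rewrite -ex.
by move=> u uE; rewrite -ex; apply: hE.
Qed.

(** K collects the nonzero elements of all the H b, and x is the point at which X fails to be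
    K-periodic. *)
Lemma pair_structure : exists c x K, [/\ [/\ is_subgroup K, #|` K| = 4%N, (forall h, h \in K -> h + h = 0), x \in X & c \in C],
  [/\ c \notin B, C = c |` (B `&` C), forall d, (d \in B `\` C) = (d - c \in K) && (d != c) & per K (B `&` C)],
  (forall h y, h \in K -> y \in X -> y != x -> h + y \in X) /\ (forall h, h \in K -> h != 0 -> h + x \notin X),
  (#|` sumset X (sumset B C)| + 2 = #|` X| + #|` B| + #|` C|)%N & x + (c + c) \notin sumset X (sumset B C)].
Proof.
have [c [cC cB' hc]] := common.
have sumb b1 b2 : b1 \in P -> b2 \in P -> b2 != b1 -> c - b1 + (c - b2) + b1 = b2.
  move=> p1 p2 n21; have [q1 q1' q1H _] := hc b1 p1; have [q2 q2' q2H _] := hc b2 p2.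
  by apply: cross; rewrite ?subr_eq0.
have yP b1 b2 : b1 \in P -> b2 \in P -> b2 != b1 -> c - b2 + b1 \in P.
  move=> p1 p2 n21; have n12 : b1 != b2 by rewrite eq_sym.
  have [q1 q1' q1H _] := hc b1 p1; have [q2 q2' q2H _] := hc b2 p2.
  rewrite PP (perB p2 (PB p1) n12 q2H) /=; apply/negP=> yC.
  have [x [_ _ _ [hC _ _]]] := Xhole hc cC p1.
  have yc : c - b2 + b1 != c.
    by rewrite -subr_eq0 (_ : c - b2 + b1 - c = b1 - b2) ?subr_eq0 //; zmod.
  by have := hC _ yC yc; rewrite addrA sumb // (negPf (PC p2)).
have tor b : b \in P -> - (c - b) = c - b.
  by move=> bP; have [_ e _ _] := hc b bP; apply: (addrI (c - b)); rewrite e subrr.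
have [b0 b0P] := Pnonempty; have [x [xX x0n hX0 [hC0 e0n hE0]]] := Xhole hc cC b0P.
have eE : x + c \in E by apply: mem_sumset.
(* Translating u by c - b1 and c - b2 rewrites b1 + u as b2 + v. If x1 and x2 differed, the
   exceptional points would not prevent this, or b1 + u would be a sum with c - b2 + b1; so every u
   would give a point of Wb b1, against [outW]. *)
have same b1 b2 x1 x2 : b1 \in P -> b2 \in P -> b2 != b1 -> x1 \in X -> x2 \in X ->
   c - b1 + (x1 + c) \notin E -> (forall u, u \in E -> u != x1 + c -> c - b1 + u \in E) ->
   c - b2 + (x2 + c) \notin E -> (forall u, u \in E -> u != x2 + c -> c - b2 + u \in E) -> x1 = x2.
  move=> p1 p2 n21 x1X x2X n1 hE1 n2 hE2; apply: (addIr c).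
  set e1 := x1 + c in n1 hE1 *; set e2 := x2 + c in n2 hE2 *.
  have e1E : e1 \in E by apply: mem_sumset. 
  have e2E : e2 \in E by apply: mem_sumset.
  have t1 := tor _ p1; have t2 := tor _ p2; have sb : c - b2 + (c - b1) + b2 = b1 by apply: sumb => //; rewrite eq_sym.
  have [q1 _ _ _] := hc b1 p1; have [q2 _ _ _] := hc b2 p2.
  have b2B := PB p2.
  apply/eqP; apply: contraT => n12.
  have k1 := hE2 _ e1E n12.
  have k1' : c - b2 + e1 != e1 by rewrite -subr_eq0 (_ : c - b2 + e1 - e1 = c - b2) ?subr_eq0 //; zmod.
  have k2 := hE1 _ k1 k1'.
  have ee : e2 = c - b1 + (c - b2 + e1).
    apply/esym/eqP; apply: contraT => n; have := hE2 _ k2 n.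
    by rewrite -{1}t2 (_ : - (c - b2) + _ = c - b1 + e1) ?(negPf n1) //; zmod.
  have [u uE un] := outW p1.
  have rep v : v \in E -> b2 + v = b1 + u -> False.
    by move=> vE ev; case/negP: un; rewrite -ev; apply: inW.
  case: (eqVneq u e1) => [eu|ue1].
    apply: False_ind; apply: (rep _ k2); rewrite eu.
    have -> : b2 + (c - b1 + (c - b2 + e1)) = c - b2 + (c - b1) + b2 + e1 by zmod.
    by rewrite sb.
  have k3 := hE1 _ uE ue1.
  case: (eqVneq (c - b1 + u) e2) => [eu|ue2]; last first.
    have k4 := hE2 _ k3 ue2; apply: False_ind; apply: (rep _ k4).
    have -> : b2 + (c - b2 + (c - b1 + u)) = c - b2 + (c - b1) + b2 + u by zmod.
    by rewrite sb.
  have eu' : u = c - b2 + e1 by apply: (addrI (c - b1)); rewrite eu ee.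
  case/negP: un; have -> : b1 + u = c - b2 + b1 + e1 by rewrite eu'; zmod.
  apply: inW => //; first by apply: PB; apply: yP.
  by rewrite -subr_eq0 (_ : c - b2 + b1 - b1 = c - b2) ?subr_eq0 //; zmod.
have all_b b : b \in P -> [/\ c - b + x \notin X, (forall y, y \in X -> y != x -> c - b + y \in X) &
   [/\ (forall d, d \in C -> d != c -> c - b + d \in C), c - b + (x + c) \notin E &
       forall u, u \in E -> u != x + c -> c - b + u \in E]].
  move=> bP; case: (eqVneq b b0) => [->|bb0]; first by [].
  have [xb [xbX k1 k2 [k3 k4 k5]]] := Xhole hc cC bP.
  by rewrite (same b0 b x xb).
pose K := 0 |` [fset c - b | b in P].
have mK h : (h \in K) = (h == 0) || (c - h \in P).
  rewrite in_fsetU in_fset1; congr (_ || _); apply/imfsetP/idP => [[b /= bP ->]|hP].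
    by rewrite (_ : c - (c - b) = b) //; zmod.
  by exists (c - h) => //; zmod.
have mKb b : b \in P -> c - b \in K.
  by move=> bP; rewrite mK (_ : c - (c - b) = b) ?bP ?orbT //; zmod.
have KP h : h \in K -> h != 0 -> exists2 b, b \in P & h = c - b.
  by rewrite mK => /orP[->//|hP] _; exists (c - h) => //; zmod.
have torK h : h \in K -> h + h = 0.
  move=> hK; case: (eqVneq h 0) => [->|h0]; first by rewrite addr0.
  by have [b bP ->] := KP h hK h0; have [_ e _ _] := hc b bP.
have negK h : h \in K -> - h = h.
  by move=> hK; apply: (addrI h); rewrite torK // subrr.
have Kg : is_subgroup K.
  split=> [|h g hK gK]; first by rewrite mK eqxx.
  case: (eqVneq g 0) => [->|g0]; first by rewrite subr0.
  case: (eqVneq h 0) => [->|h0]; first by rewrite sub0r negK.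
  have [b1 p1 e1] := KP h hK h0; have [b2 p2 e2] := KP g gK g0.
  case: (eqVneq b2 b1) => [eb|n21]; first by rewrite e1 e2 eb subrr mK eqxx.
  rewrite mK; apply/orP; right; rewrite e1 e2 (_ : c - (c - b1 - (c - b2)) = c - b2 + b1); last by zmod.
  exact: yP.
have cK : #|` K| = #|` P|.+1.
  rewrite cardfsU1 card_fim; last by move=> b1 b2 _ _ /addrI/oppr_inj.
  suff -> : 0 \notin [fset c - b | b in P] by [].
  by apply/negP=> /imfsetP[b /= bP e]; have [cb _ _ _] := hc b bP; rewrite -subr_eq0 -e eqxx in cb.
have hXK h y : h \in K -> y \in X -> y != x -> h + y \in X.
  move=> hK yX yx; case: (eqVneq h 0) => [->|h0]; first by rewrite add0r.
  by have [b bP ->] := KP h hK h0; have [_ k _] := all_b b bP; apply: k.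
have hxK h : h \in K -> h != 0 -> h + x \notin X.
  by move=> hK h0; have [b bP ->] := KP h hK h0; have [k _ _] := all_b b bP.
have hCK h d : h \in K -> d \in C -> d != c -> h + d \in C.
  move=> hK dC dc; case: (eqVneq h 0) => [->|h0]; first by rewrite add0r.
  by have [b bP ->] := KP h hK h0; have [_ _ [k _ _]] := all_b b bP; apply: k.
have hBK b d : b \in P -> d \in B -> d != b -> c - b + d \in B.
  by move=> bP dB db; have [_ _ k _] := hc b bP; apply: perB bP dB db k.
have pR : per K ((C `\` B) `\ c).
  move=> h d hK; rewrite !in_fsetD1 !in_fsetD => /and3P[dc dB dC].
  case: (eqVneq h 0) => [->|h0]; first by rewrite add0r dc dB.
  have [b bP e] := KP h hK h0; rewrite hCK // andbT; apply/andP; split.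
    apply: contraTneq dC => e2; have -> : d = b by rewrite -[d](addKr h) e2 e; zmod.
    exact: PC.
  apply: contra dB => hB; have eb : h + d != b.
    apply: contra dc => /eqP e2; apply/eqP; rewrite -[d](addKr h) e2 negK // e; zmod.
  have := hBK b _ bP hB eb; rewrite -e addrA torK // add0r //.
have [q eq] := card_per Kg pR.
have i1 := cardfsDI B C; have i2 := cardfsDI C B; rewrite fsetIC in i2.
have i3 := cardfsD1 c (C `\` B); rewrite in_fsetD cC cB' /= in i3.
(* The size is a multiple of |K| = |P| + 1, yet C \ B has at most |P| - 2 elements. *)
have q0 : q = 0%N.
  case: (q) eq => // q' eq; have : (#|` K| <= #|` (C `\` B) `\ c|)%N by rewrite eq mulSn leq_addr.
  by move: i1 i2 i3 cK hBC; rewrite -/P; clear; nlia.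
rewrite q0 mul0n in eq; rewrite eq in i3.
have cC' d : d \in C -> d != c -> d \in B.
  move=> dC dc; apply: contraT => dB; move/eqP: eq; rewrite cardfs_eq0 => /eqP/fsetP/(_ d).
  by rewrite in_fsetD1 in_fsetD dB dC dc in_fset0.
have uniqE b u : b \in P -> u \in E -> b + u \notin Wb b -> u = x + c.
  move=> bP uE un; apply/eqP; apply: contraT => ue.
  have [_ _ [_ ne hE]] := all_b b bP; have [b' [b'P b'b _]] := Pn bP.
  have [_ _ [_ _ hE']] := all_b b' b'P; have k1 := hE u uE ue.
  case: (eqVneq (c - b + u) (x + c)) => [e|n].
    by case/negP: ne; rewrite -e -{1}(tor b bP) addKr.
  have k2 := hE' _ k1 n; case/negP: un; have := inW (PB b'P) b'b k2.
  have -> : b' + (c - b' + (c - b + u)) = c - b' + (c - b) + b' + u by zmod.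
  by rewrite sumb // eq_sym.
have cWt : (#|` sumset B E| + 2 = #|` X| + #|` B| + #|` C|)%N.
  have sub : sumset B E `<=` (b0 + (x + c)) |` Wb b0.
    apply/fsubsetP=> z /sumsetP[y [u [yB uE ->]]]; rewrite in_fsetU in_fset1.
    case: (eqVneq y b0) => [->|yb]; last by rewrite inW ?orbT.
    by case: (boolP (b0 + u \in Wb b0)) => n; rewrite ?orbT // (uniqE b0 u) ?eqxx.
  have := fsubset_leq_card sub; rewrite cardfsU1; have := wb b0P; have := hW; rewrite WE.
  by case: (_ \notin _); clear; nlia.
have zW : x + (c + c) \notin sumset B E.
  have [u uE un] := outW b0P; have eu := uniqE _ _ b0P uE un; rewrite eu in un.
  have [cb0 _ hH _] := hc b0 b0P.
  have zn : x + (c + c) \notin Wb b0.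
    by apply: contra un => h; have e := pW (sgN (Hg b0) hH) h; inz e.
  apply/negP=> /sumsetP[y [v [yB vE ez]]].
  case: (eqVneq y b0) => [ey|yb]; last by case/negP: zn; rewrite ez; apply: inW.
  have e6 : b0 + v = x + (c + c) by rewrite ez ey.
  have vn : b0 + v \notin Wb b0 by rewrite e6.
  have ev := uniqE _ _ b0P vE vn; case/negP: cb0; apply/eqP; apply: (addIr (x + c)).
  have -> : c + (x + c) = x + (c + c) by zmod.
  by rewrite ez ey ev.
(* With |P| >= 4 one has |B| >= |C| + 3, so moving b0 and b1 together lowers the squares. No sum is
   lost: y = c - b1 + b0 stays in B and replaces b0 or b1 after a shift by an element of K. *)
have k4 : (#|` K| <= 4)%N.
  rewrite leqNgt; apply/negP=> k5.
  have [b1 [p1 n10 _]] := third b0 b0.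
  have yb0 : c - b1 + b0 \in P by apply: yP.
  set y := c - b1 + b0 in yb0.
  have [t0 t1] := (tor b0 b0P, tor b1 p1); have n01 : b0 != b1 by rewrite eq_sym.
  have [c0 _ _ _] := hc b0 b0P; have [c1 _ _ _] := hc b1 p1.
  have y' : y = c - b0 + b1.
    have : c - b0 + (c - b0 + (c - b1) + b0) = (c - b0) + (c - b0) + (c - b1 + b0) by zmod.
    by rewrite sumb // torK ?mKb // add0r.
  have yn0 : y != b0 by rewrite -subr_eq0 (_ : y - b0 = c - b1) ?subr_eq0 // /y; zmod.
  have yn1 : y != b1 by rewrite -subr_eq0 (_ : y - b1 = c - b0) ?subr_eq0 // y'; zmod.
  have yB' : y \in (B `\ b0) `\ b1 by rewrite !in_fsetD1 yn0 yn1 PB.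
  have CC d : d \in C -> d \in b0 |` (b1 |` C) by move=> dC; rewrite !in_fsetU dC !orbT.
  have swap b b' : b \in P -> b' \in b0 |` (b1 |` C) -> b' \in P -> y = c - b' + b -> forall x1 d, x1 \in X -> d \in C ->
     x1 + (b + d) \in sumset X (sumset ((B `\ b0) `\ b1) (b0 |` (b1 |` C))).
    move=> bP b'C b'P ey x1 d x1X dC; have t := negK _ (mKb _ b'P).
    case: (eqVneq d c) => [->|dc]; last first.
      have := mem_sumset x1X (mem_sumset yB' (CC _ (hCK _ _ (mKb _ b'P) dC dc))).
      by rewrite ey -{2}t (_ : _ + _ = x1 + (b + d)) //; zmod.
    case: (eqVneq x1 x) => [->|x1x].
      have := mem_sumset xX (mem_sumset yB' b'C).
      by rewrite ey (_ : x + _ = x + (b + c)) //; zmod.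
    have := mem_sumset (hXK _ _ (mKb _ b'P) x1X x1x) (mem_sumset yB' (CC _ cC)).
    by rewrite ey -{1}t (_ : _ + _ = x1 + (b + c)) //; zmod.
  have sub : sumset X (sumset B C) `<=` sumset X (sumset ((B `\ b0) `\ b1) (b0 |` (b1 |` C))).
    apply/fsubsetP=> z /sumsetP[x1 [_ [x1X /sumsetP[b [d [bB dC ->]]] ->]]].
    case: (eqVneq b b0) => [->|nb0].
      by apply: (swap b0 b1); rewrite // !in_fsetU !in_fset1 eqxx orbT.
    case: (eqVneq b b1) => [->|nb1].
      by apply: (swap b1 b0); rewrite // !in_fsetU !in_fset1 eqxx.
    by rewrite !mem_sumset ?CC // !in_fsetD1 nb0 nb1.
  have b0C := PC b0P; have b1C := PC p1; have b0B := PB b0P; have b1B := PB p1.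
  have ne1 : (B `\ b0) `\ b1 != fset0 by apply/fset0Pn; exists y.
  have ne2 : b0 |` (b1 |` C) != fset0 by apply/fset0Pn; exists c; apply: CC.
  have ec w : cnt w [:: (B `\ b0) `\ b1; b0 |` (b1 |` C)] = cnt w [:: B; C].
    rewrite /= !in_fsetD1 !in_fsetU !in_fset1.
    case: (eqVneq w b0) => [->|_] /=; first by rewrite n01 b0B (negPf b0C).
    by case: (eqVneq w b1) => [->|_] //=; rewrite b1B (negPf b1C).
  have big : (#|` X| + #|` B| + #|` C| <= #|` sumset X (sumset ((B `\ b0) `\ b1) (b0 |` (b1 |` C)))| + 2)%N.
    by apply: leq_trans hW _; rewrite leq_add2r fsubset_leq_card.
  have := hmin ne1 ne2 ec big; rewrite !sum_squares2 !cardfsU1 !in_fsetU !in_fset1 (negPf n01) (negPf b0C) (negPf b1C) /=.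
  have := cardfsD1 b0 B; have := cardfsD1 b1 (B `\ b0); rewrite !in_fsetD1 n10 b0B b1B.
  by move: i1 i2 i3 cK k5; rewrite -/P; clear; nlia.
exists c, x, K; split=> //.
- by split=> //; move: k4 cK cP; clear; nlia.
- split=> //.
  + apply/fsetP=> d; rewrite in_fsetU in_fset1 in_fsetI; case: (eqVneq d c) => [->|dc] //=.
    by apply/idP/andP => [dC|[]//]; split=> //; apply: cC'.
  + move=> d; rewrite -/P (sgBC Kg) mK (_ : c - (c - d) = d); last by zmod.
    rewrite subr_eq0 (eq_sym c); case: (eqVneq d c) => [->|dc] /=; last by rewrite andbT.
    by apply/negbTE/negP=> h; have [cc _ _ _] := hc c h; rewrite eqxx in cc.
  + move=> h d hK; rewrite !in_fsetI => /andP[dB dC].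
    have dc : d != c by apply: contraTneq dB => ->.
    rewrite hCK // andbT; case: (eqVneq h 0) => [->|h0]; first by rewrite add0r.
    have [b bP ->] := KP h hK h0; apply: hBK => //; apply: contraTneq dC => ->; exact: PC.
- by rewrite WE.
- by rewrite WE.
Qed.
End PairMin.

(** * Equitable arrangements *)

Section Equitable.
Variables (G : zmodType) (X : {fset G}) (S : seq G) (n : nat) (U : {fset G} -> Prop) (H Z : pred G).
Implicit Types (A B C D Y W K L V : {fset G}) (x y z a b c g h k w p q : G) (As Bs R Q : seq {fset G}).
Hypothesis X0 : X != fset0.
Hypothesis hU : forall V V', V `<=` V' -> U V -> U V'.
Hypothesis HB : forall x y, H x -> H y -> H (x - y).
Hypothesis ZH : forall x y, Z x -> H (y - x) -> Z y.
Hypothesis h2 : forall V g, V != fset0 -> U V -> V `<=` sumset X (Sigma_n n S) -> g \in Stab V -> H g.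
Hypothesis h3 : forall As, arrangement S n As -> (#|` X| + size S <= #|` ssum X As| + n)%N -> good X S n U H Z As.

Lemma not_equitable As : ~ equitable As -> exists B C R, perm_eq As (B :: C :: R) /\ (#|` C| + 2 <= #|` B|)%N.
Proof.
move=> h; apply: NNPP => no; apply: h => B C BAs CAs; rewrite leqNgt; apply/negP=> lt; apply: no.
have [R pR] := perm_pick BAs.
have : C \in R by move: CAs; rewrite (perm_mem pR) inE => /orP[/eqP e|//]; move: lt; rewrite e ltnNge leqW.
move=> /perm_pick[R' pR']; exists B, C, R'; split; last by rewrite addn2.
by apply: (perm_trans pR); rewrite perm_cons.
Qed.

Lemma equitable_of_three As : (2 < n)%N -> theorem_at G n.-1 -> good X S n U H Z As ->
  exists Bs, good X S n U H Z Bs /\ equitable Bs.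
Proof.
move=> n2 hn g0; have [|Bs gB mB] := @exists_min _ (good X S n U H Z) (fun As => sum_squares As); first by exists As.
exists Bs; split=> //; apply: NNPP => ne; have [B [C [R [pe cBC]]]] := not_equitable ne.
have v : minimal_good X S n U H Z Bs by [].
have sB : size Bs = n by case: gB => -[].
case: R pe => [|A R] pe; first by have := perm_size pe; rewrite sB => e; rewrite e in n2.
have pe' : perm_eq Bs (A :: B :: C :: R).
  by apply: (perm_trans pe); rewrite perm_sym; apply: perm_rot3.
have v' := minimal_good_perm pe' v.
have n1 : (1 < n.-1)%N by case: (n) n2 => // -[].
apply: (not_all_small_rest X0 hU HB ZH h2 v' cBC) => B1 C1 R1 v1 c1.
case: (small_rest_or_klein X0 hU HB ZH h2 h3 n1 hn v1 c1) => // -[n3 R0 [A1 [A2 [beta [K [N [[q1 q2 q3 q4 q5] cA _ kl]]]]]]].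
subst R1; have [[a1 a2 a3] u o] := v1.1; exfalso.
have A0 : A != fset0 by apply: a2; rewrite inE eqxx.
apply: (klein_triple_False X0 A0 c1 _ q1 q2 q3 q4 q5 cA kl) => Ds d1 d2 d3 d4.
apply: v1.2; apply: h3; first by split=> [||x]; rewrite ?n3 // d3.
by rewrite -(tot_count a3) n3.
Qed.

(** By Kneser's theorem two terms of B outside C cannot both be lone modulo the stabilizer of the
    sum, so some p has a companion and, by minimality, is not redundant. Modulo the stabilizer of X
    + C all such terms are lone, and [irredundant_card_cl] makes the sum too large. *)
Lemma small_pair_False B C : minimal_good X S n U H Z [:: B; C] -> (#|` C| + 2 <= #|` B|)%N ->
  (#|` ssum X [:: B; C]| + 2 < #|` X| + #|` B| + #|` C|)%N -> False.
Proof.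
move=> v cBC lt; have gd := v.1.
have [B0 C0] : B != fset0 /\ C != fset0 by case: gd => -[_ ne _] _ _; split; apply: ne; rewrite !inE eqxx ?orbT.
pose E := sumset X C; have E0 : E != fset0 by apply: sumset_neq0.
have WE D : ssum X [:: D; C] = sumset D E by rewrite !ssum_cons ssum_nil -sumsetA sumsetCA.
have W0 : ssum X [:: B; C] != fset0 by rewrite WE; apply: sumset_neq0.
pose H0 := Stab (ssum X [:: B; C]); have H0g : is_subgroup H0 := Stab_subgroup W0.
have mvF p q : p \in B -> p \notin C -> q \in B -> q != p -> q - p \in H0 -> sumset (B `\ p) E = sumset B E -> False.
  move=> pB pC qB qp hq e; apply: (minimal_good_move hU HB ZH v pB pC cBC qB qp (good_stab X0 h2 gd hq)).
  rewrite WE -e -WE !ssum_cons; apply: ssumS; apply: sumsetSS => //; exact: fsubsetUr.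
have [p1 [p2 [pP1 pP2 p12]]] : exists x y, [/\ x \in B `\` C, y \in B `\` C & x != y].
  apply: two_of; have := cardfsDI B C; have := fsubset_leq_card (fsubsetIr B C); move: cBC; clear; nlia.
move: pP1 pP2; rewrite !in_fsetD => /andP[pC1 pB1] /andP[pC2 pB2].
have [p [pB pC nl]] : exists p, [/\ p \in B, p \notin C & ~ lone H0 B p].
  apply: NNPP => no.
  have l1 : lone H0 B p1 by apply: NNPP => h; apply: no; exists p1.
  have l2 : lone H0 B p2 by apply: NNPP => h; apply: no; exists p2.
  have := card_lone2 H0g pB1 pB2 p12 l1 l2.
  have ne : nonempty [:: B; C] by case: gd => -[].
  have := kneser_list X0 ne; rewrite -/H0 !big_cons big_nil addn0 /=.
  have := card_cl_ge H0g X; have := card_cl_ge H0g C; move: lt; clear; nlia.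
have [q [qB qp hq]] := nlone nl.
have nr : sumset (B `\ p) E <> sumset B E by apply: mvF pB pC qB qp hq.
have c1 : (#|` B| + #|` E| <= #|` sumset B E| + 1)%N.
  by rewrite leqNgt; apply/negP=> h; apply: nr; apply: redundant_of_deficit.
rewrite WE in lt; have c2 := kneser X0 C0; rewrite -/E in c2; set K := Stab E in c2.
have Kg : is_subgroup K := Stab_subgroup E0.
have pE : per K E := Stab_per E0.
have KH g : g \in K -> g \in H0.
  by rewrite /K in_Stab // => h; rewrite /H0 in_Stab // WE; apply: sub_stab_sumsetr.
have lK r : r \in B -> r \notin C -> lone K B r.
  move=> rB rC; apply: NNPP => nlr; have [s [sB sr hs]] := nlone nlr.
  apply: (mvF r s) => //; first exact: KH.
  by rewrite sumsetC (per_rem Kg pE nlr) sumsetC.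
have c3 := irredundant_card_cl Kg pE pB (lK p pB pC) nr.
have c4 := card_lone2 Kg pB1 pB2 p12 (lK _ pB1 pC1) (lK _ pB2 pC2).
have c5 := card_cl_ge Kg X; have c6 := card_cl_ge Kg C.
by move: lt c2 c3 c4 c5 c6; clear; nlia.
Qed.
End Equitable.

Lemma klein_quot (G : zmodType) (K : {fset G}) : is_subgroup K -> #|` K| = 4%N ->
  (forall h, h \in K -> h + h = 0) -> quot_is_Z2xZ2 K [fset 0].
Proof.
move=> Kg c4 tor.
have [k k0 kK] : exists2 k, k != 0 & k \in K.
  have K1 : (1 < #|` K|)%N by rewrite c4.
  by have [k h1 h2] := subgroup_nonzero Kg K1; exists k.
have [l [lK l0 lk]] : exists l, [/\ l \in K, l != 0 & l != k].
  have : (#|` [fset 0%R; k]| < #|` K|)%N by rewrite c4 cardfs2; case: (_ != _).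
  by move=> /lt_card_mem[l lK]; rewrite in_fset2 negb_or => /andP[h1 h2]; exists l.
have neg h : h \in K -> - h = h by move=> hK; apply: (addrI h); rewrite tor // subrr.
have kl0 : k + l != 0 by rewrite -(neg l lK) subr_eq0 eq_sym.
have klk : k + l != k by rewrite -subr_eq0 (_ : k + l - k = l) //; zmod.
have kll : k + l != l by rewrite -subr_eq0 (_ : k + l - l = k) //; zmod.
have eK : K = [fset x in [:: 0; k; l; k + l]].
  apply/esym/eqP; rewrite eqEfcard c4; apply/andP; split.
    apply/fsubsetP=> x; rewrite !inE => /or4P[/eqP->|/eqP->|/eqP->|]; rewrite ?sg0 //.
    by rewrite orbF => /eqP->; apply: sgD.
  rewrite card_fseq undup_id //= !inE !negb_or ![0 == _]eq_sym k0 l0 kl0 ![k == _]eq_sym lk klk ![l == _]eq_sym kll.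
  by [].
pose f x : ('Z_2 * 'Z_2)%type := if x == 0 then (0, 0) else if x == k then (1, 0) else if x == l then (0, 1) else (1, 1).
have f0 : f 0 = (0, 0) by rewrite /f eqxx.
have fk : f k = (1, 0) by rewrite /f (negPf k0) eqxx.
have fl : f l = (0, 1) by rewrite /f (negPf l0) (negPf lk) eqxx.
have fkl : f (k + l) = (1, 1) by rewrite /f (negPf kl0) (negPf klk) (negPf kll).
have Kcase x : x \in K -> [\/ x = 0, x = k, x = l | x = k + l].
  rewrite eK !inE => /or4P[/eqP->|/eqP->|/eqP->|].
  - exact: Or41.
  - exact: Or42.
  - exact: Or43.
  - by rewrite orbF => /eqP->; apply: Or44.
have tk := tor k kK; have tl := tor l lK.
have e1 : k + (k + l) = l by rewrite addrA tk add0r.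
have e2 : l + (k + l) = k by rewrite addrCA tl addr0.
have e3 : k + l + k = l by rewrite addrC.
have e4 : k + l + l = k by rewrite addrC.
have e5 : k + l + (k + l) = 0 by apply/tor/sgD.
have e6 : l + k = k + l by rewrite addrC.
exists f; split; [|split].
- move=> x y /Kcase[] -> /Kcase[] ->; rewrite ?add0r ?addr0 ?e5 ?e1 ?e2 ?e3 ?e4 ?e6 ?tk ?tl ?f0 ?fk ?fl ?fkl;
  by congr pair; apply: val_inj.
- move=> [u v]; case: (Z2_cases u) => ->; case: (Z2_cases v) => ->.
  + by exists 0; rewrite ?sg0.
  + by exists l.
  + by exists k.
  + by exists (k + l); rewrite ?sgD.
- by move=> x /Kcase[] ->; rewrite in_fset1 ?f0 ?fk ?fl ?fkl ?eqxx ?(negPf k0) ?(negPf l0) ?(negPf kl0).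
Qed.

(** * The third alternative for a pair, with trivial [L] *)

Section PairEnd.
Variables (G : zmodType) (X B C K : {fset G}) (c x : G) (S : seq G).
Implicit Types (A D Y W L V : {fset G}) (y z a b d e g h i j k l u v : G).
Hypotheses (X0 : X != fset0) (Kg : is_subgroup K) (K4 : #|` K| = 4%N) (tor : forall h, h \in K -> h + h = 0).
Hypotheses (xX : x \in X) (cC : c \in C) (cB : c \notin B).
Let I := B `&` C.
Hypotheses (eC : C = c |` I) (hP : forall d, (d \in B `\` C) = (d - c \in K) && (d != c)) (IK : per K I).
Hypothesis hX : forall h y, h \in K -> y \in X -> y != x -> h + y \in X.
Hypothesis hx : forall h, h \in K -> h != 0 -> h + x \notin X.
Let W := sumset X (sumset B C).
Hypothesis cW : (#|` W| + 2 = #|` X| + #|` B| + #|` C|)%N.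
Hypothesis zW : x + (c + c) \notin W.
Hypothesis hS : forall y, (cnt y [:: B; C] <= count_mem y S)%N.

(** The setting of the section [Quad] with trivial M, with X as V, x as beta, and the coset c + K as
    the four labels. *)
Let DS := shift c K.
Let M : {fset G} := [fset 0].
Let Mg : is_subgroup M. Proof. exact: subgroup0. Qed.
Let qK : quot_is_Z2xZ2 K M. Proof. exact: klein_quot. Qed.
Let mM g : (g \in M) = (g == 0). Proof. exact: in_fset1. Qed.
Let MK : M `<=` K. Proof. by rewrite fsub1set sg0. Qed.
Let VK h v : h \in K -> v \in X -> v - x \notin M -> h + v \in X.
Proof. by rewrite mM subr_eq0; apply: hX. Qed.
Let mDS d : (d \in DS) = (d - c \in K). Proof. by rewrite shiftP. Qed.
Let dK d e : d \in DS -> e \in DS -> d - e \in K.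
Proof. by rewrite !mDS => h1 h2; have e' := sgB Kg h1 h2; inz e'. Qed.
Let dM d e : d \in DS -> e \in DS -> d - e \in M -> d = e.
Proof. by rewrite mM subr_eq0 => _ _ /eqP. Qed.
Let cDS : c \in DS. Proof. by rewrite mDS subrr sg0. Qed.
Let dP d : d \in DS -> d != c -> d \in B /\ d \notin C.
Proof. by rewrite mDS => h1 h2; have := hP d; rewrite h1 h2 in_fsetD => /andP[]. Qed.
Let mI d : (d \in I) = (d \in B) && (d \in C). Proof. exact: in_fsetI. Qed.
Let dI d : d \in DS -> d \notin I.
Proof.
case: (eqVneq d c) => [->|dc] dD; rewrite mI ?(negPf cB) //.
by have [-> /negPf->] := dP dD dc.
Qed.
Let cDS1 d : d \in DS -> cnt d [:: B; C] = 1%N.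
Proof.
move=> dD; rewrite /=; case: (eqVneq d c) => [->|dc]; first by rewrite cC (negPf cB).
by have [-> /negPf->] := dP dD dc.
Qed.
Let BC d : (0 < cnt d [:: B; C])%N -> d \in I \/ d \in DS.
Proof.
rewrite /= mI mDS; case: (boolP (d \in B)) => dB /=.
  case: (boolP (d \in C)) => dC _; [by left|right].
  by have := hP d; rewrite in_fsetD dB dC => /esym/andP[].
case: (boolP (d \in C)) => // dC _; right; move: dC; rewrite eC in_fsetU in_fset1 mI (negPf dB) orbF => /eqP->.
by rewrite subrr sg0.
Qed.
Let cI d : d \in I -> cnt d [:: B; C] = 2%N.
Proof. by rewrite mI => /andP[] /= -> ->. Qed.
Let cD4 : #|` DS| = 4%N. Proof. by rewrite card_shift. Qed.
Let SJ := Sseq [:: B; C].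
Let sSJ d : d \in SJ -> d \in I \/ d \in DS.
Proof. by rewrite -has_pred1 has_count count_Sseq; apply: BC. Qed.
Let cSJ d : d \in DS -> (count_mem d SJ <= 1)%N.
Proof. by move=> h; rewrite count_Sseq cDS1. Qed.
Let YI y : ((y \in I).*2 + (y \in DS) <= count_mem y SJ)%N.
Proof.
rewrite count_Sseq; case: (boolP (y \in DS)) => yD; first by rewrite (negPf (dI yD)) cDS1.
by case: (boolP (y \in I)) => yI; rewrite // cI.
Qed.

Lemma four_labels e : e \in DS -> e != c -> exists k l,
  DS = [fset e; c; k; l] /\ uniq [:: e; c; k; l] /\ B = e |` (k |` (l |` I)).
Proof.
move=> eD ec; have [k [l [eDS uDS _ _]]] := four_pick cD4 eD cDS ec; exists k, l; split=> //; split=> //.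
have [kD lD] : k \in DS /\ l \in DS by rewrite eDS !inE !eqxx !orbT.
have [kc lc] : k != c /\ l != c.
  by move: uDS; rewrite /= !inE !negb_or => /and4P[_ /andP[h1 h2] _ _]; rewrite eq_sym h1 eq_sym h2.
apply/fsetP=> d; rewrite !in_fsetU !in_fset1; apply/idP/idP => [dB|].
  have d0 : (0 < cnt d [:: B; C])%N by rewrite /= dB.
  case: (BC d0) => [->|]; first by rewrite !orbT.
  rewrite eDS !inE => /orP[/orP[/orP[]|]|] /eqP ed; rewrite ed ?eqxx ?orbT //.
  by move: dB; rewrite ed (negPf cB).
case/or4P=> [/eqP->|/eqP->|/eqP->|]; [by case: (dP eD ec)|by case: (dP kD kc)|by case: (dP lD lc)|by rewrite mI => /andP[]].
Qed.

Let exI : exists i, i \in DS /\ i != c.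
Proof.
have : (#|` [fset c]| < #|` DS|)%N by rewrite cD4 cardfs1.
by move=> /lt_card_mem[i iD]; rewrite in_fset1 => ic; exists i.
Qed.

Let subI A : I `<=` A -> I `<=` sumset A M.
Proof. by rewrite /M sumset0. Qed.

Lemma Sigma_pair (T : seq G) : (forall d, d \in T -> d \in I \/ d \in DS) -> (forall d, d \in DS -> (count_mem d T <= 1)%N) ->
  sumset X (Sigma_n 2 T) `<=` W.
Proof.
move=> sT cT; have [i [iD ic]] := exI; have [k [l [eDS [uDS eB]]]] := four_labels iD ic.
apply: (Sigma_sub_31 Mg Kg qK xX (@per0 _ X) VK IK dK dM sT cT eDS uDS).
- by apply: subI; apply: fsubsetIl.
- by apply: subI; apply: fsubsetIr.
- by rewrite eB !in_fsetU !in_fset1 eqxx.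
- by rewrite eB !in_fsetU !in_fset1 eqxx orbT.
- by rewrite eB !in_fsetU !in_fset1 eqxx !orbT.
- exact: cC.
Qed.

Let WYJ : W = sumset X (Sigma_n 2 SJ).
Proof.
apply/eqP; rewrite eqEfsubset Sigma_pair // andbT.
have := @ssum_Sigma _ X [:: B; C] SJ; rewrite !ssum_cons ssum_nil -sumsetA; apply=> y.
by rewrite count_Sseq.
Qed.

Let nY : ~ per K (sumset X (Sigma_n 2 SJ)).
Proof.
rewrite -WYJ => pW; case/negP: zW; have [i [iD ic]] := exI; have [iB _] := dP iD ic.
have h := pW _ _ (dK cDS iD) (mem_sumset xX (mem_sumset iB cC)); inz h.
Qed.

Let slotW z : z \in W -> (forall h, h \in K -> h + z \in W) \/ exists2 b, b \in DS & b != c /\ z = x + b + c.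
Proof.
have h1 h b : h \in K -> b \in B -> b \in I -> h + b \in B.
  by move=> hK _ bI; have := IK hK bI; rewrite mI => /andP[].
have h2 h b : h \in K -> b \in C -> b \in I -> h + b \in C.
  by move=> hK _ bI; have := IK hK bI; rewrite mI => /andP[].
move=> zW'; have [h|[b [d [bB dC bI dI' h]]]] := pair_case VK h1 h2 zW'; first by left.
have edc : d = c by apply/eqP; move: dC dI'; rewrite eC in_fsetU in_fset1 => /orP[//|->].
right; exists b; last first.
  split; first by apply: contraTneq bB => ->.
  by move: h; rewrite mM subr_eq0 edc => /eqP.
by have [|//] : b \in I \/ b \in DS; [apply: BC; rewrite /= bB|rewrite (negPf bI)].
Qed.

(** The exceptional points force g into K. If g were nonzero, c - g would be a label in B, and g
    would carry x + (c - g) + c to the missing point x + (c + c). *)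
Lemma stab_pair g : stab W g -> g = 0.
Proof.
move=> hg; have [i [iD ic]] := exI; have [iB _] := dP iD ic.
have gN := stabN hg.
have z0 : x + (i + c) \in W by rewrite !mem_sumset.
have gK : g \in K.
  have /stabP/(_ _ z0)/slotW[h|[b bD [bc e]]] := hg.
    have h' := h _ (dK cDS iD); case/negP: zW.
    have /stabP/(_ _ h') e := gN; inz e.
  have e' := dK bD iD; have : g = b - i by rewrite -(addrK (x + (i + c)) g) e; zmod.
  by move=> ->.
apply/eqP; apply: contraT => g0; case/negP: zW.
have bD : c - g \in DS by rewrite mDS (_ : c - g - c = - g) ?sgN //; zmod.
have bc : c - g != c by rewrite -subr_eq0 (_ : c - g - c = - g) ?oppr_eq0 //; zmod.
have [bB _] := dP bD bc.
have /stabP/(_ _ (mem_sumset xX (mem_sumset bB cC))) e := hg; inz e.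
Qed.

Lemma stab_pairX g : stab X g -> g = 0.
Proof.
move=> hg; apply/eqP; apply: contraT => g0; have [i [iD ic]] := exI.
have kK := dK iD cDS; have k0 : i - c != 0 by rewrite subr_eq0.
case/negP: (hx kK k0); have /stabP/(_ _ xX) h1 := hg.
have gx : g + x != x by rewrite -subr_eq0 (_ : g + x - x = g) //; zmod.
have /stabP/(_ _ (hX kK h1 gx)) e := stabN hg; inz e.
Qed.

Lemma pair_diff : (B `|` C) `\` (B `&` C) = shift c K.
Proof.
apply/fsetP=> d; rewrite in_fsetD in_fsetU -/I -/DS.
case: (boolP (d \in DS)) => dD.
  rewrite dI //=; have := cDS1 dD; rewrite /=; by case: (d \in B); case: (d \in C).
apply/negP=> /andP[dI' h]; have : (0 < cnt d [:: B; C])%N by rewrite /=; case/orP: h => ->; case: (_ \in _).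
by case/BC => h'; [rewrite h' in dI'|rewrite h' in dD].
Qed.

Lemma pair_per : periodic K (X `\` [fset x]) /\ periodic K (B `&` C).
Proof.
split=> h hK; apply: shift_sub_eq; apply/fsubsetP=> y; rewrite shiftP => yX; last first.
  by have e := IK hK yX; inz e.
move: yX; rewrite !in_fsetD !in_fset1 => /andP[yx yX].
have e := hX hK yX yx; have e' : h + (y - h) = y by zmod.
rewrite e' in e; rewrite e andbT; case: (eqVneq h 0) => [h0|h0]; first by rewrite h0 subr0 in yx.
apply: contraTneq yX => ->; rewrite addrC; apply: hx; rewrite ?oppr_eq0 //; exact: sgN.
Qed.

(** If y is a label, it is put in both blocks, and its sum with e supplies the pair that
    [Sigma_sub_21] leaves out. Otherwise y joins c while k0 and l0 form the other block. Were this
    sum too small, it would be the one described by [stab21], with stabilizer {0, w}. Kneser's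
    theorem then fails, since w + y, w + c and w + x are new points. *)
Lemma pair_free y : (cnt y [:: B; C] < count_mem y S)%N -> y \notin I ->
  exists B' C' : {fset G}, [/\ B' != fset0 /\ C' != fset0, (forall u, (cnt u [:: B'; C'] <= count_mem u S)%N),
    #|` B'| = #|` C'|, tot [:: B'; C'] = tot [:: B; C] & (#|` W| <= #|` ssum X [:: B'; C']|)%N].
Proof.
move=> fy yI.
have cardI2 k l : k \in DS -> l \in DS -> k != l -> #|` k |` (l |` I)| = (#|` I| + 2)%N.
  by move=> kD lD kl; rewrite !cardfsU1 !in_fsetU !in_fset1 (negPf kl) (negPf (dI kD)) (negPf (dI lD)) /=; clear; nlia.
have neU z A : z |` A != fset0 by apply/fset0Pn; exists z; rewrite !inE eqxx.
have [i0 [i0D i0c]] := exI; have [k0 [l0 [e0 [u0 eB0]]]] := four_labels i0D i0c.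
have [k0D l0D] : k0 \in DS /\ l0 \in DS by rewrite e0 !inE !eqxx !orbT.
have kl0 : k0 != l0 by move: u0; rewrite /= !inE !negb_or => /and4P[_ _ ? _].
have tE : tot [:: B; C] = (#|` B| + #|` C|)%N by rewrite /tot !big_cons big_nil addn0.
have tBC : (#|` B| + #|` C| = #|` I| + #|` I| + 4)%N.
  rewrite {1}eB0 {1}eC.
  move: u0; rewrite /= !inE !negb_or => /and4P[/and3P[_ ik il] _ kl _].
  rewrite !cardfsU1 !in_fsetU !in_fset1 (negPf ik) (negPf il) (negPf kl) !(negPf (dI _)) //=; clear; nlia.
have cW' : (#|` W| = #|` X| + #|` I| + #|` I| + 2)%N by move: cW tBC; clear; nlia.
have IS u : u \in I -> (2 <= count_mem u S)%N by move=> uI; apply: leq_trans (hS u); rewrite cI.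
have DS1 u : u \in DS -> (1 <= count_mem u S)%N by move=> uD; apply: leq_trans (hS u); rewrite cDS1.
have IU k l : I `<=` k |` (l |` I) by rewrite fsetUA fsubsetUr.
case: (boolP (y \in DS)) => yD.
  have [e [eD ey]] : exists e, e \in DS /\ e != y.
    have : (#|` [fset y]| < #|` DS|)%N by rewrite cD4 cardfs1.
    by move=> /lt_card_mem[e eD]; rewrite in_fset1 => h; exists e.
  rewrite eq_sym in ey; have [p [q [_ _ eDS uDS]]] := four_pick cD4 yD eD ey.
  have qD : q \in DS by rewrite eDS !inE eqxx orbT.
  have [qy qe] : q != y /\ q != e by move: uDS; rewrite /= !inE !negb_or => /and4P[_ /andP[]].
  have yq : y != q by rewrite eq_sym.
  exists (y |` (e |` I)), (y |` (q |` I)); split.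
  - by split; apply: neU.
  - move=> u; rewrite /= !in_fsetU !in_fset1; case: (eqVneq u y) => [->|uy] /=.
      by move: fy; rewrite cDS1.
    case: (eqVneq u e) => [->|ue] /=.
      by rewrite (eq_sym e) (negPf qe) (negPf (dI eD)) /= DS1.
    case: (eqVneq u q) => [->|uq] /=; first by rewrite (negPf (dI qD)) DS1.
    by case: (boolP (u \in I)) => uI //=; apply: IS.
  - by rewrite (cardI2 y e yD eD ey) (cardI2 y q yD qD yq).
  - by rewrite tE tBC /tot !big_cons big_nil addn0 (cardI2 y e yD eD ey) (cardI2 y q yD qD yq); clear; nlia.
  - rewrite !ssum_cons ssum_nil -sumsetA WYJ; apply: fsubset_leq_card.
    have y1 : y \in y |` (e |` I) by rewrite !in_fsetU !in_fset1 eqxx.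
    have e1 : e \in y |` (e |` I) by rewrite !in_fsetU !in_fset1 eqxx orbT.
    have q2 : q \in y |` (q |` I) by rewrite !in_fsetU !in_fset1 eqxx orbT.
    have y2 : y \in y |` (q |` I) by rewrite !in_fsetU !in_fset1 eqxx.
    apply: fsubset_trans (Sigma_sub_21 Mg Kg qK xX (@per0 _ X) VK IK dK dM sSJ cSJ eDS uDS (subI (IU y e)) (subI (IU y q)) y1 e1 q2) _.
    rewrite fsubUset fsubset_refl /=; apply/fsubsetP=> z; rewrite shiftP mM subr_eq0 => /eqP->.
    have h := mem_sumset xX (mem_sumset e1 y2); inz h.
exists (k0 |` (l0 |` I)), (y |` (c |` I)).
have yc : y != c by apply: contraNneq yD => ->.
have cB2 : #|` y |` (c |` I)| = (#|` I| + 2)%N.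
  by rewrite !cardfsU1 !in_fsetU !in_fset1 (negPf yc) (negPf yI) (negPf (dI cDS)) /=; clear; nlia.
have [k0c l0c] : k0 != c /\ l0 != c.
  by move: u0; rewrite /= !inE !negb_or => /and4P[_ /andP[h1 h2] _ _]; rewrite eq_sym h1 eq_sym h2.
have subIc : I `<=` c |` I by apply: fsubsetUr.
have k1 : k0 \in k0 |` (l0 |` I) by rewrite !in_fsetU !in_fset1 eqxx.
have l1 : l0 \in k0 |` (l0 |` I) by rewrite !in_fsetU !in_fset1 eqxx orbT.
have c2 : c \in c |` I by rewrite in_fsetU in_fset1 eqxx.
split.
- by split; apply: neU.
- move=> u; rewrite /= !in_fsetU !in_fset1; case: (eqVneq u y) => [->|uy] /=.
    have /negPf-> : y != k0 by apply: contraNneq yD => ->.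
    have /negPf-> : y != l0 by apply: contraNneq yD => ->.
    by rewrite (negPf yI) /=; apply: leq_ltn_trans fy.
  case: (eqVneq u k0) => [->|uk] /=; first by rewrite (negPf k0c) (negPf (dI k0D)) DS1.
  case: (eqVneq u l0) => [->|ul] /=; first by rewrite (negPf l0c) (negPf (dI l0D)) DS1.
  case: (eqVneq u c) => [->|uc] /=; first by rewrite (negPf (dI cDS)) DS1.
  by case: (boolP (u \in I)) => uI //=; apply: IS.
- by rewrite cardI2 // cB2.
- by rewrite tE tBC /tot !big_cons big_nil addn0 cardI2 // cB2; clear; nlia.
rewrite leqNgt; apply/negP=> lt.
have := Sigma_sub_21 Mg Kg qK xX (@per0 _ X) VK IK dK dM sSJ cSJ e0 u0 (subI (IU k0 l0)) (subI subIc) k1 l1 c2.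
rewrite -WYJ => /fsubset_leq_card; rewrite cardfsU card_shift cardfs1 => h.
have {}h := leq_trans h (leq_subr _ _).
set W1 := sumset X (sumset (k0 |` (l0 |` I)) (c |` I)) in h.
have sub : W1 `<=` ssum X [:: k0 |` (l0 |` I); y |` (c |` I)].
  by rewrite !ssum_cons ssum_nil -sumsetA; do 2!apply: sumsetSS => //; apply: fsubsetUr.
have eW : ssum X [:: k0 |` (l0 |` I); y |` (c |` I)] = W1.
  by apply/esym/eqP; rewrite eqEfcard sub; move: lt h; clear; nlia.
have st := stab21 Mg Kg MK qK xX (@per0 _ X) VK IK dK dM dI sSJ cSJ nY e0 u0 YI.
rewrite -/W1 in st.
have ne2 : nonempty [:: k0 |` (l0 |` I); y |` (c |` I)].
  by move=> D; rewrite !inE => /orP[] /eqP->; apply: neU.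
have := kneser_list X0 ne2; rewrite eW !big_cons big_nil addn0 /= => kn.
have sg : is_subgroup (Stab W1) by rewrite -eW; apply/Stab_subgroup/ssum_neq0.
pose w := k0 - l0; have wK : w \in K by apply: dK.
have w0 : w != 0 by rewrite subr_eq0.
have wS : w \in Stab W1 by rewrite st /w subrr !mM eqxx orbT.
have cS : (#|` Stab W1| <= 2)%N.
  have -> : Stab W1 = [fset 0; w] by apply/fsetP=> g; rewrite st !mM subr_eq0 in_fset2.
  by rewrite cardfs2; case: (_ != _).
have shw z A : z \in A -> w + z \in sumset A (Stab W1).
  by move=> zA; apply: (per_cl sg wS); apply: (fsubsetP (sub_cl sg A)).
have q1 : (#|` X| + 1 <= #|` sumset X (Stab W1)|)%N.
  have : w + x |` X `<=` sumset X (Stab W1) by rewrite fsubUset fsub1set sub_cl // shw.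
  by move/fsubset_leq_card; rewrite cardfsU1 hx //=; clear; nlia.
have q2 := card_cl_ge sg (k0 |` (l0 |` I)); rewrite cardI2 // in q2.
have wI z : z \notin I -> w + z \notin I.
  by apply: contra => h'; have e := IK (sgN Kg wK) h'; inz e.
have wD z : z \notin DS -> w + z \notin DS.
  by apply: contra; rewrite !mDS => h'; have e := sgB Kg h' wK; inz e.
have nz z : w + z != z by rewrite -subr_eq0 (_ : w + z - z = w) //; zmod.
have q3 : (#|` I| + 4 <= #|` sumset (y |` (c |` I)) (Stab W1)|)%N.
  have : w + y |` (w + c |` (y |` (c |` I))) `<=` sumset (y |` (c |` I)) (Stab W1).
    rewrite !fsubUset !fsub1set !shw ?in_fsetU ?in_fset1 ?eqxx ?orbT //=.
    have hm := fsubsetP (sub_cl sg (y |` (c |` I))).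
    rewrite !hm ?in_fsetU ?in_fset1 ?eqxx ?orbT //=.
    by apply: fsubset_trans (sub_cl sg _); rewrite fsetUA fsubsetUr.
  move/fsubset_leq_card; rewrite (cardfsU1 (w + y)) (cardfsU1 (w + c)) cB2.
  have cwD : w + c \in DS by rewrite mDS (_ : w + c - c = w) //; zmod.
  have n1 : w + c != y by apply: contraNneq yD => <-.
  have n2 : w + y != c by apply: contraNneq (wD _ yD) => ->.
  have n3 : w + y != w + c by rewrite (inj_eq (addrI w)).
  rewrite !in_fsetU !in_fset1 (negPf n1) (negPf n2) (negPf n3) !(negPf (nz _)) (negPf (wI _ yI)) (negPf (wI _ (dI cDS))) /=.
  by clear; nlia.
by move: kn cS q1 q2 q3 cW' lt; rewrite eW; clear; nlia.
Qed.
End PairEnd.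

(** * The theorem for the trivial subgroup *)

Section TrivialSubgroup.
Variable G : zmodType.
Implicit Types (A B C D X Y W K H L V : {fset G}) (x y z a b c g h k : G) (As Bs R : seq {fset G}) (S : seq G).

Lemma arrangement_cand S n m As Bs : partition_in n S m As -> arrangement (Sseq As) n Bs -> partition_in n S m Bs.
Proof.
move=> [s1 s2 s3 <-] [b1 b2 b3]; split=> //.
  by move=> x; rewrite b3 count_Sseq.
by rewrite (tot_count b3) size_Sseq.
Qed.

Lemma equitable2 B C : #|` B| = #|` C| -> equitable [:: B; C].
Proof. by move=> e D E; rewrite !inE => /orP[]/eqP-> /orP[]/eqP->; rewrite ?e. Qed.

Lemma equitable_step X S n U (H Z : pred G) As : X != fset0 -> (0 < n)%N -> ((2 < n)%N -> theorem_at G n.-1) ->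
  (forall V V', V `<=` V' -> U V -> U V') ->
  (forall x y, H x -> H y -> H (x - y)) -> (forall x y, Z x -> H (y - x) -> Z y) ->
  (forall V g, V != fset0 -> U V -> V `<=` sumset X (Sigma_n n S) -> g \in Stab V -> H g) ->
  (forall As, arrangement S n As -> (#|` X| + size S <= #|` ssum X As| + n)%N -> good X S n U H Z As) ->
  good X S n U H Z As ->
  (exists Bs, good X S n U H Z Bs /\ equitable Bs) \/
  (n = 2%N /\ exists B C, minimal_good X S n U H Z [:: B; C] /\ (#|` C| + 2 <= #|` B|)%N).
Proof.
move=> X0 n0 hn hU HB ZH h2 h3 g.
case: (ltnP 2 n) => n2; first by left; apply: equitable_of_three (hn n2) g.
have [|Bs gB mB] := @exists_min _ (good X S n U H Z) (fun As => sum_squares As); first by exists As.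
case: (classic (equitable Bs)) => e; first by left; exists Bs.
have sB : size Bs = n by case: gB => -[].
have [B [C [R [pe cBC]]]] := not_equitable e.
have sR := perm_size pe; rewrite sB /= in sR.
have n2' : n = 2%N by move: sR n2; clear; nlia.
right; split=> //; exists B, C; split=> //.
case: R pe sR => [|D R] pe sR; last by rewrite n2' in sR.
by apply: minimal_good_perm pe _.
Qed.

(** Here [U] asks to contain W = X + Sigma_n(S), so a good sum is W itself and has stabilizer H. As
    W is small, no arrangement is large, and an unbalanced pair is excluded by
    [small_pair_False]. *)
Lemma trivial_structure X S n m As : X != fset0 -> (0 < n)%N -> ((2 < n)%N -> theorem_at G n.-1) -> partition_in n S m As ->
  let H := Stab (ssum X As) in let Z := fun x => all (fun A => x \in sumset A H) As in
  (#|` ssum X As| + n < #|` X| + m)%N -> (forall x, cnt x As < count_mem x S -> Z x)%N ->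
  (forall A, A \in As -> forall x y, x \in A -> y \in A -> ~~ Z x -> ~~ Z y -> x = y) ->
  exists Bs, [/\ partition_in n S m Bs, equitable Bs, sumset X (Sigma_n n S) = ssum X Bs &
    let Z' := fun x => all (fun A => x \in sumset A (Stab (ssum X Bs))) Bs in
    (forall x, cnt x Bs < count_mem x S -> Z' x)%N /\
    (forall A, A \in Bs -> forall x y, x \in A -> y \in A -> ~~ Z' x -> ~~ Z' y -> x = y)].
Proof.
move=> X0 n0 hn cA H Z lt hf huniq; have [sA neA hc tA] := cA.
have W0 : ssum X As != fset0 by apply: ssum_neq0.
have Hg : is_subgroup H by apply: Stab_subgroup.
have okZ A : A \in As -> (forall z, Z z -> exists2 a : G, a \in A & z - a \in H) /\
  (forall x y, x \in A -> y \in A -> ~~ Z x -> ~~ Z y -> x = y).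
  move=> AAs; split; last exact: huniq.
  by move=> z /allP/(_ A AAs)/in_cl[a aA ha]; exists a.
have YW : sumset X (Sigma_n n S) = ssum X As.
  apply/eqP; rewrite eqEfsubset -sA ssum_Sigma // andbT.
  apply: (Sigma_ssum Hg (fsubset_refl _) W0 (Z := Z)) => // x.
  by case: (leqP (count_mem x S) (cnt x As)) => [|/hf]; [left|right].
have YW0 : sumset X (Sigma_n n (Sseq As)) `<=` ssum X As.
  rewrite -{1}sA; apply: (Sigma_ssum Hg (fsubset_refl _) W0 (Z := Z)) => // x.
  by rewrite count_Sseq; left.
pose U V := ssum X As `<=` V.
have hU V V' : V `<=` V' -> U V -> U V' by move=> h1 h2; apply: fsubset_trans h2 h1.
have HB x y : x \in H -> y \in H -> x - y \in H by apply: sgB.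
have ZH x y : Z x -> y - x \in H -> Z y.
  move=> /allP Zx hy; apply/allP=> A /Zx h; rewrite (per_mem Hg _ hy) //; exact: per_cl.
have h2 V g : V != fset0 -> U V -> V `<=` sumset X (Sigma_n n (Sseq As)) -> g \in Stab V -> g \in H.
  move=> V0 UV VY; suff -> : V = ssum X As by [].
  by apply/eqP; rewrite eqEfsubset; apply/andP; split; [apply: fsubset_trans VY _|].
have h3 Bs : arrangement (Sseq As) n Bs -> (#|` X| + size (Sseq As) <= #|` ssum X Bs| + n)%N ->
    good X (Sseq As) n U (mem H) Z Bs.
  move=> [b1 b2 b3]; rewrite size_Sseq tA => le; exfalso.
  have /fsubset_leq_card : ssum X Bs `<=` ssum X As.
    by apply: fsubset_trans YW0; rewrite -b1; apply: ssum_Sigma => x; rewrite b3.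
  by move: le lt; clear; nlia.
have gA : good X (Sseq As) n U (mem H) Z As.
  split; [by split=> // x; rewrite count_Sseq|exact: fsubset_refl|].
  move=> A /okZ[o1 o2]; split=> // z /o1[a aA ha]; exists a => //=; by rewrite sgBC.
have fin Bs : good X (Sseq As) n U (mem H) Z Bs -> equitable Bs ->
  exists Bs, [/\ partition_in n S m Bs, equitable Bs, sumset X (Sigma_n n S) = ssum X Bs &
    let Z' := fun x => all (fun A => x \in sumset A (Stab (ssum X Bs))) Bs in
    (forall x, cnt x Bs < count_mem x S -> Z' x)%N /\
    (forall A, A \in Bs -> forall x y, x \in A -> y \in A -> ~~ Z' x -> ~~ Z' y -> x = y)].
  move=> [a u o] e; have cB := arrangement_cand cA a; have [b1 b2 b3 b4] := cB.
  have eW : ssum X Bs = ssum X As.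
    by apply/eqP; rewrite eqEfsubset; apply/andP; split; rewrite // -YW -b1; apply: ssum_Sigma.
  exists Bs; split; rewrite ?eW //.
  have ZZ x : Z x -> all (fun A => x \in sumset A (Stab (ssum X As))) Bs.
    move=> Zx; apply/allP=> B BBs; have [/(_ x Zx)[b bB hb] _] := o B BBs.
    by apply/in_cl; exists b; rewrite // -/H sgBC.
  split=> [x lx|A ABs x y xA yA nx ny].
    by apply/ZZ/hf; case: a => _ _ h; rewrite h count_Sseq in lx.
  by have [_ h] := o A ABs; apply: h => //; [apply: contra nx|apply: contra ny]; apply: ZZ.
have [[Bs [g e]]|[n2 [B [C [v cBC]]]]] := equitable_step X0 n0 hn hU HB ZH h2 h3 gA; first exact: fin g e.
exfalso; apply: (small_pair_False X0 hU HB ZH h2 v cBC).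
have [[b1 b2 b3] u o] := v.1.
have := tot_count b3; rewrite size_Sseq tA /tot !big_cons big_nil addn0 => eBC.
have /fsubset_leq_card : ssum X [:: B; C] `<=` ssum X As.
  by apply: fsubset_trans YW0; rewrite -b1; apply: ssum_Sigma => x; rewrite b3.
by move: lt eBC; rewrite n2; clear; nlia.
Qed.

Lemma trivial_large X S n m As : X != fset0 -> (0 < n)%N -> ((2 < n)%N -> theorem_at G n.-1) -> partition_in n S m As ->
  (#|` X| + m <= #|` ssum X As| + n)%N ->
  exists Bs, partition_in n S m Bs /\ ((equitable Bs /\ (#|` X| + m <= #|` ssum X Bs| + n)%N) \/
   n = 2%N /\ exists A1 A2 beta K g, Bs = [:: A1; A2] /\
    [/\ [/\ beta \in X, is_subgroup K & quot_is_Z2xZ2 K [fset 0]],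
        periodic K (X `\ beta) /\ periodic K (A1 `&` A2),
        forall x, (cnt x Bs < count_mem x S)%N -> x \in A1 `&` A2,
        (A1 `|` A2) `\` (A1 `&` A2) = shift g K &
        [/\ sumset X (Sigma_n n S) = ssum X Bs, forall g, stab (ssum X Bs) g -> g = 0,
            forall g, stab X g -> g = 0 & (#|` ssum X Bs| + n = m + #|` X|)%N]]).
Proof.
move=> X0 n0 hn cA le; have [sA neA hc tA] := cA.
pose U V := (#|` X| + m <= #|` V| + n)%N.
have hU V V' : V `<=` V' -> U V -> U V'.
  by move=> /fsubset_leq_card h1 h2; apply: leq_trans h2 _; rewrite leq_add2r.
have h3 Bs : arrangement (Sseq As) n Bs -> (#|` X| + size (Sseq As) <= #|` ssum X Bs| + n)%N ->
    good X (Sseq As) n U predT predT Bs.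
  move=> a; rewrite size_Sseq tA => h; split=> // A ABs; split=> // z _.
  by case: a => _ /(_ A ABs)/fset0Pn[b bA] _; exists b.
have gA : good X (Sseq As) n U predT predT As.
  by apply: h3; [split=> // x; rewrite count_Sseq|rewrite size_Sseq tA].
have [[Bs [g e]]|[n2 [B [C [v cBC]]]]] := equitable_step X0 n0 hn hU (fun _ _ _ _ => erefl) (fun _ _ _ _ => erefl)
   (fun _ _ _ _ _ _ => erefl) h3 gA.
  by have [a u _] := g; exists Bs; split; [apply: arrangement_cand cA a|left].
have [a u o] := v.1; have cB := arrangement_cand cA a; have [b1 b2 b3 b4] := cB.
have WE : ssum X [:: B; C] = sumset X (sumset B C) by rewrite !ssum_cons ssum_nil sumsetA.
have eBC : (#|` B| + #|` C| = m)%N by rewrite -b4 /tot !big_cons big_nil addn0.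
have C0 : C != fset0 by apply: b2; rewrite !inE eqxx orbT.
have [||c [x [K [[Kg K4 tor xX cC] [cB' eC hP IK] [hX hx] cW zW]]]] := pair_structure X0 C0 cBC.
- by move: u; rewrite /U WE n2 -addnA eBC.
- move=> B' C' B'0 C'0 hcnt le'; apply: v.2; apply: h3.
    split=> [||y]; rewrite ?n2 //; last by rewrite hcnt; case: a.
    by move=> D; rewrite !inE => /orP[]/eqP->.
  by rewrite size_Sseq tA n2 !ssum_cons ssum_nil -sumsetA; move: le'; rewrite -addnA eBC.
case: (classic (exists2 y, (cnt y [:: B; C] < count_mem y S)%N & y \notin B `&` C)) => [[y fy yI]|no].
  have [B' [C' [[B'0 C'0] hc' cBC' tBC' leW]]] :=
    pair_free X0 Kg K4 tor xX cC cB' eC hP IK hX hx cW zW b3 fy yI.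
  exists [:: B'; C']; split.
    split=> //; last by rewrite tBC'.
    by move=> D; rewrite !inE => /orP[]/eqP->.
  by left; split; [exact: equitable2|apply: leq_trans u _; rewrite leq_add2r WE].
have free y : (cnt y [:: B; C] < count_mem y S)%N -> y \in B `&` C.
  by move=> fy; apply: contraT => yI; case: no; exists y.
have dif := pair_diff Kg cC cB' eC hP.
exists [:: B; C]; split=> //; right; split=> //; exists B, C, x, K, c; split=> //; split=> //.
- by split=> //; apply: klein_quot.
- exact: pair_per.
split.
- apply/eqP; rewrite eqEfsubset -{2}b1 ssum_Sigma // andbT n2 WE.
  apply: (Sigma_pair Kg K4 tor xX cC cB' eC hP IK hX) => d.
    rewrite -dif in_fsetD in_fsetU => dS; case: (boolP (d \in B `&` C)) => dI; [by left|right=> /=].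
    apply: contraT; rewrite negb_or => /andP[dB dC]; case/negP: dI; apply: free.
    by rewrite /= (negPf dB) (negPf dC) -has_count has_pred1.
  rewrite -dif in_fsetD => /andP[dI]; rewrite in_fsetU => h; rewrite leqNgt; apply/negP=> h1.
  case/negP: (dI); apply: free; apply: leq_trans h1; rewrite /= !ltnS.
  by move: dI; rewrite in_fsetI; case: (d \in B); case: (d \in C).
- by rewrite WE => g; apply: stab_pair Kg K4 xX cC cB' eC hP IK hX zW _.
- by move=> g; apply: (stab_pairX c Kg K4 xX hX hx).
- by rewrite WE n2 cW -addnA eBC addnC.
Qed.
End TrivialSubgroup.

(** * Passage to the quotient *)

(** [L] is packed as an additive subgroup, and [repr] is a set-theoretic section of the
    projection. *)
Lemma quotient_exists (G : zmodType) (L : {fset G}) : is_subgroup L ->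
  exists (Q : zmodType) (f : {additive G -> Q}) (s : Q -> G), cancel s f /\ forall x, (f x == 0) = (x \in L).
Proof.
move=> [L0 LB].
pose P : pred G := mem L.
have PC : zmod_closed P by split.
pose pi_mixin := GRing.isZmodClosed.Build G P PC.
pose I : zmodClosed G := HB.pack P pi_mixin.
exists (Quotient.quot I), (\pi_(Quotient.quot I))%qT, repr; split; first exact: reprK.
by move=> x; rewrite -(raddf0 (\pi_(Quotient.quot I))%qT) -Quotient.idealrBE subr0.
Qed.

Section Lift.
Variables (G Q : zmodType) (f : {additive G -> Q}) (s : Q -> G) (L : {fset G}).
Implicit Types (A B C D X Y W K : {fset G}) (x y z a b c g h k : G) (As Bs R : seq {fset G}) (S T : seq G) (q r u : Q).
Hypotheses (Lg : is_subgroup L) (sK : cancel s f) (fL : forall x, (f x == 0) = (x \in L)).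

Definition im A : {fset Q} := [fset f a | a in A].

Lemma f_eq x y : (f x == f y) = (x - y \in L).
Proof. by rewrite -fL raddfB subr_eq0. Qed.

Lemma imP A q : reflect (exists2 a, a \in A & q = f a) (q \in im A).
Proof. exact: imfsetP. Qed.

Lemma mem_im A a : a \in A -> f a \in im A.
Proof. by move=> aA; apply/imP; exists a. Qed.

Lemma in_cl_im A x : (x \in sumset A L) = (f x \in im A).
Proof.
apply/in_cl/imP => -[a aA h]; exists a => //; first by apply/eqP; rewrite f_eq.
by rewrite -f_eq h.
Qed.

Lemma in_per A x : per L A -> (x \in A) = (f x \in im A).
Proof. by move=> pA; rewrite -in_cl_im per_cl_id. Qed.

Lemma im_sumset A B : im (sumset A B) = sumset (im A) (im B).
Proof.
apply/fsetP=> q; apply/imP/sumsetP => [[_ /sumsetP[a [b [aA bB ->]]] ->]|[_ [_ [/imP[a aA ->] /imP[b bB ->] ->]]]].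
  by exists (f a), (f b); rewrite !mem_im // raddfD.
by exists (a + b); rewrite ?mem_sumset ?raddfD.
Qed.

Lemma im_ssum X As : im (ssum X As) = ssum (im X) (map im As).
Proof. by elim: As X => [|A As IH] X /=; rewrite ?ssum_nil // !ssum_cons IH im_sumset. Qed.

Lemma card_im_sep A : sep L A -> #|` im A| = #|` A|.
Proof.
by move=> h; apply: card_in_imfset => x y xA yA /eqP; rewrite f_eq; apply: h.
Qed.

Lemma card_im_per A : per L A -> #|` A| = (#|` im A| * #|` L|)%N.
Proof.
move=> pA; pose T := [fset s q | q in im A].
have sT : sep L T.
  by move=> _ _ /imfsetP[q _ ->] /imfsetP[r _ ->]; rewrite -f_eq !sK => /eqP->.
have eT : im T = im A.
  apply/fsetP=> q; apply/imP/idP => [[_ /imfsetP[r /= h ->] ->]|h]; first by rewrite sK.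
  by exists (s q); rewrite ?sK //; apply/imfsetP; exists q.
rewrite -eT card_im_sep // -card_sep //; congr (#|` _|); apply/fsetP=> x.
by rewrite in_cl_im eT; apply: in_per.
Qed.

Lemma stab_im A g : per L A -> stab A g = stab (im A) (f g).
Proof.
move=> pA; apply/stabP/stabP => [h _ /imP[a aA ->]|h a aA].
  by rewrite -raddfD mem_im ?h.
by rewrite (in_per _ pA) raddfD h ?mem_im.
Qed.

(** Over each point of [B] the earliest term of [S] with that image is taken, so that [A] has one
    element per coset; [S1] is what remains of [S]. *)
Lemma lift_set (B : {fset Q}) S : (forall q, (q \in B) <= count_mem q (map f S))%N ->
  exists A S1, [/\ im A = B, sep L A, forall x, count_mem x S = (x \in A) + count_mem x S1 &
    forall q, count_mem q (map f S) = (q \in B) + count_mem q (map f S1)]%N.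
Proof.
move=> hB; pose g q := nth 0 S (index q (map f S)).
have mB q : q \in B -> q \in map f S.
  by move=> qB; rewrite -has_pred1 has_count; apply: leq_trans (hB q); rewrite qB.
have iB q : q \in B -> (index q (map f S) < size S)%N.
  by move=> /mB; rewrite -index_mem size_map.
have fg q : q \in B -> f (g q) = q.
  by move=> qB; rewrite -(nth_map _ 0) ?nth_index ?mB ?iB.
pose A := [fset g q | q in B].
have sA : sep L A.
  move=> _ _ /imfsetP[q /= qB ->] /imfsetP[r /= rB ->]; rewrite -f_eq !fg //.
  by move=> /eqP->.
have iA : im A = B.
  apply/fsetP=> q; apply/imP/idP => [[_ /imfsetP[r /= h ->] ->]|h]; first by rewrite fg.
  by exists (g q); rewrite ?fg //; apply/imfsetP; exists q.
have AS x : (x \in A <= count_mem x S)%N.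
  case: (boolP (x \in A)) => // /imfsetP[q /= qB ->].
  by rewrite -has_count has_pred1 mem_nth ?iB.
have cA x : count_mem x (enum_fset A) = (x \in A) :> nat by rewrite count_uniq_mem ?fset_uniq.
have pS : perm_eq S (enum_fset A ++ seqdiff S (enum_fset A)).
  by apply/allP=> x _ /=; rewrite count_cat count_seqdiff cA subnKC.
exists A, (seqdiff S (enum_fset A)); split=> // [x|q].
  by rewrite (permP pS) count_cat cA.
rewrite (permP (perm_map f pS)) map_cat count_cat; congr addn.
have -> : count_mem q (map f (enum_fset A)) = (q \in map f (enum_fset A)) :> nat.
  rewrite count_uniq_mem // map_inj_in_uniq ?fset_uniq // => x y xA yA /eqP; rewrite f_eq; exact: sA.
congr nat_of_bool; rewrite -iA; apply/mapP/imP => -[a aA e]; by exists a.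
Qed.

Lemma lift_parts (Bs : seq {fset Q}) S : (forall q, cnt q Bs <= count_mem q (map f S))%N ->
  exists As, [/\ map im As = Bs, forall A, A \in As -> sep L A & forall x, cnt x As <= count_mem x S]%N.
Proof.
elim: Bs S => [|B Bs IH] S h; first by exists [::].
have [A [S1 [iA sA c1 c2]]] : exists A S1, [/\ im A = B, sep L A, forall x, count_mem x S = (x \in A) + count_mem x S1 &
    forall q, count_mem q (map f S) = (q \in B) + count_mem q (map f S1)]%N.
  by apply: lift_set => q; apply: leq_trans (h q); apply: leq_addr.
have [|As [eA sAs c3]] := IH S1.
  by move=> q; have := h q; rewrite c2 /= leq_add2l.
exists (A :: As); split=> /= [|D|x].
- by rewrite iA eA.
- by rewrite inE => /orP[/eqP->|/sAs].
- by rewrite c1 leq_add2l.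
Qed.

Lemma count_im As x : (forall A, A \in As -> sep L A) -> cnt (f x) (map im As) = count_mem (f x) (map f (Sseq As)).
Proof.
elim: As => [|A As IH] h //; rewrite /Sseq /= map_cat count_cat IH; last by move=> B hB; apply: h; rewrite inE hB orbT.
congr addn; have sA := h A (mem_head _ _).
rewrite count_uniq_mem; last first.
  rewrite map_inj_in_uniq ?fset_uniq // => y z yA zA /eqP; rewrite f_eq; exact: sA.
by congr nat_of_bool; apply/imP/mapP => -[a aA e]; exists a.
Qed.

Lemma free_im As S x : (forall A, A \in As -> sep L A) -> (forall y, cnt y As <= count_mem y S)%N ->
  (cnt x As < count_mem x S)%N -> (cnt (f x) (map im As) < count_mem (f x) (map f S))%N.
Proof.
move=> hs hc hx; rewrite count_im // !count_map.
have /count_subseqP[T sT pT] : forall y, (count_mem y (x :: Sseq As) <= count_mem y S)%N.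
  by move=> y /=; rewrite count_Sseq; case: eqVneq => [<-|_]; rewrite ?add1n ?add0n.
have := leq_count_subseq (preim f (pred1 (f x))) sT; rewrite -(permP pT) /= eqxx; apply.
Qed.

Lemma im_Sigma n S : im (Sigma_n n S) = Sigma_n n (map f S).
Proof.
have fs T : f (sigma T) = sigma (map f T) by rewrite /sigma raddf_sum big_map.
apply/fsetP=> q; apply/imP/SigmaP => [[_ /SigmaP[T [sT zT ->]] ->]|[T [/count_subseqP[T1 sT pT] zT ->]]].
  exists (map f T); rewrite size_map -fs; split=> //.
  have /count_subseqP[T1 h pT] := sT => r; rewrite (permP (perm_map f pT)).
  by apply/leq_count_subseq/map_subseq.
have [m sm eT] := subseqP sT; rewrite size_map in sm.
exists (sigma (mask m S)); last by rewrite fs map_mask -eT /sigma (perm_big _ pT).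
apply/SigmaP; exists (mask m S); split=> //.
  by move=> x; apply/leq_count_subseq/mask_subseq.
by rewrite -zT (perm_size pT) eT -map_mask size_map.
Qed.

Lemma equitable_im As : (forall A, A \in As -> sep L A) -> equitable (map im As) -> equitable As.
Proof.
move=> hs e A B hA hB; have := e _ _ (map_f im hA) (map_f im hB).
by rewrite !card_im_sep //; apply: hs.
Qed.

Lemma tot_im As : (forall A, A \in As -> sep L A) -> tot (map im As) = tot As.
Proof.
by move=> hs; rewrite /tot big_map; apply: eq_big_seq => A /hs /card_im_sep.
Qed.

Lemma im0 A : im A = fset0 -> A = fset0.
Proof.
move=> h; apply/fsetP=> x; rewrite in_fset0; apply/negP=> /mem_im; by rewrite h in_fset0.
Qed.
End Lift.

(** X and the sumsets are unions of cosets of L, so their images are smaller by the factor |L| and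
    have the corresponding stabilizers. Setpartitions lift back with one element per coset. The
    image lives in another group, hence the hypothesis for all groups. *)
Lemma theorem_at_step n : (forall Q, (2 < n)%N -> theorem_at Q n.-1) -> forall G, theorem_at G n.
Proof.
move=> hn G X L S S' n0 X0 Lg LX subS /andP[hm nm].
have [Q [f [s [sK fL]]]] := quotient_exists Lg.
have pX : per L X by move=> k a kL; apply/stabP; apply: LX.
set m := size S' in nm *.
(* The bound on the multiplicities modulo L is what allows the images of the terms of S' to be dealt
   into n sets. *)
have [Es [e1 e2 e3]] : exists Es, [/\ size Es = n, nonempty Es & forall q, cnt q Es = count_mem q (map f S')].
  apply: deal; last by rewrite size_map.
  move=> q; rewrite count_map -(sK q) (eq_count (_ : _ =1 (fun y => y - s q \in L))); last first.
    by move=> y /=; rewrite (f_eq fL).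
  by move: (s q); apply/hmult_le.
have cE : partition_in n (map f S) m Es.
  split=> // [q|]; last by rewrite (tot_count e3) size_map.
  rewrite e3; have /count_subseqP[T sT pT] := subS.
  by rewrite (permP (perm_map f pT)); apply/leq_count_subseq/map_subseq.
pose iX := im f X; have iX0 : iX != fset0 by apply: contra_neq X0; apply: im0.
have cX : #|` X| = (#|` iX| * #|` L|)%N := card_im_per Lg sK fL pX.
have pW As : per L (ssum X As) by apply: per_sumset.
have pY : per L (sumset X (Sigma_n n S)) by apply: per_sumset.
have iY : im f (sumset X (Sigma_n n S)) = sumset iX (Sigma_n n (map f S)) by rewrite im_sumset im_Sigma.
have lift Bs : partition_in n (map f S) m Bs -> exists As, [/\ map (im f) As = Bs, forall A, A \in As -> sep L A,
   forall x, (cnt x As <= count_mem x S)%N & [/\ size As = n, is_setpartition As,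
        subseqm (Sseq As) S, size (Sseq As) = m & forall A, A \in As -> #|` phi_set L A| = #|` A| ]].
  move=> [b1 b2 b3 b4]; have [As [a1 a2 a3]] := lift_parts fL b3; exists As; split=> //; split.
  - by rewrite -b1 -a1 size_map.
  - move=> A hA; have : im f A != fset0 by apply: b2; rewrite -a1 map_f.
    by apply: contra_neq => ->; apply/fsetP=> q; rewrite in_fset0; apply/negP=> /imP[].
  - by move=> x; rewrite count_Sseq.
  - by rewrite size_Sseq -b4 -a1 (tot_im fL).
  - by move=> A hA; apply/(phi_sep _ Lg)/a2.
have stW As g : stab (ssum X As) g = stab (ssum iX (map (im f) As)) (f g).
  by rewrite (stab_im Lg fL) // im_ssum.
have cW As : #|` ssum X As| = (#|` ssum iX (map (im f) As)| * #|` L|)%N.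
  by rewrite (card_im_per Lg sK fL) // im_ssum.
have YW As : sumset iX (Sigma_n n (map f S)) = ssum iX (map (im f) As) -> sumset X (Sigma_n n S) = ssum X As.
  move=> h; apply/fsetP=> x; rewrite (in_per Lg fL _ pY) iY h -im_ssum.
  by apply/esym/(in_per Lg fL).
have [As0 [cA0 struct]] := large_or_structured iX0 (ex_intro _ Es cE).
case: (leqP (#|` iX| + m) (#|` ssum iX As0| + n)) => [large|small].
  have [Bs [cB out]] := trivial_large iX0 n0 (hn Q) cA0 large.
  have [As [a1 a2 a3 a4]] := lift Bs cB; have [z1 z2 z3 z4 z5] := a4.
  exists As; split=> //; case: out => [[e le]|[n2 [A1 [A2 [beta [K [g [eB [[k1 k2 k3] [k4 k5] k6 k7 [k8 k9 k10 k11]]]]]]]]]].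
    apply: Or31; rewrite -/(ssum X As); split.
    + by apply: fsubset_leq_card; rewrite -z1; apply: ssum_Sigma.
    + by rewrite -/m cX cW a1 -mulnDl leq_mul2r; apply/orP; right; move: le nm; clear; nlia.
    + by apply: (equitable_im fL) => //; rewrite a1.
  apply: Or33; split=> //.
  case: As a1 a2 a3 a4 z1 z2 z3 z4 z5 => [|B1 [|B2 [|B3 As]]] a1 a2 a3 a4 z1 z2 z3 z4 z5;
    try by move: a1; rewrite eB.
  move: a1; rewrite eB => -[i1 i2]; exists B1, B2; split=> //.
  (* K' is the preimage of K, a finite union of cosets of L. *)
  have [b bX fb] := imP _ _ _ k1; pose K' := sumset [fset s q | q in K] L.
  have mK' x : (x \in K') = (f x \in K).
    rewrite (in_cl_im fL); apply/imP/idP => [[_ /imfsetP[q /= qK ->] ->]|h]; first by rewrite sK.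
    by exists (s (f x)); rewrite ?sK //; apply/imfsetP; exists (f x).
  exists b, K' => I.
  have mI x : (x \in I) = (f x \in A1 `&` A2) by rewrite !in_fsetI !(in_cl_im fL) i1 i2.
  have pI x k : k \in K' -> (f x \in A1 `&` A2) = (f (x - k) \in A1 `&` A2).
    by rewrite mK' => /k5 e; rewrite -{1}e shiftP raddfB.
  have eY := YW [:: B1; B2]; rewrite /= i1 i2 -eB in eY; have {}eY := eY k8.
  have sW x : stab (ssum X [:: B1; B2]) x = (x \in L).
    rewrite stW /= i1 i2 -eB -fL; apply/idP/eqP => [/k9//|->]; exact: stab0.
  have sX x : stab X x = (x \in L).
    rewrite (stab_im Lg fL) // -fL; apply/idP/eqP => [/k10//|->]; exact: stab0.
  split.
  + split=> //.
    * split=> [|x y]; rewrite !mK' ?raddf0 ?raddfB; [exact: sg0|exact: sgB].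
    * by apply/fsubsetP=> x; rewrite mK' -fL => /eqP->; apply: sg0.
    * have [h [h1 [h2 h3]]] := k3; exists (fun x => h (f x)); split; [|split].
      - by move=> x y; rewrite !mK' raddfD; apply: h1.
      - by move=> v; have [q qK <-] := h2 v; exists (s q); rewrite ?mK' ?sK.
      - by move=> x; rewrite mK' => /h3->; rewrite in_fset1 fL.
  + split=> k kK; apply/fsetP=> x; rewrite shiftP; last by rewrite !mI -pI.
    have mX y : (y \in X `\` shift b L) = (f y \in iX `\ beta).
      by rewrite in_fsetD shiftP in_fsetD1 fb (f_eq fL) (in_per Lg fL _ pX).
    by rewrite !mX; move: kK; rewrite mK' => /k4 e; rewrite -{2}e shiftP raddfB.
  + move=> x /seqdiffP; rewrite count_Sseq => lx; rewrite mI; apply: k6.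
    by have := free_im fL a2 a3 lx; rewrite /= i1 i2 eB.
  + exists (s g); apply/fsetP=> x; rewrite in_fsetD mI in_fsetU !(in_cl_im fL) i1 i2.
    by rewrite shiftP mK' raddfB sK -shiftP -k7 in_fsetD in_fsetU.
  rewrite -/(ssum X [:: B1; B2]) eY; split=> // [x|].
    by rewrite sW sX.
  by rewrite -/m cW /= i1 i2 -eB cX -mulnDl; congr muln; move: k11 nm; clear; nlia.
case: struct => [|[hf hu]]; first by rewrite leqNgt small.
have [Bs [cB e eY [hf' hu']]] := trivial_structure iX0 n0 (hn Q) cA0 small hf hu.
have [As [a1 a2 a3 a4]] := lift Bs cB; have [b1 b2 b3 b4] := cB.
exists As; split=> //; rewrite -a1 in eY; have eYW := YW _ eY.
have W0 : ssum iX Bs != fset0 by apply: ssum_neq0.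
have eZ x : all (fun A => in_sum_pred A (stab (ssum X As)) x) As =
   all (fun B => f x \in sumset B (Stab (ssum iX Bs))) Bs.
  rewrite -{2}a1 all_map; apply: eq_all => A /=; rewrite /in_sum_pred; apply/hasP/in_cl => [[a aA ha]|[_ /imP[a aA ->] ha]].
    by exists (f a); rewrite ?mem_im // -raddfB in_Stab // -a1 -stW.
  by exists a; rewrite // stW a1 raddfB -in_Stab.
apply: Or32; rewrite -/(ssum X As) eYW; split=> // [|x /seqdiffP|A AAs].
- by apply: (equitable_im fL) => //; rewrite a1.
- by rewrite count_Sseq eZ => lx; apply: hf'; rewrite -a1; apply: (free_im fL).
rewrite leqNgt; apply/negP=> /two_of[x [y []]]; rewrite !inE !eZ => /andP[xA Zx] /andP[yA Zy] /negP; apply.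
apply/eqP/(a2 A) => //; rewrite -(f_eq fL); apply/eqP.
have iA : im f A \in Bs by rewrite -a1 map_f.
by apply: hu' iA _ _ _ _ _ _; rewrite ?mem_im.
Qed.

Lemma theorem_at_all n G : theorem_at G n.
Proof.
elim/ltn_ind: n G => n IH; apply: theorem_at_step => Q n2; apply: IH.
by case: n n2.
Qed.

Local Open Scope fset_scope.

Theorem theorem1p1 (G : zmodType) (n : nat) (X L : {fset G}) (S S' : seq G) :
  (1 <= n)%N ->
  X != fset0 ->
  is_subgroup L -> {subset L <= stab X} ->
  subseqm S' S ->
  (hmult (map (phi L) S') <= n <= size S')%N ->
  exists As : seq {fset G},
    [/\ size As = n, is_setpartition As,
        subseqm (Sseq As) S, size (Sseq As) = size S' &
        forall A, A \in As -> #|` phi_set L A| = #|` A| ] /\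
    let Y := sumset X (Sigma_n n S) in
    let W := sumset X (bigsumset As) in
    [\/
      (* case 1 *)
      [/\ (#|` W| <= #|` Y|)%N,
       ((size S' - n) * #|` L| + #|` X| <= #|` W|)%N & equitable As],
      (* case 2 *)
      (let H := stab Y in
       let Z := fun x => all (fun A => in_sum_pred A H x) As in
       [/\ Y = W, equitable As,
           forall x, x \in seqdiff S (Sseq As) -> Z x &
           forall A, A \in As -> (#|` [fset a in A | ~~ Z a]| <= 1)%N])
    | (* case 3 *)
      n = 2%N /\
      exists A1 A2 : {fset G}, As = [:: A1; A2] /\
      exists beta : G, exists K : {fset G},
        let I := sumset A1 L `&` sumset A2 L in
        [/\ [/\ beta \in X, is_subgroup K, L `<=` K & quot_is_Z2xZ2 K L],
            periodic K (X `\` shift beta L) /\ periodic K I,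
            forall x, x \in seqdiff S (Sseq As) -> x \in I,
            (exists g, (sumset A1 L `|` sumset A2 L) `\` I = shift g K) &
            [/\ forall g, stab Y g = stab W g, forall g, stab W g = stab X g,
                forall g, stab X g = (g \in L) &
                #|` Y| = ((size S' - n) * #|` L| + #|` X|)%N]]].
Proof. exact: theorem_at_all. Qed.
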